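(* Let $\alpha=\frac N2$ and let $(v,q)$ be a self-similar profile pair on $\mathbb R^N$ with exponent $\alpha=\frac N2$, i.e. $\nabla\cdot v=0$ and $\frac{1}{1+\alpha}\,y\cdot\nabla v+\frac{\alpha}{1+\alpha}\,v=v\cdot\nabla v+\nabla q$ on $\mathbb R^N$. Suppose $v\in L^2(\mathbb R^N)\cap C^1_{loc}(\mathbb R^N)$ and that $q$ is the associated pressure of $v$. Suppose there exist $\delta>0$ and $C,c>0$ such that $$\frac{c}{|y|^{N+1-\delta}}\le |v(y)|\le C|y|^{1-\delta}$$ for all sufficiently large $|y|$. Then $v=0$. (Equivalently, since $v=0$ contradicts the lower bound, no such $v$ exists.)
   Context: $N\ge 2$ is the space dimension; $v:\mathbb R^N\to\mathbb R^N$ is a vector field and $q:\mathbb R^N\to\mathbb R$ a scalar function; the equations are understood in the sense of distributions. These are the equations of the profile of a self-similar solution $u(x,t)=t^{-\alpha/(1+\alpha)}v(x\,t^{-1/(1+\alpha)})$, $p(x,t)=t^{-2\alpha/(1+\alpha)}q(x\,t^{-1/(1+\alpha)})$, $t>0$, of the incompressible Euler equations $u_t+u\cdot\nabla u+\nabla p=0$, $\nabla\cdot u=0$ (collapse at time $t=0$, time reversed). Associated pressure: $q$ is given by $$q(y)=-\frac{|v(y)|^2}{N}+\mathrm{P.V.}\int_{\mathbb R^N}K_{ij}(y-z)\,v_i(z)v_j(z)\,dz,\qquad K_{ij}(y)=\frac{N y_iy_j-\delta_{ij}|y|^2}{N\omega_N|y|^{N+2}},$$ with summation over repeated indices, where $\omega_N$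 is the volume of the unit ball in $\mathbb R^N$. *)

(* Defs.v *)
From HB Require Import structures.
From mathcomp Require Import all_boot all_order all_algebra.
From mathcomp Require Import all_classical all_reals all_analysis.

Set Implicit Arguments.
Unset Strict Implicit.
Unset Printing Implicit Defensive.

Import Order.TTheory GRing.Theory Num.Theory.
Import numFieldNormedType.Exports.

Local Open Scope classical_set_scope.
Local Open Scope ring_scope.

Definition rV_display : measure_display. Proof. exact. Qed.

Section measurable_rV.
Context {R : realType} (n : nat).

Let coor : 'I_n -> 'rV[R]_n -> measurableTypeR R := fun i x => x ord0 i.

Let rV_set0 : g_sigma_preimage coor set0.
Proof. exact: sigma_algebra0. Qed.

Let rV_setC A : g_sigma_preimage coor A -> g_sigma_preimage coor (~` A).
Proof. exact: sigma_algebraC. Qed.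

Let rV_bigcup (F : _^nat) : (forall i, g_sigma_preimage coor (F i)) ->
  g_sigma_preimage coor (\bigcup_i (F i)).
Proof. exact: sigma_algebra_bigcup. Qed.

(* The sigma-algebra generated by the coordinates, that is, the Borel
   sigma-algebra of R^n. *)
HB.instance Definition _ := @isMeasurable.Build rV_display
  'rV[R]_n (g_sigma_preimage coor) rV_set0 rV_setC rV_bigcup.

Lemma measurable_coor (i : 'I_n) :
  measurable_fun [set: 'rV[R]_n]
    (fun x : 'rV[R]_n => x ord0 i : measurableTypeR R).
Proof.
move=> _ Y mY; rewrite setTI; apply: sub_sigma_algebra => /=.
rewrite -bigcup_seq/=; exists i => /=; first by rewrite mem_index_enum.
by exists Y => //; rewrite setTI.
Qed.

Lemma measurable_fun_rV d (T : measurableType d) (f : T -> 'rV[R]_n) :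
  (forall i, measurable_fun setT (fun x => f x ord0 i : measurableTypeR R)) ->
  measurable_fun setT f.
Proof.
move=> mf _ A; rewrite setTI => mA.
pose G := [set B : set 'rV[R]_n | measurable (f @^-1` B)].
suff : g_sigma_preimage coor `<=` G by apply.
apply: smallest_sub.
  split; first by rewrite /G/= preimage_set0.
  - by move=> B; rewrite /G/= setTD -preimage_setC => /measurableC.
  - by move=> F mF; rewrite /G/= preimage_bigcup; exact: bigcupT_measurable.
rewrite -bigcup_seq => B [i _] [Y mY <-].
rewrite /G/= !setTI.
by have := mf i measurableT Y mY; rewrite setTI.
Qed.

End measurable_rV.

(* Up to the measurable bijection f, the image of a product of sigma-finite
   measures is a sigma-finite measure. *)
Lemma pushforward_prod_sigma_finite d1 d2 d3 (T1 : measurableType d1)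
    (T2 : measurableType d2) (T3 : measurableType d3) (R : realType)
    (m1 : {sigma_finite_measure set T1 -> \bar R})
    (m2 : {sigma_finite_measure set T2 -> \bar R})
    (f : T1 * T2 -> T3) (g : T3 -> T1 * T2) :
  measurable_fun setT f -> measurable_fun setT g -> cancel f g ->
  exists m : {sigma_finite_measure set T3 -> \bar R},
    m = pushforward (m1 \x m2)%E f :> (set _ -> _).
Proof.
move=> mf mg fK.
have mpre A : measurable A -> measurable (f @^-1` A).
  by move=> mA; rewrite -[X in measurable X]setTI; exact: mf.
pose P : {measure set (T1 * T2) -> \bar R} := (m1 \x m2)%E.
pose M : set T3 -> \bar R := pushforward P f.
have sf : sigma_finite setT M.
  have /sigma_finiteP[F [FT ndF Foo]] := sigma_finiteT m1.
  have /sigma_finiteP[G [GT ndG Goo]] := sigma_finiteT m2.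
  exists (fun k => g @^-1` (F k `*` G k)).
    rewrite -preimage_bigcup; apply/esym/seteqP; split=> // z _ /=.
    have : (\bigcup_i F i) (g z).1 by rewrite -FT.
    have : (\bigcup_i G i) (g z).2 by rewrite -GT.
    move=> [k _ Gk] [l _ Fl]; exists (maxn k l) => //=; split.
      by move: Fl; exact/subsetPset/ndF/leq_maxr.
    by move: Gk; exact/subsetPset/ndG/leq_maxl.
  move=> k; have [mF Fk] := Foo k; have [mG Gk] := Goo k; split.
    by rewrite -[X in measurable X]setTI; apply: mg => //; exact: measurableX.
  rewrite /M /pushforward -comp_preimage (_ : _ \o _ = id) //.
    by rewrite [ltLHS](product_measure1E m1 m2 mF mG) lte_mul_pinfty// ge0_fin_numE.
  by apply/funext => p /=; exact: fK.
have M0 : M set0 = 0%E by rewrite /M /pushforward preimage_set0 measure0.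
have Mge0 A : (0 <= M A)%E by exact: measure_ge0.
have Madd : semi_sigma_additive M.
  move=> F mF tF mUF; rewrite /M /pushforward preimage_bigcup.
  apply: measure_semi_sigma_additive.
  - by move=> k; exact: mpre.
  - apply/trivIsetP => /= i j _ _ ij; rewrite -preimage_setI.
    by move/trivIsetP : tF => /(_ _ _ _ _ ij) ->//; rewrite preimage_set0.
  - by rewrite -preimage_bigcup; exact: mpre.
pose mixin := isMeasure.Build _ _ _ M M0 Mge0 Madd.
pose Mm : {measure set T3 -> \bar R} := HB.pack M mixin.
pose mixin2 := Measure_isSigmaFinite.Build _ _ _ Mm sf.
pose Ms : {sigma_finite_measure set T3 -> \bar R} := HB.pack M mixin mixin2.
by exists Ms.
Qed.

Section lebesgue_rV.
Context {R : realType}.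
Local Open Scope ereal_scope.

Definition rV_cons n (p : measurableTypeR R * 'rV[R]_n) : 'rV[R]_n.+1 :=
  row_mx (const_mx p.1 : 'rV_1) p.2.

(* Lebesgue measure on R^n, built as an iterated product; lebesgue_rV_box below
   shows that it has the expected values on boxes. *)
Fixpoint lebesgue_rV n : set 'rV[R]_n -> \bar R :=
  match n with
  | 0 => @dirac _ 'rV[R]_0 0%R R
  | m.+1 => pushforward (lebesgue_measure \x @lebesgue_rV m) (@rV_cons m)
  end.

Lemma rV_consE0 n (p : measurableTypeR R * 'rV[R]_n) :
  rV_cons p ord0 ord0 = p.1.
Proof.
have := row_mxEl (const_mx p.1 : 'rV_1) p.2 ord0 ord0.
rewrite [X in _ = X]mxE; apply: etrans.
by congr (row_mx _ _ _ _); exact: val_inj.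
Qed.

Lemma rV_consES n (p : measurableTypeR R * 'rV[R]_n) i :
  rV_cons p ord0 (lift ord0 i) = p.2 ord0 i.
Proof.
apply: etrans (row_mxEr (const_mx p.1 : 'rV_1) p.2 ord0 i).
by congr (row_mx _ _ _ _); exact: val_inj.
Qed.

Lemma measurable_rV_cons n : measurable_fun setT (@rV_cons n).
Proof.
apply: measurable_fun_rV => i.
have [->|[j ->]] : i = ord0 \/ exists j, i = lift ord0 j.
  by case: (unliftP ord0 i) => [j ->|->]; [right; exists j|left].
  by under eq_fun do rewrite rV_consE0; exact: measurable_fst.
under eq_fun do rewrite rV_consES.
apply: (@measurableT_comp _ _ _ _ _ _
  (fun x : 'rV[R]_n => x ord0 j : measurableTypeR R)).
  exact: measurable_coor.
exact: measurable_snd.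
Qed.

Let uncons n (x : 'rV[R]_n.+1) : measurableTypeR R * 'rV[R]_n :=
  (x ord0 ord0, \row_i x ord0 (lift ord0 i)).

Let rV_consK n : cancel (@rV_cons n) (@uncons n).
Proof.
move=> p; rewrite /uncons rV_consE0 [p in RHS]surjective_pairing; congr pair.
by apply/rowP => i; rewrite mxE rV_consES.
Qed.

Let measurable_uncons n : measurable_fun setT (@uncons n).
Proof.
apply/measurable_fun_pairP; split; first exact: measurable_coor.
apply: measurable_fun_rV => i.
by under eq_fun do rewrite /= mxE; exact: measurable_coor.
Qed.

Let lebesgue_rV_subproof n :
  exists m : {sigma_finite_measure set 'rV[R]_n -> \bar R},
    m = @lebesgue_rV n :> (set _ -> _).
Proof.
elim: n => [|n [m mE]]; first by exists (@dirac _ 'rV[R]_0 0%R R).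
have [M ME] := pushforward_prod_sigma_finite lebesgue_measure m
  (@measurable_rV_cons n) (@measurable_uncons n) (@rV_consK n).
by exists M; rewrite ME mE.
Qed.

Section instances.
Variable n : nat.

Let lebesgue_rV0 : @lebesgue_rV n set0 = 0.
Proof. by have [m <-] := lebesgue_rV_subproof n; exact: measure0. Qed.

Let lebesgue_rV_ge0 A : 0 <= @lebesgue_rV n A.
Proof. by have [m <-] := lebesgue_rV_subproof n; exact: measure_ge0. Qed.

Let lebesgue_rV_sigma_additive : semi_sigma_additive (@lebesgue_rV n).
Proof.
by have [m <-] := lebesgue_rV_subproof n; exact: measure_semi_sigma_additive.
Qed.

HB.instance Definition _ := isMeasure.Build _ _ _ (@lebesgue_rV n)
  lebesgue_rV0 lebesgue_rV_ge0 lebesgue_rV_sigma_additive.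

Let lebesgue_rV_sigma_finite : sigma_finite setT (@lebesgue_rV n).
Proof. by have [m <-] := lebesgue_rV_subproof n; exact: sigma_finiteT. Qed.

HB.instance Definition _ := Measure_isSigmaFinite.Build _ _ _ (@lebesgue_rV n)
  lebesgue_rV_sigma_finite.

End instances.

Lemma lebesgue_rV_box n (A : 'I_n -> set R) : (forall i, measurable (A i)) ->
  lebesgue_rV [set x : 'rV[R]_n | forall i, A i (x ord0 i)] =
  \prod_(i < n) lebesgue_measure (A i).
Proof.
elim: n A => [|n IH] A mA.
  by rewrite big_ord0 /= diracE mem_set// => -[].
pose B := [set x : 'rV[R]_n | forall i, A (lift ord0 i) (x ord0 i)].
have mB : measurable B.
  rewrite (_ : B = \bigcap_(i in [set: 'I_n])
      ((fun x : 'rV[R]_n => x ord0 i : measurableTypeR R) @^-1` A (lift ord0 i))).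
    apply: fin_bigcap_measurable; first exact: finite_finset.
    move=> i _; rewrite -[X in measurable X]setTI.
    exact: (measurable_coor i measurableT (mA (lift ord0 i))).
  by apply/seteqP; split=> [x Bx i _|x Bx i]; exact: Bx.
rewrite big_ord_recl -IH// -product_measure1E//; last exact: (mA ord0).
rewrite /= /pushforward; congr (_ _).
apply/seteqP; split=> [p pA|p [pA0 pA1]] /=.
  split=> [|i]; first by have := pA ord0; rewrite rV_consE0.
  by have := pA (lift ord0 i); rewrite rV_consES.
move=> i; case: (unliftP ord0 i) => [j|] ->; last by rewrite rV_consE0.
by rewrite rV_consES; exact: pA1.
Qed.

End lebesgue_rV.

Section euler_profile.
Context {R : realType} {N : nat}.
Implicit Types (x y z : 'rV[R]_N) (f q phi : 'rV[R]_N -> R)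
  (v : 'rV[R]_N -> 'rV[R]_N).

Local Notation mu := (@lebesgue_rV R N).

(* The Euclidean norm: the norm `| x | of the library on 'rV[R]_N is the
   supremum norm. *)
Definition enorm x : R := Num.sqrt (\sum_i x ord0 i ^+ 2).

Definition partial (W : normedModType R) (i : 'I_N) (f : 'rV[R]_N -> W) :
  'rV[R]_N -> W := 'D_(delta_mx ord0 i : 'rV[R]_N) f.

Definition C1 (W : normedModType R) (f : 'rV[R]_N -> W) : Prop :=
  forall i : 'I_N, (forall x, derivable f x (delta_mx ord0 i)) /\
    continuous (partial i f).

Definition smooth f : Prop :=
  forall s : seq 'I_N, C1 (foldr (@partial R) f s : 'rV[R]_N -> R).

Definition test_function phi : Prop :=
  smooth phi /\ compact (closure [set x | phi x != 0]).

Definition loc_integrable f : Prop :=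
  measurable_fun setT f /\
  forall K : set 'rV[R]_N, compact K ->
    (\int[mu]_(x in K) `|f x|%:E < +oo)%E.

(* Distributions are represented by their action on test functions. *)
Definition distribution := ('rV[R]_N -> R) -> R.

Definition distr_of f : distribution :=
  fun phi => \int[mu]_x (f x * phi x).

Definition distr_partial (i : 'I_N) (T : distribution) : distribution :=
  fun phi => - T (partial i phi).

Definition distr_mul (a : 'rV[R]_N -> R) (T : distribution) : distribution :=
  fun phi => T (fun x => a x * phi x).

Definition vcomp v (i : 'I_N) : 'rV[R]_N -> R := fun x => v x ord0 i.

Definition divergence_free v : Prop :=
  forall phi, test_function phi ->
    \sum_(j < N) distr_partial j (distr_of (vcomp v j)) phi = 0.

(* The i-th component of
     1/(1+alpha) y.grad v + alpha/(1+alpha) v = v.grad v + grad q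
   as an equality of distributions. As usual for divergence-free fields, the
   product v.grad v_i is read as sum_j d_j (v_j v_i). *)
Definition profile_momentum (alpha : R) v q : Prop :=
  forall (i : 'I_N) phi, test_function phi ->
    (1 + alpha)^-1 *
      (\sum_(j < N) distr_mul (fun y => y ord0 j)
                      (distr_partial j (distr_of (vcomp v i))) phi) +
    alpha / (1 + alpha) * distr_of (vcomp v i) phi =
    \sum_(j < N) distr_partial j
                   (distr_of (fun y => vcomp v j y * vcomp v i y)) phi +
    distr_partial i (distr_of q) phi.

(* Local integrability is what gives v, v (x) v and q a meaning as
   distributions. *)
Definition self_similar_profile (alpha : R) v q : Prop :=
  [/\ forall i, loc_integrable (vcomp v i),
      forall i j, loc_integrable (fun y => vcomp v i y * vcomp v j y),
      loc_integrable q,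
      divergence_free v &
      profile_momentum alpha v q].

Definition unit_ball_volume : R := fine (mu [set x | enorm x < 1]).

Definition pressure_kernel (i j : 'I_N) y : R :=
  (N%:R * y ord0 i * y ord0 j - (i == j)%:R * enorm y ^+ 2) /
  (N%:R * unit_ball_volume * enorm y ^+ (N + 2)).

Definition is_principal_value (y : 'rV[R]_N) f (l : R) : Prop :=
  (forall e : R, 0 < e ->
    mu.-integrable [set z | e < enorm (y - z)] (EFin \o f)) /\
  \int[mu]_(z in [set z | e < enorm (y - z)]) f z @[e --> 0^'+] --> l.

Definition associated_pressure v q : Prop :=
  forall y, exists2 l : R,
    is_principal_value y
      (fun z => \sum_(i < N) \sum_(j < N)
         pressure_kernel i j (y - z) * vcomp v i z * vcomp v j z) l &
    q y = - (enorm (v y) ^+ 2 / N%:R) + l.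

Definition square_integrable v : Prop :=
  forall i, vcomp v i \in Lfun mu 2%:E.

End euler_profile.

(* Main.v *)
(** Testing the profile equation with phi v, phi a cutoff of the shell |y| ~ R,
    bounds the energy of that shell by the integrals of |v|^2 g and q g, where
    g = v . grad phi = O(R^-1 |v|) is a divergence.  The coefficient of the energy
    without derivative vanishes exactly for alpha = N / 2.

    The pressure is never represented by a singular integral.  Testing the momentum
    equation with grad psi kills every term but q Delta psi and v_i v_j D_ij psi.
    Take for psi the correlation of g with the difference of the fundamental
    solution smoothed at the scales e and T; then Delta psi is a mollification of g
    at scale e minus one at scale T, and the latter is negligible as T tends to
    infinity, again by the momentum equation.  Near the shell, D_ij psi is
    controlled in L^2, since the sum of the squares of the D_ij psi has the same
    integral as (Delta psi)^2; far from it, |D_ij psi| <= C R^-N |g|_1, and the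
    lower bound R^(N+1-delta) |v| >= c turns |g|_1 into the energy of the shell.

    Hence the energy on a shell of radius R is at most C R^-delta times the energy
    on a slightly larger one.  Iterating, it decays faster than every power of R,
    which contradicts the lower bound on |v|. *)

Require Import Defs.
From HB Require Import structures.
From mathcomp Require Import all_boot all_order all_algebra.
From mathcomp Require Import all_classical all_reals all_analysis.
From mathcomp Require Import measurable_realfun.
From mathcomp Require Import ring lra.

Set Implicit Arguments.
Unset Strict Implicit.
Unset Printing Implicit Defensive.

Import Order.TTheory GRing.Theory Num.Theory.
Import numFieldNormedType.Exports.
Local Open Scope classical_set_scope.
Local Open Scope ring_scope.

(** * Lebesgue measure on R^n *)

Section lebesgue_rV_theory.
Context {R : realType} {N : nat}.
Local Notation X := 'rV[R]_N.
Local Notation mu := (@lebesgue_rV R N).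

(** The tail at scale T is negligible because g = div F with F = phi v. Mollified at scale T, F is
    O(T^-N) with gradient O(T^-(N+1)), on a region of size T. Against |v| <= T |v|^2 + 1/T the
    momentum equation bounds the pairing with q by O(T^(1-N) + 1/T), which vanishes in the limit
    since N >= 2. Every term of the shell inequality has the size (b/R) times the energy, where b =
    R^(1-delta). The convective term has |v| <= C b and |g| <= C |v| / R. The near part of the
    pressure is split by Young's inequality with weight 1/(R b): the integral of |v|^4 costs b^2
    times the energy and that of g^2 costs R^-2 times the energy, so both halves are of order b/R.
    In the far part the lower bound reads |v| <= C R^N b |v|^2, which turns R^-N |g|_1 into (b/R)
    times the energy. Finally b/R = R^-delta. The test fields phi v are no smoother than v, which is
    only C^1. Hence the weak identities are first extended from smooth test functions to C^1 ones,
    and derivatives are moved onto kernels or cutoffs rather than taken twice on v. *)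

Definition box (A : 'I_N -> set R) : set X := [set x | forall i, A i (x ord0 i)].

Lemma measurable_box (A : 'I_N -> set R) :
  (forall i, measurable (A i)) -> measurable (box A).
Proof.
move=> mA; rewrite (_ : box A = \bigcap_(i in [set: 'I_N])
    ((fun x : X => x ord0 i : measurableTypeR R) @^-1` A i)).
  apply: fin_bigcap_measurable; first exact: finite_finset.
  move=> i _; rewrite -[X in measurable X]setTI.
  exact: (measurable_coor i measurableT (mA i)).
by apply/seteqP; split=> [x Bx i _|x Bx i]; exact: Bx.
Qed.

Lemma lebesgue_box (A : 'I_N -> set R) : (forall i, measurable (A i)) ->
  mu (box A) = (\prod_(i < N) lebesgue_measure (A i))%E.
Proof. exact: lebesgue_rV_box. Qed.

Lemma coor_le_norm (x : X) i : `|x ord0 i| <= `|x|.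
Proof.
rewrite [leRHS]/Num.norm/= mx_normrE.
exact: (le_bigmax _ (fun ij => `|x ij.1 ij.2|) (ord0, i)).
Qed.

Lemma norm_le_coor (x : X) r : 0 <= r -> (forall i, `|x ord0 i| <= r) -> `|x| <= r.
Proof.
move=> r0 xr; rewrite [leLHS]/Num.norm/= mx_normrE bigmax_le//= => -[i j] _ /=.
by rewrite ord1.
Qed.

Definition cube (r : R) : set X := [set x | `|x| <= r].

Lemma cubeE r : 0 <= r -> cube r = box (fun=> `[- r, r]%classic).
Proof.
move=> r0; apply/seteqP; split=> x /=.
  by move=> xr i; rewrite /= in_itv/= -ler_norml (le_trans (coor_le_norm x i)).
by move=> xr; apply: norm_le_coor => // i; have := xr i; rewrite /= in_itv/= -ler_norml.
Qed.

Lemma measurable_cube r : measurable (cube r).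
Proof.
have [r0|r0] := leP 0 r; first by rewrite cubeE//; exact: measurable_box.
rewrite (_ : cube r = set0)//; apply/seteqP; split=> x //= xr.
by have := le_lt_trans (le_trans (normr_ge0 x) xr) r0; rewrite ltxx.
Qed.

Lemma lebesgue_cube r : 0 <= r -> mu (cube r) = ((2 * r) ^+ N)%:E.
Proof.
move=> r0; rewrite cubeE//; apply: (etrans (lebesgue_box _)) => [i//|].
rewrite -[X in (_ ^+ X)%:E]card_ord -prodr_const -prodEFin; apply: eq_bigr => i _.
rewrite lebesgue_measure_itv/= lte_fin; case: ltP => [_|r0'].
  by rewrite -EFinB; congr EFin; ring.
by congr EFin; lra.
Qed.

Let boxes : set (set X) :=
  [set B | exists2 A, (forall i, measurable (A i)) & B = box A].

Lemma measurable_rVE : @measurable _ X = <<s boxes >>.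
Proof.
apply/seteqP; split=> [B|]; last first.
  apply: smallest_sub; first exact: sigma_algebra_measurable.
  by move=> _ [A mA ->]; exact: measurable_box.
apply: smallest_sub; first exact: smallest_sigma_algebra.
rewrite -bigcup_seq => C [i _] [Y mY <-].
apply: sub_sigma_algebra; exists (fun j => if j == i then Y else setT).
  by move=> j; case: ifP.
rewrite setTI; apply/seteqP; split=> x /=.
  by move=> Yx j; case: ifP => // /eqP ->.
by move=> /(_ i); rewrite eqxx.
Qed.

Lemma lebesgue_measure_shift (a : R) (A : set R) : measurable A ->
  lebesgue_measure ((fun x => x + a) @^-1` A) = lebesgue_measure A.
Proof.
move=> mA.
have mf : measurable_fun setT ((fun x => x + a) : measurableTypeR R -> measurableTypeR R).
  by apply: measurable_funD.
pose f_mix := isMeasurableFun.Build _ _ _ _ _ mf.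
pose f : {mfun (measurableTypeR R) >-> (measurableTypeR R)} :=
  MeasurableFun.Pack (MeasurableFun.Class f_mix).
apply/esym; apply: (@lebesgue_measure_unique R (pushforward lebesgue_measure f)) => //.
move=> _ [[u v]] _ <-; rewrite /pushforward /=.
rewrite [X in _ = lebesgue_measure X](_ : _ = `]u - a, v - a]%classic); last first.
  by apply/seteqP; split=> x /=; rewrite !in_itv/= ltrBlDr lerBrDr.
rewrite !lebesgue_measure_itv/= !lte_fin ltrD2r.
by rewrite -!EFinB opprB addrA subrK.
Qed.

Lemma measurable_translation (a : X) : measurable_fun setT (fun x : X => x + a).
Proof.
apply: measurable_fun_rV => i; under eq_fun do rewrite mxE.
by apply: measurable_funD => //; exact: measurable_coor.
Qed.

Definition translation (a : X) : {mfun X >-> X} := MeasurableFun.Pack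
  (MeasurableFun.Class (isMeasurableFun.Build _ _ _ _ _ (measurable_translation a))).

(** Uniqueness of measures: the boxes generate the sigma-algebra and are stable under intersection,
    the cubes of integer radius exhaust the space with finite measure, and on a box the claim is a
    product of one-dimensional translations. *)
Lemma lebesgue_rV_shift (a : X) (A : set X) : measurable A ->
  pushforward mu (translation a) A = mu A.
Proof.
move=> mA; apply/esym.
pose g k : set X := box (fun=> `[- k%:R, k%:R]%classic).
apply: (@measure_unique _ _ _ boxes g measurable_rVE) => //.
- move=> _ _ [A1 mA1 ->] [A2 mA2 ->]; exists (fun i => A1 i `&` A2 i).
    by move=> i; exact: measurableI.
  apply/seteqP; split=> x /= => [[h1 h2] i|h]; first by split.
  by split=> i; have [] := h i.
- by move=> k; exists (fun=> `[- k%:R, k%:R]%classic).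
- apply/seteqP; split=> // x _ /=.
  exists (Num.truncn `|x|).+1 => //= i; rewrite /= in_itv/= -ler_norml.
  by apply: le_trans (coor_le_norm x i) _; exact/ltW/truncnS_gt.
- move=> _ [B mB ->]; apply: (etrans (lebesgue_box mB)); rewrite /pushforward.
  rewrite [X in _ = mu X](_ : _ = box (fun i => (fun x => x + a ord0 i) @^-1` B i)); last first.
    by apply/seteqP; split=> x /= h i; have := h i; rewrite !mxE.
  apply/esym/(etrans (lebesgue_box _)) => [i|]; last first.
    by apply: eq_bigr => i _; rewrite lebesgue_measure_shift.
  rewrite -[X in measurable X]setTI.
  suff mf : measurable_fun setT ((fun x => x + a ord0 i) : measurableTypeR R -> measurableTypeR R).
    exact: (mf measurableT _ (mB i)).
  by apply: measurable_funD.
- by move=> k; rewrite /g -cubeE// [ltLHS](lebesgue_cube _)// ltry.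
Qed.

End lebesgue_rV_theory.

(** * Open sets and continuous functions of compact support *)

Section integration.
Context {R : realType} {N : nat}.
Local Notation X := 'rV[R]_N.
Local Notation mu := (@lebesgue_rV R N).
Implicit Types f g u : X -> R.

(** The sigma-algebra is generated by the coordinates, so an open set is written as the countable
    union of the boxes with rational centre and radius 1/(n+1) that it contains. *)
Lemma open_measurable_rV (U : set X) : open U -> measurable U.
Proof.
move=> oU.
pose c (p : 'rV[rat]_N * nat) : set X :=
  box (fun i => `](ratr (p.1 ord0 i)) - p.2.+1%:R^-1, ratr (p.1 ord0 i) + p.2.+1%:R^-1[%classic).
pose F p : set X := if `[< c p `<=` U >] then c p else set0.
rewrite (_ : U = \bigcup_p F p).
  apply: countable_bigcupT_measurable => [|p]; first exact: countableP.
  rewrite /F; case: ifP => // _; apply: measurable_box => i; exact: measurable_itv.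
apply/seteqP; split=> [x Ux|x [p _]]; last first.
  by rewrite /F; case: ifPn => // /asboolP cU /cU.
have /nbhs_ballP[e /= e0 eU] : nbhs x U by exact: open_nbhs_nbhs.
(* The rational centre is within 1/(n+1) of x in each coordinate, so all points of the box are
   within 2/(n+1) of x. *)
pose n := Num.truncn (2 / e).
have ne : 2 / n.+1%:R < e.
  by rewrite ltr_pdivrMr// mulrC -ltr_pdivrMr// truncnS_gt.
have n0 : 0 < n.+1%:R^-1 :> R by rewrite invr_gt0.
have /choice[q qx] : forall i, exists q : rat,
    ratr q \in `]x ord0 i - n.+1%:R^-1, x ord0 i + n.+1%:R^-1[.
  by move=> i; apply: rat_in_itvoo; rewrite ltrBlDr -addrA ltrDl addr_gt0.
exists (\row_i q i, n) => //; rewrite /F; case: ifPn => [_|/asboolPn]; last first.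
  move=> /existsNP[y /not_implyP[cy nUy]]; exfalso; apply/nUy/eU.
  rewrite mx_norm_ball /ball_/=.
  apply: le_lt_trans ne; apply: norm_le_coor => [|i]; first by rewrite divr_ge0.
  have := cy i; rewrite /= !mxE in_itv/=; have := qx i; rewrite in_itv/=.
  move: (n.+1%:R^-1 : R) => t.
  rewrite ler_norml => /andP[] ? ? /andP[? ?]; apply/andP; split; lra.
by move=> i; rewrite /= !mxE in_itv/=; have := qx i; rewrite in_itv/=; move: (n.+1%:R^-1 : R) => t /andP[? ?]; apply/andP; split; lra.
Qed.

Lemma closed_measurable_rV (U : set X) : closed U -> measurable U.
Proof.
by move=> cU; rewrite -(setCK U); apply: measurableC; apply: open_measurable_rV; exact: closed_openC.
Qed.

Lemma continuous_measurable f : continuous f -> measurable_fun setT f.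
Proof.
move=> /continuousP cf; apply: (measurability _ (RGenOpens.measurableE R)).
move=> _ [_ [a [b ->] <-]]; rewrite setTI; apply: open_measurable_rV.
exact/cf/interval_open.
Qed.

Lemma continuous_bounded_cube f r : continuous f -> exists2 M, 0 <= M & forall x, `|x| <= r -> `|f x| <= M.
Proof.
have [r0|r0 _] := leP 0 r; last first.
  by exists 0 => // x xr; have := le_lt_trans (le_trans (normr_ge0 x) xr) r0; rewrite ltxx.
move=> cf.
have cK : compact (cube r : set X).
  by rewrite cubeE//; apply: (@rV_compact _ N (fun=> `[- r, r]%classic)) => _; exact: segment_compact.
have [||c _ cmax] := @EVT_max_rV R N (fun x => `|f x|) (cube r) _ cK.
- by exists 0; rewrite /cube/= normr0.
- by apply: continuous_subspaceT => x; apply: continuous_comp; [exact: cf|exact: norm_continuous].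
by exists `|f c| => // x xr; apply: cmax; rewrite inE.
Qed.

Definition supp_in (r : R) f := forall x, r < `|x| -> f x = 0.

Definition Cc (r : R) f := continuous f /\ supp_in r f.

Lemma compact_cube r : compact (cube r : set X).
Proof.
have [r0|r0] := leP 0 r.
  by rewrite cubeE//; apply: (@rV_compact _ N (fun=> `[- r, r]%classic)) => _; exact: segment_compact.
rewrite (_ : cube r = set0); first exact: compact0.
apply/seteqP; split=> x //= xr.
by have := le_lt_trans (le_trans (normr_ge0 x) xr) r0; rewrite ltxx.
Qed.

Lemma Cc_bounded r f : Cc r f -> exists2 M, 0 <= M & forall x, `|f x| <= M.
Proof.
move=> [cf sf]; have [M M0 fM] := continuous_bounded_cube r cf.
by exists M => // x; have [/fM//|/sf ->] := leP `|x| r; rewrite normr0.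
Qed.

Lemma Cc_unif r f : Cc r f -> forall e, 0 < e -> exists2 d, 0 < d &
  forall x h : X, `|h| <= d -> `|f (x + h) - f x| <= e.
Proof.
move=> [cf sf] e e0.
(* The margin 1 matters: for |h| <= 1 and x outside the cube of radius r + 1, both x and x + h lie
   outside the support. Uniformity is thus needed on a compact cube only. *)
have /compact_near_coveringP cK := @compact_cube (r + 1).
have near0 : \forall h \near (0 : X), cube (r + 1) `<=` (fun x : X => `|f (x + h) - f x| < e).
  apply: (cK X (nbhs (0 : X)) (fun h x => `|f (x + h) - f x| < e)) => x _.
  have : (f (y.1 + y.2) - f y.1) @[y --> (x, 0 : X)] --> f (x + 0) - f x.
    apply: cvgB.
      apply: (@cvg_comp _ _ _ (fun y : X * X => y.1 + y.2) f _ (nbhs (x + 0))); last exact: cf.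
      by apply: cvgD; [exact: cvg_fst|exact: cvg_snd].
    by apply: cvg_comp; [exact: cvg_fst|exact: cf].
  rewrite addr0 subrr => /cvgr0Pnorm_lt/(_ e e0).
  by [].
have /nbhs_ballP[d /= d0 dP] := near0.
exists (Num.min (d / 2) 1); first by rewrite lt_min divr_gt0//=.
move=> x h; rewrite le_min => /andP[hd h1].
have [xr|rx] := leP `|x| (r + 1).
  apply/ltW/dP => //; rewrite mx_norm_ball /ball_/= sub0r normrN.
  by apply: le_lt_trans hd _; rewrite ltr_pdivrMr// mulr_natr mulr2n ltrDl.
rewrite !sf ?subrr ?normr0 ?ltW//; first lra.
by have := ler_normB (x + h) h; rewrite addrK; lra.
Qed.

Definition itg f := mu.-integrable setT (EFin \o f).
Definition Int f : R := \int[mu]_x f x.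
End integration.

(** * Calculus of the integral and its translation invariance *)

Section integral_algebra.
Context {R : realType} {N : nat}.
Local Notation X := 'rV[R]_N.
Local Notation mu := (@lebesgue_rV R N).
Implicit Types f g u : X -> R.
Local Notation itg := (@itg R N).
Local Notation Int := (@Int R N).

Lemma itg_meas f : itg f -> measurable_fun setT f.
Proof. by move=> /measurable_int /measurable_EFinP. Qed.

Lemma itg_le f g : measurable_fun setT f -> itg g ->
  (forall x, `|f x| <= g x) -> itg f.
Proof.
move=> mf ig fg; apply: (le_integrable _ _ _ ig) => //.
  exact/measurable_EFinP.
by move=> x _ /=; rewrite lee_fin (le_trans (fg x))// ler_norm.
Qed.

Lemma itg0 : itg (fun=> 0).
Proof. by rewrite /itg (_ : EFin \o _ = cst 0%E)//; exact: integrable0. Qed.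

Lemma itgD f g : itg f -> itg g -> itg (fun x => f x + g x).
Proof.
move=> fi gi; rewrite /itg (_ : EFin \o _ = (EFin \o f) \+ (EFin \o g))%E//.
exact: integrableD.
Qed.

Lemma itgZ k f : itg f -> itg (fun x => k * f x).
Proof.
move=> fi; rewrite /itg (_ : EFin \o _ = (fun x => k%:E * (f x)%:E)%E)//.
exact: integrableZl.
Qed.

Lemma itgN f : itg f -> itg (fun x => - f x).
Proof. by move=> /(itgZ (-1)); under eq_fun do rewrite mulN1r. Qed.

Lemma itgB f g : itg f -> itg g -> itg (fun x => f x - g x).
Proof. by move=> fi /itgN; exact: itgD. Qed.

Lemma itg_abs f : itg f -> itg (fun x => `|f x|).
Proof. exact: integrable_norm. Qed.

Lemma itg_sum (I : finType) (f : I -> X -> R) :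
  (forall i, itg (f i)) -> itg (fun x => \sum_i f i x).
Proof.
move=> fi; elim: (index_enum I) => [|i s ih].
  by under eq_fun do rewrite big_nil; exact: itg0.
by under eq_fun do rewrite big_cons; exact: itgD.
Qed.

Lemma IntD f g : itg f -> itg g -> Int (fun x => f x + g x) = Int f + Int g.
Proof. by move=> fi gi; rewrite /Int RintegralD. Qed.

Lemma IntB f g : itg f -> itg g -> Int (fun x => f x - g x) = Int f - Int g.
Proof. by move=> fi gi; rewrite /Int RintegralB. Qed.

Lemma IntZ k f : itg f -> Int (fun x => k * f x) = k * Int f.
Proof. by move=> fi; rewrite /Int RintegralZl. Qed.

Lemma IntN f : itg f -> Int (fun x => - f x) = - Int f.
Proof. by move=> fi; rewrite -mulN1r -IntZ//; congr Int; apply/funext => x; rewrite mulN1r. Qed.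

Lemma Int0 : Int (fun=> 0) = 0.
Proof. by rewrite /Int /Rintegral integral0. Qed.

Lemma Int_sum (I : finType) (f : I -> X -> R) : (forall i, itg (f i)) ->
  Int (fun x => \sum_i f i x) = \sum_i Int (f i).
Proof.
move=> fi; elim: (index_enum I) => [|i s ih].
  by rewrite big_nil; under eq_fun do rewrite big_nil; exact: Int0.
rewrite big_cons; under eq_fun do rewrite big_cons; rewrite IntD// ?ih//.
elim: s {ih} => [|j s ih]; first by under eq_fun do rewrite big_nil; exact: itg0.
by under eq_fun do rewrite big_cons; exact: itgD.
Qed.

Lemma Int_le f g : itg f -> itg g -> (forall x, f x <= g x) -> Int f <= Int g.
Proof. by move=> fi gi fg; rewrite /Int; apply: le_Rintegral. Qed.

Lemma Int_ge0 f : (forall x, 0 <= f x) -> 0 <= Int f.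
Proof. by move=> f0; rewrite /Int; apply: Rintegral_ge0. Qed.

Lemma Int_abs f : itg f -> `|Int f| <= Int (fun x => `|f x|).
Proof. by move=> fi; rewrite /Int; apply: le_normr_Rintegral. Qed.

Lemma Int_abs_le f g : measurable_fun setT f -> itg g ->
  (forall x, `|f x| <= g x) -> `|Int f| <= Int g.
Proof.
move=> mf gi fg; have fi := itg_le mf gi fg.
apply: le_trans (Int_abs fi) _; apply: Int_le => //; exact: itg_abs.
Qed.

Lemma measurable_shift f a : measurable_fun setT f ->
  measurable_fun setT (fun x : X => f (x + a)).
Proof. by move=> mf; apply: (measurableT_comp mf (measurable_translation a)). Qed.

Let integral_shift (f : X -> \bar R) (a : X) : measurable_fun setT f ->
  (forall x, 0 <= f x)%E -> (\int[mu]_x f ((x : X) + a)%R = \int[mu]_x f x)%E.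
Proof.
move=> mf f0.
have := @ge0_integral_pushforward _ _ _ _ _ (translation a) (measurable_translation a) mu setT f measurableT mf (fun x _ => f0 x).
rewrite preimage_setT => <-.
by apply: eq_measure_integral => A mA _; exact: lebesgue_rV_shift.
Qed.

Lemma itg_shift f a : itg f -> itg (fun x => f (x + a)).
Proof.
move=> fi; have mf := itg_meas fi.
apply/integrableP; split; first by apply/measurable_EFinP; exact: measurable_shift.
rewrite (@integral_shift (fun x => `|(f x)%:E|%E)) => //.
  by case/integrableP : fi.
by apply: measurableT_comp => //; exact/measurable_EFinP.
Qed.

Lemma Int_shift f a : itg f -> Int (fun x => f (x + a)) = Int f.
Proof.
move=> fi; have mf := itg_meas fi; rewrite /Int /Rintegral; congr fine.
rewrite [LHS]integralE [RHS]integralE; congr (_ - _)%E.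
  rewrite -(@integral_shift ((EFin \o f)^\+)%E a) => [||x].
  - by apply: eq_integral => x _; rewrite unlock.
  - by apply: measurable_funepos; exact/measurable_EFinP.
  - exact: funepos_ge0.
rewrite -(@integral_shift ((EFin \o f)^\-)%E a) => [||x].
- by apply: eq_integral => x _; rewrite unlock.
- by apply: measurable_funeneg; exact/measurable_EFinP.
- exact: funeneg_ge0.
Qed.

Definition cind r (x : X) : R := (`|x| <= r)%R%:R.

Lemma cindE r : cind r = \1_(cube r).
Proof.
apply/funext => x; rewrite /cind indicE; congr (_ %:R).
by congr nat_of_bool; apply/idP/idP; rewrite inE.
Qed.

Lemma itg_cind r : itg (cind r).
Proof.
rewrite cindE; have [r0|r0] := leP 0 r.
  have mc := @measurable_cube R N r.
  apply/integrableP; split; first by apply/measurable_EFinP; exact: measurable_indic.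
  rewrite (eq_integral (fun x => (\1_(cube r) x)%:E)) => [|x _]; last first.
    by rewrite /= ger0_norm.
  by rewrite integral_indic// setIT [ltLHS](lebesgue_cube r0) ltry.
rewrite (_ : cube r = set0) ?indic0; first exact: itg0.
apply/seteqP; split=> x //= xr.
by have := le_lt_trans (le_trans (normr_ge0 x) xr) r0; rewrite ltxx.
Qed.

Lemma Int_cind r : 0 <= r -> Int (cind r) = (2 * r) ^+ N.
Proof.
move=> r0; rewrite cindE /Int /Rintegral integral_indic//; last exact: measurable_cube.
by rewrite setIT [X in fine X](lebesgue_cube r0).
Qed.

Lemma cindT r x : `|x| <= r -> cind r x = 1.
Proof. by rewrite /cind => ->. Qed.

Lemma supp_cind r f x : supp_in r f -> f x = cind r x * f x.
Proof. by move=> sf; rewrite /cind; case: leP => [_|/sf ->]; rewrite /= ?mulr0 ?mul1r. Qed.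

Lemma supp_bound r f M : supp_in r f -> (forall x, `|f x| <= M) ->
  forall x, `|f x| <= M * cind r x.
Proof.
move=> sf fM x; rewrite /cind; case: (leP `|x| r) => [_|/sf ->]; first by rewrite mulr1.
by rewrite mulr0 normr0.
Qed.

Lemma itg_supp r f M : measurable_fun setT f -> supp_in r f ->
  (forall x, `|f x| <= M) -> itg f.
Proof.
move=> mf sf fM; apply: (itg_le mf (itgZ M (itg_cind r))).
exact: supp_bound.
Qed.

Lemma Int_supp r f M : 0 <= r -> measurable_fun setT f -> supp_in r f ->
  (forall x, `|f x| <= M) -> `|Int f| <= M * (2 * r) ^+ N.
Proof.
move=> r0 mf sf fM; rewrite -Int_cind// -IntZ; last exact: itg_cind.
by apply: Int_abs_le => //; [exact/itgZ/itg_cind|exact: supp_bound].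
Qed.

Lemma Cc_itg r f : Cc r f -> itg f.
Proof.
move=> cf; have [M _ fM] := Cc_bounded cf.
by apply: (itg_supp _ cf.2 fM); apply: continuous_measurable; exact: cf.1.
Qed.

Lemma loc_itg_cube u r : loc_integrable u -> itg (fun x => cind r x * u x).
Proof.
move=> [mu_ iu]; have mf : measurable_fun setT (fun x => cind r x * u x).
  apply: measurable_funM => //; exact: itg_meas (itg_cind r).
apply/integrableP; split; first exact/measurable_EFinP.
apply: le_lt_trans (iu _ (@compact_cube R N r)).
rewrite [leRHS]integral_mkcond; apply: ge0_le_integral => //.
- by apply: measurableT_comp => //; exact/measurable_EFinP.
- apply/(measurable_restrictT _ (@measurable_cube R N r)).
  apply: measurable_funTS; apply/measurable_EFinP; exact: measurableT_comp.
move=> x _; rewrite /= patchE /cind; case: ifPn => xr.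
  by rewrite inE in xr; rewrite xr mul1r.
by rewrite (_ : (_ <= _) = false) ?mul0r ?normr0//; apply/negP => xr'; move/negP : xr; rewrite inE.
Qed.

Lemma loc_itgM u r f M : loc_integrable u -> measurable_fun setT f ->
  supp_in r f -> (forall x, `|f x| <= M) -> itg (fun x => u x * f x).
Proof.
move=> iu mf sf fM; have [mu_ _] := iu.
apply: (itg_le _ (itgZ M (itg_abs (loc_itg_cube r iu)))); first exact: measurable_funM.
move=> x; rewrite (supp_cind x sf) (_ : _ * _ = f x * (cind r x * u x)); last by ring.
by rewrite normrM ler_wpM2r.
Qed.

Lemma loc_itg_Cc u r f : loc_integrable u -> Cc r f -> itg (fun x => u x * f x).
Proof.
move=> iu cf; have [M _ fM] := Cc_bounded cf.
by apply: (loc_itgM iu _ cf.2 fM); apply: continuous_measurable; exact: cf.1.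
Qed.

Lemma continuous_loc_integrable f : continuous f -> loc_integrable f.
Proof.
move=> cf; have mf := continuous_measurable cf; split=> // K cK.
have [r Kr] : exists r, forall x, K x -> `|x| <= r.
  have := compact_bounded cK => -[r [_ rP]].
  by exists (r + 1) => x Kx; apply: (rP (r + 1)) => //; rewrite ltrDl.
have [M M0 fM] := continuous_bounded_cube r cf.
have mK : measurable K.
  by apply: closed_measurable_rV; apply: compact_closed => //; exact: norm_hausdorff.
apply: le_lt_trans (_ : \int[mu]_(x in K) M%:E < +oo)%E.
  apply: ge0_le_integral => //.
  - by apply: measurable_funTS; apply/measurable_EFinP; exact: measurableT_comp.
  - by move=> x Kx; rewrite lee_fin fM// Kr.
rewrite integral_cst// lte_mul_pinfty//.
rewrite (@le_lt_trans _ _ (mu (cube `|r|)))//.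
  apply: le_measure; rewrite ?inE//; first exact: measurable_cube.
  by move=> x Kx; rewrite /cube/= (le_trans (Kr x Kx))// ler_norm.
by rewrite [ltLHS](lebesgue_cube (normr_ge0 r)) ltry.
Qed.

End integral_algebra.

(** * Gradients and integration by parts *)

Section gradients.
Context {R : realType} {N : nat}.
Local Notation X := 'rV[R]_N.
Implicit Types (f g u : X -> R) (df dg : 'I_N -> X -> R).
Local Notation Int := (@Int R N).
Local Notation e_ i := (delta_mx ord0 i : X).

(** The gradient is carried as explicit data, so that the formulas for partial derivatives can be
    rewritten. Only derivatives along the coordinate axes are required, as in [C1]. *)
Definition has_grad f df : Prop :=
  (forall i x, is_derive x (e_ i) f (df i x)) /\ forall i, continuous (df i).

Lemma has_grad_C1 f df : has_grad f df -> C1 f.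
Proof.
move=> [fd dfc] i; split=> [x|]; first by have [] := fd i x.
rewrite (_ : partial i f = df i); first exact: dfc.
by apply/funext => x; have [_] := fd i x.
Qed.

Lemma has_grad_partial f df i : has_grad f df -> partial i f = df i.
Proof. by move=> [fd _]; apply/funext => x; have [_] := fd i x. Qed.

Lemma is_derive_line f (x v : X) (t d : R) :
  is_derive (x + t *: v) v f d -> is_derive t (1 : R) (fun s : R => f (x + s *: v)) d.
Proof.
have E : (fun h : R => h^-1 *: ((f \o shift (x + t *: v)) (h *: v) - f (x + t *: v))) =
    (fun h : R => h^-1 *: (((fun s => f (x + s *: v)) \o shift t) (h *: 1) - f (x + t *: v))).
  apply/funext => h /=; rewrite [_%:A]mulr1 scalerDl.
  by rewrite [h *: v + _]addrC -addrA [t *: v + _]addrC.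
by move=> [fd fD]; split; move: fd fD; rewrite /derivable /derive E.
Qed.

Lemma is_derive_ex f (x v : X) (d : R) :
  is_derive (0 : R) (1 : R) (fun s : R => f (x + s *: v)) d -> is_derive x v f d.
Proof.
have E : (fun h : R => h^-1 *: ((f \o shift x) (h *: v) - f x)) =
    (fun h : R => h^-1 *: (((fun s => f (x + s *: v)) \o shift 0) (h *: 1) - f (x + 0 *: v))).
  by apply/funext => h /=; rewrite [_%:A]mulr1 scale0r !addr0 [h *: v + x]addrC.
by move=> [fd fD]; split; move: fd fD; rewrite /derivable /derive E.
Qed.

Lemma MVT_line f df i x (h : R) : has_grad f df ->
  exists2 t, `|t| <= `|h| & f (x + h *: e_ i) - f x = h * df i (x + t *: e_ i).
Proof.
move=> [fd _].
have D t : is_derive t (1 : R) (fun s : R => f (x + s *: e_ i)) (df i (x + t *: e_ i)).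
  exact: is_derive_line.
have C a b : {within `[a, b], continuous (fun s => f (x + s *: e_ i))}.
  by apply: derivable_within_continuous => t _; have [] := D t.
have [h0|h0] := leP 0 h.
  have [t] := @MVT_segment _ _ _ 0 h h0 (fun t _ => D t) (C _ _).
  rewrite in_itv/= scale0r addr0 subr0 => /andP[t0 th] ->.
  by exists t; [rewrite !ger0_norm|rewrite mulrC].
have [t] := @MVT_segment _ _ _ h 0 (ltW h0) (fun t _ => D t) (C _ _).
rewrite in_itv/= scale0r addr0 sub0r => /andP[th t0] E.
exists t; first by rewrite !ler0_norm ?lerN2// ltW.
by rewrite -opprB E; ring.
Qed.

Lemma norm_e i : `|e_ i| <= 1.
Proof.
apply: norm_le_coor => // j; rewrite mxE/=.
by case: eqP => _; rewrite ?normr1 ?normr0.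
Qed.

Lemma norm_Ze i (h : R) : `|h *: e_ i| <= `|h|.
Proof. by rewrite normrZ ler_piMr// norm_e. Qed.

(** Only the partial derivatives are available, so the increment is taken one coordinate at a time,
    with the mean value theorem on each axis. The radius r + 2 contains all intermediate points. *)
Lemma has_grad_lip f df r : has_grad f df ->
  exists2 M, 0 <= M & forall x h, `|x| <= r -> `|h| <= 1 ->
    `|f (x + h) - f x| <= M * `|h|.
Proof.
move=> fdf; have /choice[M MP] : forall i, exists M, 0 <= M /\
    forall x, `|x| <= r + 2 -> `|df i x| <= M.
  move=> i; have [M M0 MP] := continuous_bounded_cube (r + 2) (fdf.2 i).
  by exists M.
exists (\sum_i M i); first by apply: sumr_ge0 => i _; have [] := MP i.
move=> x h xr h1.
(* The first k coordinates of h: a path from 0 to h along the axes. *)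
pose T k : X := \row_i (if (i < k)%N then h ord0 i else 0).
have TS k (kN : (k < N)%N) : T k.+1 = T k + h ord0 (Ordinal kN) *: e_ (Ordinal kN).
  apply/rowP => j; rewrite !mxE eqxx/= ltnS leq_eqVlt -(inj_eq val_inj)/=.
  have [jk|jk] := eqVneq (j : nat) k; last by rewrite /= mulr0 addr0.
  by rewrite jk ltnn/= add0r mulr1; congr (h _ _); exact: val_inj.
have TN k : `|T k| <= `|h|.
  apply: norm_le_coor => // i; rewrite mxE; case: ifP => _; first exact: coor_le_norm.
  by rewrite normr0.
have T0 : T 0%N = 0 by apply/rowP => i; rewrite !mxE ltn0.
have TNN : T N = h by apply/rowP => i; rewrite !mxE ltn_ord.
have H k : (k <= N)%N -> `|f (x + T k) - f x| <= (\sum_(i < N | (i < k)%N) M i) * `|h|.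
  elim: k => [_|k ih kN]; first by rewrite T0 addr0 subrr normr0 big_pred0_eq mul0r.
  rewrite (bigD1 (Ordinal kN))//= mulrDl -(subrK (f (x + T k)) (f _)) -addrA.
  apply: le_trans (ler_normD _ _) _; apply: lerD.
    have [t th] := MVT_line (Ordinal kN) (x + T k) (h ord0 (Ordinal kN)) fdf.
    rewrite -addrA -TS => ->; rewrite normrM mulrC; apply: ler_pM => //.
      apply: (MP _).2; apply: le_trans (ler_normD _ _) _.
      have := ler_normD x (T k); have := TN k; have := norm_Ze (Ordinal kN) t.
      have := coor_le_norm h (Ordinal kN); lra.
    exact: coor_le_norm.
  rewrite (eq_bigl (fun i : 'I_N => (i < k)%N)); first by apply: ih; exact: ltnW.
  by move=> i; rewrite -(inj_eq val_inj)/= ltnS ltn_neqAle andbC.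
have := H N (leqnn _); rewrite TNN => /le_trans; apply; rewrite ler_wpM2r//.
by rewrite [leRHS](eq_bigl (fun i : 'I_N => (i < N)%N))// => i; rewrite ltn_ord.
Qed.

Lemma continuous_eps f : (forall (x : X) e, 0 < e -> exists2 d, 0 < d &
    forall h : X, `|h| <= d -> `|f (x + h) - f x| <= e) -> continuous f.
Proof.
move=> fe x; apply/(@cvgrPdist_le _ _ _ (nbhs x) (nbhs_filter x)) => e e0.
have [d d0 dP] := fe x e e0; apply/nbhs_ballP; exists d => //= y.
rewrite mx_norm_ball /ball_/= distrC => /ltW /dP.
by rewrite [x + _]addrC subrK distrC.
Qed.

Lemma has_grad_continuous f df : has_grad f df -> continuous f.
Proof.
move=> fdf; apply: continuous_eps => x e e0.
have [M M0 MP] := has_grad_lip `|x| fdf.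
exists (Num.min 1 (e / (M + 1))) => /=; first by rewrite lt_min ltr01 divr_gt0// ltr_wpDl.
move=> h; rewrite le_min => /andP[h1 h2].
apply: le_trans (MP x h (lexx _) h1) _.
by move: h2; rewrite ler_pdivlMr ?ltr_wpDl//; have := normr_ge0 h; nra.
Qed.

Lemma has_grad_Cc f df r i : has_grad f df -> supp_in r f -> Cc r (df i).
Proof.
move=> fdf sf; split; first exact: fdf.2.
move=> x rx; have [_ <-] := fdf.1 i x.
rewrite -[RHS](@derive_cst R X R 0 (e_ i) x); apply: near_eq_derive.
apply/nbhs_ballP; exists (`|x| - r) => /=; first by rewrite subr_gt0.
move=> y; rewrite mx_norm_ball /ball_/= => xy; rewrite sf//.
by have := ler_normD (x - y) y; rewrite subrK; lra.
Qed.

Lemma has_grad_Cc0 f df r : has_grad f df -> supp_in r f -> Cc r f.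
Proof. by move=> fdf sf; split => //; exact: has_grad_continuous fdf. Qed.

Lemma diff_quot_unif f df r i : has_grad f df -> supp_in r f ->
  forall e, 0 < e -> exists2 d, 0 < d & forall x (h : R), `|h| <= d ->
    `|f (x + h *: e_ i) - f x - h * df i x| <= e * `|h|.
Proof.
move=> fdf sf e e0; have [d d0 dP] := Cc_unif (has_grad_Cc i fdf sf) e0.
exists d => // x h hd; have [t th ->] := MVT_line i x h fdf.
rewrite -mulrBr normrM mulrC ler_wpM2r// dP//.
exact: le_trans (norm_Ze i t) (le_trans th hd).
Qed.

(** By translation invariance the integral of f(x + h e_i) - f(x) is 0. It differs from h times the
    integral of the derivative by at most e |h| times the volume of a fixed cube, with e
    arbitrary. *)
Lemma Int_grad f df r i : has_grad f df -> supp_in r f -> Int (df i) = 0.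
Proof.
move=> fdf sf; have dfi := Cc_itg (has_grad_Cc i fdf sf).
have fi := Cc_itg (has_grad_Cc0 fdf sf).
(* A cube containing the supports of f and of its translates by steps of length at most 1. The
   absolute value covers a negative r. *)
pose s := `|r| + 1; have s0 : 0 <= s by rewrite addr_ge0.
pose V := (2 * s) ^+ N; have V0 : 0 <= V by rewrite exprn_ge0// mulr_ge0.
have key e : 0 < e -> `|Int (df i)| <= e * V.
  move=> e0; have [d d0 dP] := diff_quot_unif i fdf sf e0.
  pose h := Num.min d 1; have h0 : 0 < h by rewrite lt_min d0 ltr01.
  have hd : `|h| <= d by rewrite gtr0_norm// ge_min lexx.
  have h1 : `|h| <= 1 by rewrite gtr0_norm// ge_min lexx orbT.
  have fsi := itg_shift (h *: e_ i) fi.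
  have E : Int (fun x => f (x + h *: e_ i) - f x - h * df i x) = - (h * Int (df i)).
    rewrite IntB ?IntB ?Int_shift ?IntZ ?subrr ?sub0r//; [exact: itgB|exact: itgZ].
  have : `|h * Int (df i)| <= (e * h) * V.
    rewrite -normrN -E; apply: Int_supp => //.
    - by apply: itg_meas; apply: itgB; [exact: itgB|exact: itgZ].
    - move=> x xs; have hx : `|x| - `|h| <= `|x + h *: e_ i|.
        have := ler_normB (x + h *: e_ i) (h *: e_ i); rewrite addrK.
        by have := norm_Ze i h; lra.
      have rr := ler_norm r; rewrite /s in xs.
      rewrite !sf; [|lra|lra]; rewrite (has_grad_Cc i fdf sf).2; last lra.
      by rewrite subrr mulr0 subr0.
    - by move=> x; have := dP x h hd; rewrite (gtr0_norm h0).
  by rewrite normrM (gtr0_norm h0) (mulrC e) -mulrA ler_pM2l.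
apply/eqP; rewrite -normr_eq0; apply/eqP/le_anti/andP; split => //.
apply/ler_addgt0Pr => e e0; rewrite add0r.
apply: le_trans (key (e / (V + 1)) _) _; first by rewrite divr_gt0// ltr_wpDl.
rewrite mulrAC ler_pdivrMr ?ltr_wpDl//; nra.
Qed.

End gradients.

Section gradient_rules.
Context {R : realType} {N : nat}.
Local Notation X := 'rV[R]_N.
Implicit Types (f g u : X -> R) (df dg : 'I_N -> X -> R).
Local Notation e_ i := (delta_mx ord0 i : X).

Lemma has_grad_ext f df g dg : has_grad f df -> f =1 g -> (forall i, df i =1 dg i) ->
  has_grad g dg.
Proof.
move=> fdf /funext <- E; rewrite (_ : dg = df)//.
by apply/funext => i; apply/funext => x; rewrite E.
Qed.

Lemma has_grad_cst (c : R) : has_grad (fun _ : X => c) (fun _ _ => 0).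
Proof. by split=> [i x|i]; [exact: is_derive_cst|exact: cst_continuous]. Qed.

Lemma has_gradD f df g dg : has_grad f df -> has_grad g dg ->
  has_grad (fun x => f x + g x) (fun i x => df i x + dg i x).
Proof.
move=> [f1 f2] [g1 g2]; split=> [i x|i x]; first exact: is_deriveD.
by apply: continuousD; [exact: f2|exact: g2].
Qed.

Lemma has_gradM f df g dg : has_grad f df -> has_grad g dg ->
  has_grad (fun x => f x * g x) (fun i x => f x * dg i x + g x * df i x).
Proof.
move=> fdf gdg; have [f1 f2] := fdf; have [g1 g2] := gdg.
have cf := has_grad_continuous fdf; have cg := has_grad_continuous gdg.
split=> [i x|i x]; first exact: is_deriveM.
apply: (@continuousD _ _ _ (fun x => f x * dg i x) (fun x => g x * df i x)); apply: continuousM.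
- exact: cf.
- exact: g2.
- exact: cg.
- exact: f2.
Qed.

Lemma has_gradZ (c : R) f df : has_grad f df ->
  has_grad (fun x => c * f x) (fun i x => c * df i x).
Proof.
move=> /(has_gradM (has_grad_cst c)) /has_grad_ext; apply => // i x.
by rewrite mulr0 addr0.
Qed.

Lemma has_grad_sum (I : finType) (F : I -> X -> R) (dF : I -> 'I_N -> X -> R) :
  (forall k, has_grad (F k) (dF k)) ->
  has_grad (fun x => \sum_k F k x) (fun i x => \sum_k dF k i x).
Proof.
move=> H; elim: (index_enum I) => [|k s ih].
  by apply: has_grad_ext (has_grad_cst 0) _ _ => [x|i x]; rewrite big_nil.
by apply: has_grad_ext (has_gradD (H k) ih) _ _ => [x|i x]; rewrite big_cons.
Qed.

Lemma has_grad_coor j : has_grad (fun x : X => x ord0 j) (fun i _ => (i == j)%:R).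
Proof.
split=> [i x|i]; last exact: cst_continuous.
apply: is_derive_ex.
rewrite (_ : (fun s : R => _) = (fun s : R => x ord0 j + s * (i == j)%:R)).
  by apply: is_derive_eq; rewrite !add0r mul1r scaler0 add0r [_%:A]mulr1.
by apply/funext => s; rewrite !mxE eqxx/= eq_sym.
Qed.

Lemma has_grad_comp f df (g g' : R -> R) : has_grad f df ->
  (forall x, is_derive (f x) (1 : R) g (g' (f x))) -> continuous (fun x => g' (f x)) ->
  has_grad (fun x => g (f x)) (fun i x => g' (f x) * df i x).
Proof.
move=> fdf gd cg; split=> [i x|i x].
  apply: is_derive_ex.
  have H : is_derive (0 : R) (1 : R) (fun s : R => f (x + s *: e_ i)) (df i x).
    by apply: is_derive_line; rewrite scale0r addr0; exact: fdf.1.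
  have H2 : is_derive (f (x + 0 *: e_ i)) (1 : R) g (g' (f x)) by rewrite scale0r addr0.
  exact: is_derive1_comp.
by apply: continuousM; [exact: cg|exact: fdf.2].
Qed.

Lemma has_grad_opp f df : has_grad f df ->
  has_grad (fun x => f (- x)) (fun i x => - df i (- x)).
Proof.
move=> fdf; split=> [i x|i x].
  apply: is_derive_ex.
  have H : is_derive (0 : R) (1 : R) (fun s : R => f (- x + s *: e_ i)) (df i (- x)).
    by apply: is_derive_line; rewrite scale0r addr0; exact: fdf.1.
  have H2 : is_derive (- (0 : R)) (1 : R) (fun s : R => f (- x + s *: e_ i)) (df i (- x)) by rewrite oppr0.
  rewrite (_ : (fun s : R => _) = (fun s : R => f (- x + s *: e_ i)) \o -%R).
    by apply: is_derive_eq; rewrite mulrN1.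
  by apply/funext => s /=; rewrite opprD scaleNr.
apply: continuousN; apply: (@continuous_comp _ _ _ (fun x : X => - x) (df i) x); last exact: fdf.2.
exact: opp_continuous.
Qed.

Lemma C1_vcomp (v : X -> X) j : C1 v ->
  has_grad (vcomp v j) (fun i x => partial i v x ord0 j).
Proof.
move=> vC1; split=> [i x|i x]; last first.
  apply: (@continuous_comp _ _ _ (partial i v) (fun y : X => y ord0 j)).
    by have [_] := vC1 i; exact.
  exact: coord_continuous.
have [vd _] := vC1 i; apply: DeriveDef; first exact: ((derivable_mxP _ _ _).1 (vd x) ord0 j).
by rewrite /partial derive_mx ?mxE//; exact: vd.
Qed.

End gradient_rules.

(** * Convolution and its derivatives *)

Section convolution.
Context {R : realType} {N : nat}.
Local Notation X := 'rV[R]_N.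
Implicit Types (f g G : X -> R) (df dg dG : 'I_N -> X -> R).
Local Notation Int := (@Int R N).
Local Notation itg := (@itg R N).
Local Notation e_ i := (delta_mx ord0 i : X).

(* With + instead of the usual -, so that only translation invariance of the
   measure is needed. *)
Definition corr G g (x : X) : R := Int (fun y => G y * g (x + y)).

Lemma corr_itg r s G g x : Cc r G -> Cc s g -> itg (fun y => G y * g (x + y)).
Proof.
move=> cG cg; have [M _ gM] := Cc_bounded cg.
have mG := itg_meas (Cc_itg cG); have mg := itg_meas (Cc_itg cg).
apply: (itg_le _ (itgZ M (itg_abs (Cc_itg cG)))) => [|y].
  apply: measurable_funM => //.
  by under eq_fun do rewrite addrC; exact: measurable_shift.
by rewrite normrM mulrC ler_wpM2r.
Qed.

Lemma corr_sym r s G g x : Cc r G -> Cc s g -> corr G g x = corr g G (- x).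
Proof.
move=> cG cg; rewrite /corr -(@Int_shift _ _ _ (- x)); last exact: (corr_itg x cG cg).
by congr Int; apply/funext => y; rewrite mulrC addrC subrK addrC.
Qed.

Lemma supp_corr r s G g : supp_in r G -> supp_in s g -> supp_in (r + s) (corr G g).
Proof.
move=> sG sg x xrs; rewrite /corr -[RHS](@Int0 R N); congr Int; apply/funext => y.
have [yr|yr] := leP `|y| r; last by rewrite sG// mul0r.
rewrite sg ?mulr0//; have := ler_normB (x + y) y; rewrite addrK; lra.
Qed.

(** The bound on G is required only where g(x + y) does not vanish. Far from the support of g this
    confines a singular kernel to the region where it is small. *)
Lemma corr_bound r s G g M x : Cc r G -> Cc s g ->
  (forall y, g (x + y) != 0 -> `|G y| <= M) -> `|corr G g x| <= M * Int (fun y => `|g y|).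
Proof.
move=> cG cg GM; have ig := itg_abs (Cc_itg cg).
rewrite -(Int_shift x ig) -IntZ; last exact: (itg_shift x ig).
apply: Int_abs_le => [||y]; [exact: itg_meas (corr_itg x cG cg)|exact/itgZ/(itg_shift x ig)|].
rewrite [y + x]addrC normrM; have [->|/GM yM] := eqVneq (g (x + y)) 0.
  by rewrite normr0 !mulr0.
by rewrite ler_wpM2r.
Qed.

Lemma corr_Cc r s G g : Cc r G -> Cc s g -> Cc (r + s) (corr G g).
Proof.
move=> cG cg; split; last by apply: supp_corr; [exact: cG.2|exact: cg.2].
apply: continuous_eps => x e e0.
pose K := Int (fun y => `|G y|); have K0 : 0 <= K by apply: Int_ge0.
have iG := itg_abs (Cc_itg cG).
have [|d d0 dP] := Cc_unif cg (_ : 0 < e / (K + 1)).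
  by rewrite divr_gt0// ltr_wpDl.
exists d => // h hd; rewrite /corr -IntB; [|exact: (corr_itg _ cG cg)|exact: (corr_itg _ cG cg)].
apply: (@le_trans _ _ (e / (K + 1) * K)); last first.
  rewrite mulrAC ler_pdivrMr ?ltr_wpDl//; nra.
rewrite -IntZ//; apply: Int_abs_le => [||y].
- by apply: itg_meas; apply: itgB; exact: (corr_itg _ cG cg).
- exact: itgZ.
rewrite -mulrBr normrM mulrC ler_wpM2r//.
by rewrite [x + h + y](_ : _ = (x + y) + h) ?dP//; rewrite addrAC.
Qed.

Lemma corr_grad r s G g dg : Cc r G -> has_grad g dg -> supp_in s g ->
  has_grad (corr G g) (fun i => corr G (dg i)).
Proof.
move=> cG gdg sg; have cg := has_grad_Cc0 gdg sg.
have cdg i := has_grad_Cc i gdg sg.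
have ig x := corr_itg x cG cg; have idg i x := corr_itg x cG (cdg i).
split=> [i x|i]; last exact: (corr_Cc cG (cdg i)).1.
pose K := Int (fun y => `|G y|); have K0 : 0 <= K by apply: Int_ge0.
have iG := itg_abs (Cc_itg cG).
suff H : (fun h : R => h^-1 *: ((corr G g \o shift x) (h *: e_ i) - corr G g x)) h @[h --> 0^']
    --> corr G (dg i) x.
  apply: DeriveDef; first by apply/cvg_ex; exists (corr G (dg i) x).
  exact/cvg_lim.
apply/cvgrPdist_le => /= e e0.
have [|d d0 dP] := diff_quot_unif i gdg sg (_ : 0 < e / (K + 1)).
  by rewrite divr_gt0// ltr_wpDl.
near=> h.
have h0 : h != 0 by near: h; exact: nbhs_dnbhs_neq.
have hd : `|h| <= d by near: h; apply: dnbhs0_le.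
rewrite distrC -(ler_pM2l (_ : 0 < `|h|)) ?normr_gt0// -normrM mulrBr.
rewrite [h *: e_ i + x]addrC -[h^-1 *: _]/(h^-1 * _) mulVKf//.
rewrite /corr -IntB; [|exact: ig|exact: ig].
rewrite -IntZ; last exact: idg.
rewrite -IntB; [|by apply: itgB; exact: ig|by apply: itgZ; exact: idg].
apply: (@le_trans _ _ (e / (K + 1) * `|h| * K)); last first.
  rewrite mulrAC mulrC ler_wpM2l//.
  rewrite mulrAC ler_pdivrMr ?ltr_wpDl//; nra.
rewrite -IntZ//; apply: Int_abs_le => [||y].
- by apply: itg_meas; apply: itgB; [apply: itgB; exact: ig|apply: itgZ; exact: idg].
- exact: itgZ.
rewrite (_ : _ - _ = G y * (g ((x + y) + h *: e_ i) - g (x + y) - h * dg i (x + y))).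
  by rewrite normrM mulrC ler_wpM2r// dP.
by rewrite [x + h *: _ + y]addrAC; ring.
Unshelve. all: by end_near. Qed.

(** Obtained from [corr_grad] by exchanging the two factors, which reflects x; the reflection is the
    origin of the minus sign. *)
Lemma corr_gradl r s G dG g : has_grad G dG -> supp_in r G -> Cc s g ->
  has_grad (corr G g) (fun i x => - corr (dG i) g x).
Proof.
move=> GdG sG cg; have cG := has_grad_Cc0 GdG sG.
apply: has_grad_ext (has_grad_opp (corr_grad cg GdG sG)) _ _ => [x|i x].
  by rewrite -(corr_sym x cG cg).
by rewrite -(corr_sym x (has_grad_Cc i GdG sG) cg).
Qed.

Lemma corr_gradE r s G dG g dg i x : has_grad G dG -> supp_in r G ->
  has_grad g dg -> supp_in s g -> corr G (dg i) x = - corr (dG i) g x.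
Proof.
move=> GdG sG gdg sg.
have [_ <-] := (corr_grad (has_grad_Cc0 GdG sG) gdg sg).1 i x.
by have [_ <-] := (corr_gradl GdG sG (has_grad_Cc0 gdg sg)).1 i x.
Qed.

Lemma corr_approx r s G g e x : Cc r G -> Cc s g ->
  (forall y, `|y| <= r -> `|g (x + y) - g x| <= e) ->
  `|corr G g x - Int G * g x| <= e * Int (fun y => `|G y|).
Proof.
move=> cG cg ge; have iG := Cc_itg cG.
rewrite mulrC -IntZ// /corr -IntB; [|exact: (corr_itg _ cG cg)|exact: itgZ].
rewrite -IntZ; last exact: itg_abs.
apply: Int_abs_le => [||y].
- by apply: itg_meas; apply: itgB; [exact: (corr_itg _ cG cg)|exact: itgZ].
- exact/itgZ/itg_abs.
rewrite (_ : _ - _ = G y * (g (x + y) - g x)); last by ring.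
have [yr|/cG.2 ->] := leP `|y| r; last by rewrite mul0r normr0 mulr0.
by rewrite normrM mulrC ler_wpM2r// ge.
Qed.

Lemma corr_sum r s G (I : finType) (F : I -> X -> R) x : Cc r G -> (forall k, Cc s (F k)) ->
  corr G (fun y => \sum_k F k y) x = \sum_k corr G (F k) x.
Proof.
move=> cG cF; rewrite /corr -Int_sum => [|k]; last exact: (corr_itg _ cG (cF k)).
by congr Int; apply/funext => y; rewrite mulr_sumr.
Qed.

Lemma corr_suml r s (I : finType) (F : I -> X -> R) g x : (forall k, Cc r (F k)) -> Cc s g ->
  corr (fun y => \sum_k F k y) g x = \sum_k corr (F k) g x.
Proof.
move=> cF cg; rewrite /corr -Int_sum => [|k]; last exact: (corr_itg _ (cF k) cg).
by congr Int; apply/funext => y; rewrite mulr_suml.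
Qed.

Lemma corrBl r s G1 G2 g x : Cc r G1 -> Cc r G2 -> Cc s g ->
  corr (fun y => G1 y - G2 y) g x = corr G1 g x - corr G2 g x.
Proof.
move=> c1 c2 cg; rewrite /corr -IntB; [|exact: (corr_itg _ c1 cg)|exact: (corr_itg _ c2 cg)].
by congr Int; apply/funext => y; rewrite mulrBl.
Qed.

End convolution.

(** * Gluing of differentiable functions, and functions flat at the origin *)

Section gluing.
Context {R : realType}.
Implicit Types f g : R -> R.

Lemma is_derive_eps f (a d : R) :
  (forall e, 0 < e -> exists2 r, 0 < r & forall h : R, `|h| <= r ->
    `|f (a + h) - f a - h * d| <= e * `|h|) -> is_derive a (1 : R) f d.
Proof.
move=> H.
suff C : (fun h : R => h^-1 *: ((f \o shift a) (h *: 1) - f a)) h @[h --> 0^'] --> d.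
  by apply: DeriveDef; [apply/cvg_ex; exists d|exact/cvg_lim].
apply/cvgrPdist_le => /= e e0; have [r r0 rP] := H e e0.
near=> h.
have h0 : h != 0 by near: h; exact: nbhs_dnbhs_neq.
have hr : `|h| <= r by near: h; apply: dnbhs0_le.
rewrite distrC -(ler_pM2l (_ : 0 < `|h|)) ?normr_gt0// -normrM mulrBr.
rewrite [_%:A]mulr1 [h + a]addrC -[h^-1 *: _]/(h^-1 * _) mulVKf// [leRHS]mulrC.
exact: rP.
Unshelve. all: by end_near. Qed.

Lemma is_deriveE f (a d : R) : is_derive a (1 : R) f d ->
  forall e, 0 < e -> exists2 r, 0 < r & forall h : R, `|h| <= r ->
    `|f (a + h) - f a - h * d| <= e * `|h|.
Proof.
move=> [/cvg_ex[/= l fl] fd] e e0.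
have {fd} ld : l = d by rewrite -fd; apply/esym/cvg_lim.
rewrite {l}ld in fl; move/cvgrPdist_le : fl => /(_ e e0).
move=> /nbhs_ballP[r /= r0 rP]; exists (r / 2); first by rewrite divr_gt0.
move=> h hr; have [->|h0] := eqVneq h 0; first by rewrite addr0 subrr mul0r subrr normr0 mulr0.
have hb : ball 0 r h.
  rewrite /ball/= sub0r normrN; apply: le_lt_trans hr _.
  by rewrite ltr_pdivrMr// mulr_natr mulr2n ltrDl.
have := rP h hb h0.
rewrite distrC -(ler_pM2l (_ : 0 < `|h|)) ?normr_gt0// -normrM mulrBr.
rewrite [_%:A]mulr1 [h + a]addrC -[h^-1 *: _]/(h^-1 * _) mulVKf//.
by rewrite [`|h| * e]mulrC.
Qed.

Definition piecewise (a : R) f g : R -> R := fun s => if s <= a then f s else g s.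

Lemma piecewise_derive (a : R) f g (f' g' : R -> R) :
  (forall s : R, s <= a -> is_derive s (1 : R) f (f' s)) ->
  (forall s : R, a <= s -> is_derive s (1 : R) g (g' s)) ->
  f a = g a -> f' a = g' a ->
  forall s : R, is_derive s (1 : R) (piecewise a f g) (piecewise a f' g' s).
Proof.
move=> df dg fga dfga s; apply: is_derive_eps => e e0; rewrite /piecewise.
case: (ltgtP s a) => [sa|sa|->].
- have [r r0 rP] := is_deriveE (df _ (ltW sa)) e0.
  exists (Num.min r (a - s)); first by rewrite lt_min r0 subr_gt0.
  move=> h; rewrite le_min => /andP[/rP H ha].
  by rewrite ifT//; have := ler_norm h; lra.
- have [r r0 rP] := is_deriveE (dg _ (ltW sa)) e0.
  exists (Num.min r ((s - a) / 2)); first by rewrite lt_min r0 divr_gt0// subr_gt0.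
  move=> h; rewrite le_min => /andP[/rP H ha].
  rewrite ifF//; apply/negbTE; rewrite -ltNge.
  by have := ler_norm (- h); rewrite normrN; lra.
- have [r r0 rP] := is_deriveE (df a (lexx _)) e0.
  have [r' r'0 r'P] := is_deriveE (dg a (lexx _)) e0.
  exists (Num.min r r'); first by rewrite lt_min r0.
  move=> h; rewrite le_min => /andP[/rP H /r'P H'].
  by case: ifP => _ //; rewrite fga dfga.
Qed.

Lemma is_derive_continuous f f' : (forall s : R, is_derive s (1 : R) f (f' s)) -> continuous f.
Proof.
move=> df s; apply: differentiable_continuous; apply/derivable1_diffP.
by have [] := df s.
Qed.

End gluing.

Section flat.
Context {R : realType}.

(** The powers of 1/s are there so that the family is stable under differentiation: the derivative
    of [flat n] is a combination of [flat n.+2] and [flat n.+1]. *)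
Definition flat (n : nat) : R -> R :=
  piecewise 0 (fun=> 0) (fun s => s^-1 ^+ n * expR (- s^-1)).

Lemma expR_pow_bound n (t : R) : 0 <= t -> t ^+ n <= n`!%:R * expR t.
Proof.
move=> t0; case: n => [|n].
  by rewrite expr0 fact0 mul1r (le_trans _ (expR_ge1Dx t))// lerDl.
rewrite mulrC -ler_pdivrMr ?ltr0n ?fact_gt0//.
apply: le_trans (expR_ge1Dxn n t0). by rewrite lerDr ler01.
Qed.

(** A quadratic bound at 0 suffices for the derivative there to exist and vanish. It is the bound of
    t^(n+2) by (n+2)! exp t at t = 1/s. *)
Lemma flat_small n (s : R) : 0 < s -> s^-1 ^+ n * expR (- s^-1) <= n.+2`!%:R * s ^+ 2.
Proof.
move=> s0; have t0 : 0 <= s^-1 by rewrite invr_ge0 ltW.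
have := expR_pow_bound n.+2 t0.
rewrite -addn2 exprD !exprVn => H.
rewrite expRN ler_pdivrMr ?expR_gt0// -[leLHS](divfK (_ : s ^+ 2 != 0)); last first.
  by rewrite expf_neq0 ?gt_eqF.
by rewrite [leRHS]mulrAC ler_pM2r ?exprn_gt0// exprVn.
Qed.

Lemma flat_derive n (s : R) : is_derive s (1 : R) (flat n) (flat n.+2 s - n%:R * flat n.+1 s).
Proof.
have [s0|s0] := leP s 0; last first.
  have D : is_derive s (1 : R) (fun s : R => s^-1 ^+ n * expR (- s^-1))
      (s^-1 ^+ n.+2 * expR (- s^-1) - n%:R * (s^-1 ^+ n.+1 * expR (- s^-1))).
    have sN0 : s != 0 by rewrite gt_eqF.
    have V : is_derive s (1 : R) (fun s : R => s^-1) (- s ^- 2).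
      apply: DeriveDef; first by apply: (@derivableV _ _ id) => //; exact: derivable_id.
      by rewrite (@deriveV _ _ id) ?derive_id//; exact: mulr1.
    have X : is_derive s^-1 (1 : R) (fun u : R => u ^+ n) (n%:R * s^-1 ^+ n.-1).
      apply: DeriveDef; first exact: exprn_derivable.
      by rewrite exp_derive; exact: mulr1.
    have E : is_derive s^-1 (1 : R) (fun u : R => expR (- u)) (- expR (- s^-1)).
      by apply: is_derive_eq; rewrite mulrN1.
    have XE := is_deriveM X E.
    have H : is_derive s (1 : R) (fun s : R => s^-1 ^+ n * expR (- s^-1)) _ :=
      is_derive1_comp XE V.
    apply: (is_derive_eq H); rewrite -![_ *: _]/(_ * _).
    have -> : s ^- 2 = s^-1 * s^-1 by rewrite -exprVn expr2.
    case: n {X XE H} => [|n]; first by rewrite !exprS !expr0; ring.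
    by rewrite !exprS /= -natr1; ring.
  apply: (@near_eq_is_derive _ _ _ (fun s : R => s^-1 ^+ n * expR (- s^-1)) (flat n)).
    near=> u; rewrite /flat /piecewise ifF//; apply/negbTE; rewrite -ltNge.
    by near: u; exact: lt_nbhsr.
  by rewrite /flat /piecewise (lt_geF s0).
(* For s <= 0 the increment is either 0 or at most (n+2)! (s + h)^2 with 0 < s + h <= |h|, hence
   o(|h|). *)
have -> : flat n.+2 s - n%:R * flat n.+1 s = 0.
  by rewrite /flat /piecewise s0 mulr0 subr0.
apply: is_derive_eps => e e0.
exists (e / (n.+2`!%:R + 1)); first by rewrite divr_gt0// ltr_wpDl.
move=> h; rewrite ler_pdivlMr ?ltr_wpDl// => hr.
rewrite mulr0 subr0 [flat n s]/flat /piecewise s0 subr0 /flat /piecewise; case: (leP (s + h) 0) => sh.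
  by rewrite normr0 mulr_ge0// ltW.
rewrite ger0_norm; last by rewrite mulr_ge0 ?expR_ge0// exprn_ge0// invr_ge0 ltW.
apply: le_trans (flat_small n sh) _.
have : (s + h) ^+ 2 <= `|h| ^+ 2.
  apply: lerXn2r; rewrite ?nnegrE ?(ltW sh)//; have := ler_norm h; lra.
have := normr_ge0 h; have : 0 <= n.+2`!%:R :> R by [].
move: (n.+2`!%:R : R) (`|h|) hr ((s+h)^+2) => a b ab c a0 b0 cb.
by apply: (@le_trans _ _ (a * b ^+ 2)); [exact: ler_wpM2l|nra].
Unshelve. all: by end_near.
Qed.

Lemma flat_ge0 n s : 0 <= flat n s.
Proof.
rewrite /flat /piecewise; case: (leP s 0) => // s0.
by rewrite mulr_ge0 ?expR_ge0// exprn_ge0// invr_ge0 ltW.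
Qed.

Lemma flat_gt0 n s : 0 < s -> 0 < flat n s.
Proof.
by move=> s0; rewrite /flat /piecewise (lt_geF s0) mulr_gt0 ?expR_gt0// exprn_gt0// invr_gt0.
Qed.

Lemma flat_le0 n s : s <= 0 -> flat n s = 0.
Proof. by rewrite /flat /piecewise => ->. Qed.

End flat.

(** * Mollification of test functions *)

Section mollification.
Context {R : realType} {N : nat}.
Local Notation X := 'rV[R]_N.
Implicit Types (f g k : X -> R) (df dg : 'I_N -> X -> R).
Local Notation Int := (@Int R N).
Local Notation itg := (@itg R N).

(** Smoothness asks for all iterated partial derivatives. A class of functions stable under taking
    gradients consists of smooth functions, by induction on the list of directions. *)
Lemma smooth_class (P : (X -> R) -> Prop) :
  (forall f, P f -> exists2 df, has_grad f df & forall i, P (df i)) ->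
  forall f, P f -> smooth f.
Proof.
move=> PP f Pf s.
suff : P (foldr (@partial R N R) f s) by move=> /PP[df /has_grad_C1].
elim: s => //= i s /PP[df fdf Pdf].
by rewrite (has_grad_partial i fdf).
Qed.

(** A class stable under partial derivatives, sums and products, and large enough to contain a bump;
    it is the input of [smooth_class]. *)
Inductive elementary : (X -> R) -> Prop :=
| elem_flat n (c t : R) i : elementary (fun x => flat n (c + t * x ord0 i))
| elem_cst (c : R) : elementary (fun _ => c)
| elem_add f g : elementary f -> elementary g -> elementary (fun x => f x + g x)
| elem_mul f g : elementary f -> elementary g -> elementary (fun x => f x * g x).

Lemma elementary_grad f : elementary f ->
  exists2 df, has_grad f df & forall i, elementary (df i).
Proof.
elim=> [n c t j|c|{}f g _ [df fdf Pf] _ [dg gdg Pg]|{}f g ef [df fdf Pf] eg [dg gdg Pg]].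
- have D (s : R) : is_derive s (1 : R) (flat n) (flat n.+2 s + - n%:R * flat n.+1 s).
    by rewrite mulNr; exact: flat_derive.
  have C : continuous (fun s : R => flat n.+2 s + - n%:R * flat n.+1 s).
    move=> s; apply: (@continuousD _ _ _ (flat n.+2) (fun s => - n%:R * flat n.+1 s)).
      exact: (is_derive_continuous (flat_derive n.+2)).
    apply: (@continuousM _ _ (fun=> - n%:R) (flat n.+1)); first exact: cst_continuous.
    exact: (is_derive_continuous (flat_derive n.+1)).
  have L := has_gradD (has_grad_cst c) (has_gradZ t (has_grad_coor j)).
  have C' : continuous (fun x : X => flat n.+2 (c + t * x ord0 j) + - n%:R * flat n.+1 (c + t * x ord0 j)).
    move=> x; apply: (@continuous_comp _ _ _ (fun x : X => c + t * x ord0 j)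
      (fun s : R => flat n.+2 s + - n%:R * flat n.+1 s) x); last exact: C.
    exact: (has_grad_continuous L).
  exists (fun i (x : X) => (flat n.+2 (c + t * x ord0 j) + - n%:R * flat n.+1 (c + t * x ord0 j)) *
      (0 + t * (i == j)%:R)).
    exact: (@has_grad_comp _ _ _ _ _ (fun s => flat n.+2 s + - n%:R * flat n.+1 s) L (fun x => D _) C').
  move=> i; apply: elem_mul; last exact: elem_cst.
  apply: elem_add; first exact: elem_flat.
  by apply: elem_mul; [exact: elem_cst|exact: elem_flat].
- by eexists; [exact: has_grad_cst|move=> i; exact: elem_cst].
- by eexists; [exact: has_gradD fdf gdg|move=> i; exact: elem_add].
- by eexists; [exact: has_gradM fdf gdg|move=> i; apply: elem_add; exact: elem_mul].
Qed.

Lemma elementary_prod (I : finType) (F : I -> X -> R) :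
  (forall i, elementary (F i)) -> elementary (fun x => \prod_i F i x).
Proof.
move=> FE; elim: (index_enum I) => [|i s ih].
  by under eq_fun do rewrite big_nil; exact: elem_cst.
by under eq_fun do rewrite big_cons; exact: elem_mul.
Qed.

Lemma elementary_Cc f r : elementary f -> supp_in r f -> Cc r f.
Proof. by move=> /elementary_grad[df fdf _]; exact: (has_grad_Cc0 fdf). Qed.

(** All derivatives fall on k, so g only has to be continuous with compact support. *)
Lemma corr_smooth k g r s : elementary k -> supp_in r k -> Cc s g -> smooth (corr k g).
Proof.
move=> ek sk cg.
apply: (@smooth_class (fun f => exists k, [/\ elementary k, supp_in r k & f = corr k g])).
  move=> _ [{ek sk}k [ek sk ->]]; have [dk kdk edk] := elementary_grad ek.
  eexists; first exact: corr_gradl kdk sk cg.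
  (* The sign of [corr_gradl] is absorbed in the kernel, which stays elementary as a product with a
     constant. *)
  move=> i; exists (fun x => -1 * dk i x); split.
  - by apply: elem_mul => //; exact: elem_cst.
  - by move=> x rx; rewrite (has_grad_Cc i kdk sk).2// mulr0.
  - apply/funext => x; have cdk := has_grad_Cc i kdk sk.
    rewrite /corr -IntN; last exact: (corr_itg x cdk cg).
    by congr Int; apply/funext => y; rewrite mulN1r mulNr.
by exists k.
Qed.

Lemma test_functionP f r : smooth f -> supp_in r f -> test_function f.
Proof.
move=> sf sr; split => //.
apply: (@subclosed_compact _ _ (cube r)); [exact: closed_closure|exact: compact_cube|].
have clo : closed (cube r : set X) by apply: compact_closed; [exact: norm_hausdorff|exact: compact_cube].
rewrite [X in _ `<=` X]((closure_id _).1 clo); apply: closureS => x /= fx.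
by rewrite /cube/= leNgt; apply/negP => /sr fx0; rewrite fx0 eqxx in fx.
Qed.

Lemma Int_gt0 f r : Cc r f -> (forall x, 0 <= f x) -> 0 < f 0 -> 0 < Int f.
Proof.
move=> cf f0 f00; have [|d d0 dP] := Cc_unif cf (_ : 0 < f 0 / 2); first by rewrite divr_gt0.
have : Int (fun x => f 0 / 2 * cind d x) <= Int f.
  apply: Int_le; [exact/itgZ/itg_cind|exact: Cc_itg cf|move=> x].
  rewrite /cind; case: (leP `|x| d) => xd; last by rewrite mulr0.
  by have := dP 0 x xd; rewrite add0r mulr1 ler_norml => /andP[+ _]; lra.
apply: lt_le_trans; rewrite IntZ; last exact: itg_cind.
by rewrite Int_cind ?ltW// mulr_gt0// ?divr_gt0// exprn_gt0// mulr_gt0.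
Qed.

(** The coefficients 1 and -1 keep each factor in the form of [elem_flat]. *)
Definition smooth_bump (e : R) (x : X) : R :=
  \prod_(i < N) (flat 0 (e + 1 * x ord0 i) * flat 0 (e + -1 * x ord0 i)).

Lemma smooth_bump_elementary e : elementary (smooth_bump e).
Proof. by apply: elementary_prod => i; apply: elem_mul; exact: elem_flat. Qed.

Lemma smooth_bump_ge0 e x : 0 <= smooth_bump e x.
Proof. by apply: prodr_ge0 => i _; rewrite mulr_ge0// flat_ge0. Qed.

Lemma supp_smooth_bump e : 0 <= e -> supp_in e (smooth_bump e).
Proof.
move=> e0 x ex; have [i xi] : exists i, e < `|x ord0 i|.
  apply/not_existsP => H; move: ex; rewrite ltNge; apply/negP/negPn.
  by apply: norm_le_coor => // i; rewrite leNgt; apply/negP/H.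
rewrite /smooth_bump (bigD1 i)//=; apply/eqP; rewrite !mulf_eq0; apply/orP; left.
case: (leP 0 (x ord0 i)) xi => xi0.
  by rewrite ger0_norm// => xi; apply/orP; right; apply/eqP/flat_le0; lra.
by rewrite ltr0_norm// => xi; apply/orP; left; apply/eqP/flat_le0; lra.
Qed.

Lemma Int_smooth_bump_gt0 e : 0 < e -> 0 < Int (smooth_bump e).
Proof.
move=> e0; apply: (@Int_gt0 _ e); [|exact: smooth_bump_ge0|].
  by apply: elementary_Cc; [exact: smooth_bump_elementary|apply: supp_smooth_bump; exact: ltW].
by apply: prodr_gt0 => i _; rewrite !mxE !mulr0 addr0 mulr_gt0// flat_gt0.
Qed.

(** The inverse of 1 plus the sum of the inverse radii lies below each of the radii, and is positive
    even for an empty family. *)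
Lemma uniform_radius (I : finType) (P : I -> R -> Prop) :
  (forall i, exists2 d, 0 < d & forall r, 0 < r -> r <= d -> P i r) ->
  exists2 d, 0 < d & forall i, P i d.
Proof.
move=> H; have /choice[D DP] : forall i, exists d, 0 < d /\ forall r, 0 < r -> r <= d -> P i r.
  by move=> i; have [d d0 dP] := H i; exists d.
have S0 : 0 <= \sum_i (D i)^-1 by apply: sumr_ge0 => i _; rewrite invr_ge0 ltW//; have [] := DP i.
exists (1 + \sum_i (D i)^-1)^-1; first by rewrite invr_gt0 ltr_wpDr.
move=> i; have [Di0 DPi] := DP i; apply: DPi; first by rewrite invr_gt0 ltr_wpDr.
rewrite -[leRHS]invrK lef_pV2 ?posrE ?invr_gt0 ?ltr_wpDr//.
rewrite (bigD1 i)//= addrCA lerDl addr_ge0//.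
by apply: sumr_ge0 => j _; rewrite invr_ge0 ltW//; have [] := DP j.
Qed.

Lemma mollify f df s e : has_grad f df -> supp_in s f -> 0 < e ->
  exists phi dphi, [/\ test_function phi, has_grad phi dphi, supp_in (s + 1) phi,
    forall x, `|phi x - f x| <= e & forall i x, `|dphi i x - df i x| <= e].
Proof.
move=> fdf sf e0; have cf := has_grad_Cc0 fdf sf.
have cdf i := has_grad_Cc i fdf sf.
have [d0 d00 d0P] := Cc_unif cf e0.
have [d1 d10 d1P] : exists2 d, 0 < d &
    forall i x (h : X), `|h| <= d -> `|df i (x + h) - df i x| <= e.
  apply: (@uniform_radius _ (fun i d => forall x (h : X), `|h| <= d -> `|df i (x + h) - df i x| <= e)).
  move=> i; have [d d_gt0 dP] := Cc_unif (cdf i) e0.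
  by exists d => // r _ rd x h hr; apply: dP; exact: le_trans rd.
pose d := Num.min 1 (Num.min d0 d1).
have d_gt0 : 0 < d by rewrite !lt_min ltr01 d00.
have [dd1 dd0 dd] : [/\ d <= 1, d <= d0 & d <= d1].
  by rewrite /d !ge_min !lexx !orbT.
pose c := (Int (smooth_bump d))^-1; have c0 : 0 < c by rewrite invr_gt0 Int_smooth_bump_gt0.
pose k x := c * smooth_bump d x.
have ek : elementary k by apply: elem_mul; [exact: elem_cst|exact: smooth_bump_elementary].
have sk : supp_in d k by move=> x dx; rewrite /k supp_smooth_bump ?mulr0// ltW.
have ck := elementary_Cc ek sk.
have k0 x : 0 <= k x by rewrite mulr_ge0 ?smooth_bump_ge0// ltW.
have Ik : Int k = 1.
  rewrite /k IntZ ?mulVf// ?gt_eqF// ?Int_smooth_bump_gt0//.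
  by apply: (@Cc_itg _ _ d); apply: elementary_Cc; [exact: smooth_bump_elementary|apply: supp_smooth_bump; exact: ltW].
have Iak : Int (fun x => `|k x|) = 1.
  by rewrite -Ik; congr Int; apply/funext => x; rewrite ger0_norm.
have gr := corr_grad ck fdf sf.
have ss : supp_in (s + 1) (corr k f).
  move=> x sx; apply: (supp_corr sk sf); apply: le_lt_trans sx; lra.
exists (corr k f), (fun i => corr k (df i)); split => //.
- apply: (test_functionP _ ss); exact: corr_smooth ek sk cf.
- move=> x; have := @corr_approx _ _ _ _ _ _ e x ck cf; rewrite Ik Iak mul1r mulr1; apply.
  by move=> y yd; apply: d0P; exact: le_trans dd0.
- move=> i x; have := @corr_approx _ _ _ _ _ _ e x ck (cdf i); rewrite Ik Iak mul1r mulr1; apply.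
  by move=> y yd; apply: d1P; exact: le_trans dd.
Qed.

(** The smooth approximations of f converge uniformly together with their gradients and have their
    supports in one fixed cube, where a and the b i are integrable. This admits test functions built
    from v, which are only C^1. *)
Lemma weak_extension a (b : 'I_N -> X -> R) :
  loc_integrable a -> (forall i, loc_integrable (b i)) ->
  (forall f df r, test_function f -> has_grad f df -> supp_in r f ->
     Int (fun x => a x * f x + \sum_i b i x * df i x) = 0) ->
  forall f df r, has_grad f df -> supp_in r f ->
     Int (fun x => a x * f x + \sum_i b i x * df i x) = 0.
Proof.
move=> la lb H f df r fdf sf.
have ii f' df' r' : has_grad f' df' -> supp_in r' f' ->
    itg (fun x => a x * f' x + \sum_i b i x * df' i x).
  move=> fdf' sf'; apply: itgD; first exact: (loc_itg_Cc la (has_grad_Cc0 fdf' sf')).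
  by apply: itg_sum => i; apply: (loc_itg_Cc (lb i) (has_grad_Cc i fdf' sf')).
(* Dominates the integrand of the difference, up to the uniform error e. *)
pose W x := `|cind (r + 1) x * a x| + \sum_i `|cind (r + 1) x * b i x|.
have iW : itg W.
  apply: itgD; first by apply: itg_abs; exact: loc_itg_cube.
  by apply: itg_sum => i; apply: itg_abs; exact: loc_itg_cube.
pose K := Int W; have K0 : 0 <= K.
  by apply: Int_ge0 => x; rewrite addr_ge0// sumr_ge0.
have key e : 0 < e -> `|Int (fun x => a x * f x + \sum_i b i x * df i x)| <= e * K.
  move=> e0; have [phi [dphi [tphi pdp sp ap adp]]] := mollify fdf sf e0.
  rewrite -normrN -sub0r -[X in `|X - _|](H _ _ _ tphi pdp sp).
  have i1 := ii _ _ _ pdp sp; have i2 := ii _ _ _ fdf sf.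
  rewrite -IntB// /K -IntZ//; apply: Int_abs_le => [||x]; [by apply: itg_meas; apply: itgB|exact: itgZ|].
  have [xr|xr] := leP `|x| (r + 1); last first.
    have rx : r < `|x| by lra.
    rewrite sp// sf// !mulr0 !add0r.
    rewrite !big1 => [|i _|i _]; first by rewrite subrr normr0 mulr_ge0 ?(ltW e0)// /W addr_ge0 ?sumr_ge0.
      by rewrite (has_grad_Cc i fdf sf).2 ?mulr0.
    by rewrite (has_grad_Cc i pdp sp).2 ?mulr0.
  rewrite /W (cindT xr) mul1r [X in _ <= _ * (_ + X)](eq_bigr (fun i => `|b i x|)) => [|i _]; last by rewrite mul1r.
  rewrite opprD addrACA -mulrBr -sumrB [leRHS]mulrDr mulr_sumr.
  apply: le_trans (ler_normD _ _) _; apply: lerD.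
    by rewrite normrM mulrC ler_wpM2r.
  apply: le_trans (ler_norm_sum _ _ _) _; apply: ler_sum => i _.
  by rewrite -mulrBr normrM mulrC ler_wpM2r.
apply/eqP; rewrite -normr_eq0; apply/eqP/le_anti/andP; split => //.
apply/ler_addgt0Pr => e e0; rewrite add0r.
apply: le_trans (key (e / (K + 1)) _) _; first by rewrite divr_gt0// ltr_wpDl.
rewrite mulrAC ler_pdivrMr ?ltr_wpDl//; nra.
Qed.

End mollification.

(** * Weak form of the profile equations *)

Section Cc_closure.
Context {R : realType} {N : nat}.
Local Notation X := 'rV[R]_N.
Implicit Types f g : X -> R.

Lemma ctsD f g : continuous f -> continuous g -> continuous (fun x => f x + g x).
Proof. by move=> cf cg x; apply: continuousD; [exact: cf|exact: cg]. Qed.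

Lemma ctsM f g : continuous f -> continuous g -> continuous (fun x => f x * g x).
Proof. by move=> cf cg x; apply: continuousM; [exact: cf|exact: cg]. Qed.

Lemma cts_cst (c : R) : continuous (fun _ : X => c).
Proof. exact: cst_continuous. Qed.

Lemma cts_coor i : continuous (fun x : X => x ord0 i).
Proof. exact: has_grad_continuous (has_grad_coor i). Qed.

Lemma cts_sum (I : finType) (F : I -> X -> R) :
  (forall i, continuous (F i)) -> continuous (fun x => \sum_i F i x).
Proof.
move=> H; elim: (index_enum I) => [|k s ih].
  by under eq_fun do rewrite big_nil; exact: cts_cst.
by under eq_fun do rewrite big_cons; exact: ctsD.
Qed.

Lemma Cc_mul r f g : continuous f -> Cc r g -> Cc r (fun x => f x * g x).
Proof. by move=> cf [cg sg]; split=> [|x /sg ->]; [exact: ctsM|rewrite mulr0]. Qed.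

Lemma Cc_mulr r f g : Cc r f -> continuous g -> Cc r (fun x => f x * g x).
Proof. by move=> [cg sg] cf; split=> [|x /sg ->]; [exact: ctsM|rewrite mul0r]. Qed.

Lemma Cc_add r f g : Cc r f -> Cc r g -> Cc r (fun x => f x + g x).
Proof. by move=> [cf sf] [cg sg]; split=> [|x rx]; [exact: ctsD|rewrite sf// sg// addr0]. Qed.

Lemma Cc_sum r (I : finType) (F : I -> X -> R) :
  (forall i, Cc r (F i)) -> Cc r (fun x => \sum_i F i x).
Proof.
move=> H; split=> [|x rx]; first by apply: cts_sum => i; exact: (H i).1.
by apply: big1 => i _; exact: (H i).2.
Qed.

Lemma has_grad_shift f df a : has_grad f df ->
  has_grad (fun x : X => f (x + a)) (fun i x => df i (x + a)).
Proof.
move=> [f1 f2]; split=> [i x|i x].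
  apply: is_derive_ex.
  rewrite (_ : (fun s : R => _) = (fun s : R => f (x + a + s *: delta_mx ord0 i))).
    by apply: is_derive_line; rewrite scale0r addr0; exact: f1.
  by apply/funext => s; rewrite addrAC.
apply: (@continuous_comp _ _ _ (fun x : X => x + a) (df i) x); last exact: f2.
by apply: continuousD; [|exact: cst_continuous].
Qed.

Lemma loc_itg_lin f g (c : R) : loc_integrable f -> loc_integrable g ->
  loc_integrable (fun x : X => f x + c * g x).
Proof.
move=> [mf lf] [mg lg].
have mcg : measurable_fun setT (fun x => c * g x) by apply: measurable_funM.
split=> [|K cK]; first exact: measurable_funD.
have mK : measurable K.
  by apply: closed_measurable_rV; apply: compact_closed => //; exact: norm_hausdorff.
have mT (h : X -> R) : measurable_fun setT h -> measurable_fun K (fun x : X => `|h x|%:E).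
  by move=> mh; apply: measurable_funTS; apply/measurable_EFinP; exact: measurableT_comp.
apply: (@le_lt_trans _ _ (\int[@lebesgue_rV R N]_(x in K) (`|f x|%:E + `|c|%:E * `|g x|%:E))%E).
  apply: ge0_le_integral => //.
  - by apply: mT; exact: measurable_funD.
  - apply: emeasurable_funD; first exact: mT.
    by apply: measurable_funeM; exact: mT.
  - by move=> x _; rewrite -EFinM -EFinD lee_fin (le_trans (ler_normD _ _))// normrM.
rewrite ge0_integralD//; [|exact: mT|by apply: measurable_funeM; exact: mT].
rewrite ge0_integralZl//; last exact: mT.
by rewrite lte_add_pinfty//; [exact: lf|rewrite lte_mul_pinfty//; exact: lg].
Qed.

End Cc_closure.

Section euler.
Context {R : realType} {N : nat}.
Local Notation X := 'rV[R]_N.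
Implicit Types (f g : X -> R) (df dg : 'I_N -> X -> R).
Local Notation Int := (@Int R N).
Local Notation itg := (@itg R N).

Lemma distr_ofE f phi : distr_of f phi = Int (fun x => f x * phi x).
Proof. by []. Qed.

Context (v : X -> X) (q : X -> R) (alpha : R).
Context (vC1 : C1 v) (vdiv : divergence_free v) (qloc : loc_integrable q).
Context (vmom : profile_momentum alpha v q).

Local Notation V := (vcomp v).
Definition dvcomp i j (x : X) : R := partial j v x ord0 i.
Local Notation dV := dvcomp.

Lemma vcomp_grad i : has_grad (V i) (dV i).
Proof. exact: C1_vcomp. Qed.

Lemma cts_vcomp i : continuous (V i).
Proof. exact: has_grad_continuous (vcomp_grad i). Qed.

Lemma divfree_weak f df r : has_grad f df -> supp_in r f ->
  Int (fun x => \sum_j V j x * df j x) = 0.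
Proof.
move=> fdf sf.
suff : Int (fun x => 0 * f x + \sum_j V j x * df j x) = 0.
  by under eq_fun do rewrite mul0r add0r.
move: f df r fdf sf; apply: (@weak_extension _ _ (fun=> 0) V).
- by apply: continuous_loc_integrable; exact: cts_cst.
- by move=> i; apply: continuous_loc_integrable; exact: cts_vcomp.
move=> f df r tf fdf sf; under eq_fun do rewrite mul0r add0r.
rewrite Int_sum => [|i]; last first.
  exact: Cc_itg (Cc_mul (@cts_vcomp i) (has_grad_Cc i fdf sf)).
have := vdiv tf; rewrite /distr_partial sumrN => /eqP; rewrite oppr_eq0 => /eqP.
by under eq_bigr do rewrite (has_grad_partial _ fdf) distr_ofE.
Qed.

(** If the divergence were nonzero at x, it would keep its sign near x, and a bump supported there
    would contradict the weak form. *)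
Lemma divfree x : \sum_j dV j j x = 0.
Proof.
apply: contrapT => /eqP Dx0.
pose D x := \sum_j dV j j x.
have cD : continuous D by apply: cts_sum => j; exact: (vcomp_grad j).2.
have DI f df r : has_grad f df -> supp_in r f -> Int (fun x => D x * f x) = 0.
  move=> fdf sf; have cf := has_grad_Cc0 fdf sf.
  rewrite (_ : (fun x => _) = (fun x => \sum_j (V j x * df j x + f x * dV j j x) - \sum_j V j x * df j x)); last first.
    by apply/funext => y; rewrite big_split/= [X in X - _]addrC addrK /D mulr_suml; apply: eq_bigr => j _; rewrite mulrC.
  have i1 j : itg (fun x => V j x * df j x + f x * dV j j x).
    apply: (@Cc_itg _ _ r); apply: Cc_add; first exact: Cc_mul (@cts_vcomp j) (has_grad_Cc j fdf sf).
    by apply: Cc_mulr => //; exact: (vcomp_grad j).2.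
  rewrite IntB; [|exact: itg_sum|]; last first.
    by apply: itg_sum => j; exact: Cc_itg (Cc_mul (@cts_vcomp j) (has_grad_Cc j fdf sf)).
  rewrite (divfree_weak fdf sf) subr0 Int_sum// big1// => j _.
  apply: (Int_grad j (has_gradM (vcomp_grad j) fdf) (r := r)).
  by move=> y /sf ->; rewrite mulr0.
(* Multiplication by the value D x treats both signs at once. *)
have [d d0 dP] : exists2 d, 0 < d & forall h : X, `|h| <= d -> 0 <= D x * D (x + h).
  have DD : 0 < D x ^+ 2 by rewrite exprn_even_gt0.
  have : \forall y \near x, `|D x * D x - D x * D y| < D x ^+ 2.
    have /cvgrPdist_lt : D x * D y @[y --> x] --> D x * D x by exact: (ctsM (@cts_cst R N (D x)) cD).
    by apply.
  move=> /nbhs_ballP[d /= d0 dP]; exists (d / 2); first by rewrite divr_gt0.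
  move=> h hd; have := dP (x + h); rewrite mx_norm_ball /ball_/= opprD addNKr normrN.
  have /[swap]/[apply] : `|h| < d by apply: le_lt_trans hd _; rewrite ltr_pdivrMr// mulr_natr mulr2n ltrDl.
  by rewrite ltr_norml => /andP[_]; lra.
have [db bdb _] := elementary_grad (smooth_bump_elementary (N := N) d).
have sb := @supp_smooth_bump R N d (ltW d0).
have := DI _ _ (d + `|x|) (has_grad_shift (- x) bdb) _.
have sbs : supp_in (d + `|x|) (fun y => smooth_bump d (y - x)).
  by move=> y yd; apply: sb; have := ler_normD (y - x) x; rewrite subrK; lra.
move=> /(_ sbs) /(congr1 ( *%R (D x))); rewrite mulr0.
have cb := has_grad_Cc0 bdb sb.
have cDx : continuous (fun y : X => D (y + x)).
  move=> y; apply: (@continuous_comp _ _ _ (fun y : X => y + x) D y); last exact: cD.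
  by apply: continuousD; [|exact: cst_continuous].
have i0 : itg (fun y : X => D y * smooth_bump d (y - x)).
  have cbs : Cc (d + `|x|) (fun y => smooth_bump d (y - x)).
    exact: has_grad_Cc0 (has_grad_shift (- x) bdb) sbs.
  exact: (Cc_itg (Cc_mul cD cbs)).
rewrite -(Int_shift x i0) -IntZ; last exact: (itg_shift x i0).
under eq_fun do rewrite addrK mulrA.
apply/eqP; rewrite gt_eqF//; apply: (@Int_gt0 _ _ _ d).
- by apply: Cc_mul cb; apply: ctsM cDx; exact: cts_cst.
- move=> y; have [yd|yd] := leP `|y| d; last by rewrite sb// mulr0.
  by rewrite mulr_ge0 ?smooth_bump_ge0// addrC dP.
rewrite add0r mulr_gt0//; first by rewrite -expr2 exprn_even_gt0.
by apply: prodr_gt0 => i _; rewrite !mxE !mulr0 addr0 mulr_gt0// flat_gt0.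
Qed.

Local Notation l := ((1 + alpha)^-1).
Local Notation k := ((alpha - N%:R) * l).

(** The product rule in d_j (y_j f), summed over j, releases N f: this is why the coefficient of the
    undifferentiated term is (alpha - N) / (1 + alpha). *)
Lemma momentum_weak i f df r : has_grad f df -> supp_in r f ->
  Int (fun x => k * V i x * f x +
    \sum_j (V j x * V i x - l * (x ord0 j * V i x) + (j == i)%:R * q x) * df j x) = 0.
Proof.
have cV := cts_vcomp.
move: f df r; apply: weak_extension.
- by apply: continuous_loc_integrable; apply: ctsM => //; exact: cts_cst.
- move=> j; apply: loc_itg_lin => //; apply: continuous_loc_integrable.
  apply: ctsD; first exact: ctsM.
  under eq_fun do rewrite -mulNr.
  by apply: ctsM; [exact: cts_cst|apply: ctsM => //; exact: cts_coor].
move=> f df r tf fdf sf.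
have cf := has_grad_Cc0 fdf sf; have cdf j := has_grad_Cc j fdf sf.
have := vmom i tf.
rewrite /distr_mul /distr_partial !distr_ofE.
rewrite (has_grad_partial i fdf).
have E1 j : distr_of (V i) (partial j (fun x : X => x ord0 j * f x)) =
    Int (fun x => V i x * f x) + Int (fun x => x ord0 j * V i x * df j x).
  rewrite (has_grad_partial j (has_gradM (has_grad_coor j) fdf)) distr_ofE -IntD.
  - by congr Int; apply/funext => x; rewrite eqxx mulr1; ring.
  - exact: (Cc_itg (Cc_mul (cV i) cf)).
  - by apply: (@Cc_itg _ _ r); apply: Cc_mul => //; apply: ctsM => //; exact: cts_coor.
rewrite [X in l * X + _](_ : _ =
    - \sum_j (Int (fun x => V i x * f x) + Int (fun x => x ord0 j * V i x * df j x))); last first.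
  by rewrite -sumrN; apply: eq_bigr => j _; rewrite E1.
under [X in _ = X - _ -> _]eq_bigr do rewrite (has_grad_partial _ fdf) distr_ofE.
rewrite sumrN big_split/= sumr_const card_ord.
have i1 : itg (fun x => V i x * f x) by exact: (Cc_itg (Cc_mul (cV i) cf)).
have i2 j : itg (fun x => V j x * V i x * df j x).
  by apply: (@Cc_itg _ _ r); apply: Cc_mul => //; apply: ctsM.
have i3 j : itg (fun x => x ord0 j * V i x * df j x).
  by apply: (@Cc_itg _ _ r); apply: Cc_mul => //; apply: ctsM => //; exact: cts_coor.
have i4 : itg (fun x => q x * df i x) by exact: loc_itg_Cc (cdf i).
rewrite (_ : (fun x => k * V i x * f x + _) = (fun x => k * (V i x * f x) +
    (\sum_j V j x * V i x * df j x - l * (\sum_j x ord0 j * V i x * df j x) + q x * df i x))); last first.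
  apply/funext => x; rewrite -mulrA; congr (_ + _).
  rewrite mulr_sumr -sumrB (bigD1 i)//= [in RHS](bigD1 i)//= eqxx mul1r.
  rewrite [in LHS](eq_bigr (fun j => V j x * V i x * df j x - l * (x ord0 j * V i x * df j x))).
    by ring.
  by move=> j /negbTE ->; rewrite mul0r addr0; ring.
rewrite IntD; [|exact: itgZ|]; last first.
  by apply: itgD => //; apply: itgB; [exact: itg_sum|apply: itgZ; exact: itg_sum].
rewrite IntD//; last by apply: itgB; [exact: itg_sum|apply: itgZ; exact: itg_sum].
rewrite IntB; [|exact: itg_sum|apply: itgZ; exact: itg_sum].
rewrite !IntZ//; last exact: itg_sum.
rewrite !Int_sum// -mulr_natl.
by move=> H; lra.
Qed.

End euler.

(** * The energy and pressure identities *)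

Section identities.
Context {R : realType} {N : nat}.
Local Notation X := 'rV[R]_N.
Implicit Types (f g : X -> R) (df dg : 'I_N -> X -> R).
Local Notation Int := (@Int R N).
Local Notation itg := (@itg R N).
Context (v : X -> X) (q : X -> R) (alpha : R).
Context (vC1 : C1 v) (vdiv : divergence_free v) (qloc : loc_integrable q).
Context (vmom : profile_momentum alpha v q).
Local Notation V := (vcomp v).
Local Notation dV := (dvcomp v).
Local Notation l := ((1 + alpha)^-1).
Local Notation k := ((alpha - N%:R) * l).

(** The part without pressure of the momentum equation tested with the vector field F. Here [dF i j]
    is the j-th derivative of the i-th component, and the pressure pairs with its trace. *)
Definition mom_density (F : 'I_N -> X -> R) (dF : 'I_N -> 'I_N -> X -> R) (x : X) : R :=
  \sum_i (k * V i x * F i x + \sum_j (V j x * V i x - l * (x ord0 j * V i x)) * dF i j x).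

Lemma cts_flux i j : continuous (fun x : X => V j x * V i x - l * (x ord0 j * V i x)).
Proof.
have cV := cts_vcomp vC1; apply: ctsD; first exact: ctsM.
under eq_fun do rewrite -mulNr.
by apply: ctsM; [exact: cts_cst|apply: ctsM => //; exact: cts_coor].
Qed.

Lemma mom_density_Cc F dF r : (forall i, has_grad (F i) (dF i)) -> (forall i, supp_in r (F i)) ->
  Cc r (mom_density F dF).
Proof.
move=> FdF sF; apply: Cc_sum => i; apply: Cc_add.
  apply: Cc_mul; last exact: has_grad_Cc0 (FdF i) (sF i).
  by apply: ctsM; [exact: cts_cst|exact: cts_vcomp].
apply: Cc_sum => j; apply: Cc_mul; first exact: cts_flux.
exact: has_grad_Cc (FdF i) (sF i).
Qed.

Lemma momentum_field F dF r : (forall i, has_grad (F i) (dF i)) -> (forall i, supp_in r (F i)) ->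
  Int (mom_density F dF) + Int (fun x => q x * \sum_i dF i i x) = 0.
Proof.
move=> FdF sF.
have iq i : itg (fun x => q x * dF i i x) by exact: loc_itg_Cc (has_grad_Cc i (FdF i) (sF i)).
have im i : itg (fun x => k * V i x * F i x + \sum_j (V j x * V i x - l * (x ord0 j * V i x)) * dF i j x).
  apply: (@Cc_itg _ _ r); apply: Cc_add.
    apply: Cc_mul; last exact: has_grad_Cc0 (FdF i) (sF i).
    by apply: ctsM; [exact: cts_cst|exact: cts_vcomp].
  apply: Cc_sum => j; apply: Cc_mul; first exact: cts_flux.
  exact: has_grad_Cc (FdF i) (sF i).
rewrite /mom_density Int_sum//.
rewrite (_ : (fun x => q x * _) = (fun x => \sum_i q x * dF i i x)); last first.
  by apply/funext => x; rewrite mulr_sumr.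
rewrite Int_sum// -big_split/= big1// => i _.
rewrite -IntD// -[RHS](momentum_weak vC1 qloc vmom i (FdF i) (sF i)).
congr Int; apply/funext => x; rewrite -addrA; congr (_ + _).
rewrite (bigD1 i)//= [in RHS](bigD1 i)//= eqxx mul1r.
rewrite [in RHS](eq_bigr (fun j => (V j x * V i x - l * (x ord0 j * V i x)) * dF i j x)).
  by ring.
by move=> j /negbTE ->; rewrite mul0r addr0.
Qed.

Definition energy (x : X) : R := \sum_i V i x ^+ 2.
Definition denergy j (x : X) : R := \sum_i (V i x * dV i j x) *+ 2.

Lemma energy_grad : has_grad energy denergy.
Proof.
apply: has_grad_ext (has_grad_sum (fun i => has_gradM (vcomp_grad vC1 i) (vcomp_grad vC1 i))) _ _.
  by move=> x; apply: eq_bigr => i _; rewrite expr2.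
by move=> j x; apply: eq_bigr => i _; rewrite mulr2n.
Qed.

(** The test field is phi v, whose divergence is v . grad phi because div v = 0. The terms with
    derivatives of v combine into derivatives of |v|^2, which are removed by integrating the
    divergences of phi |v|^2 v and of phi |v|^2 x. *)
Lemma energy_identity phi dphi r : alpha = N%:R / 2 ->
  has_grad phi dphi -> supp_in r phi ->
  2^-1 * Int (fun x => energy x * \sum_j V j x * dphi j x) +
    Int (fun x => q x * \sum_j V j x * dphi j x) =
  l / 2 * Int (fun x => energy x * \sum_j x ord0 j * dphi j x).
Proof.
move=> ha pdp sp; have cp := has_grad_Cc0 pdp sp.
have cdp j := has_grad_Cc j pdp sp.
have gV := vcomp_grad vC1; have cV := cts_vcomp vC1.
have cE : continuous energy by exact: has_grad_continuous energy_grad.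
have FdF i := has_gradM pdp (gV i).
have sF i : supp_in r (fun x => phi x * V i x) by move=> x /sp ->; rewrite mul0r.
have peg := has_gradM pdp energy_grad.
have spe : supp_in r (fun x => phi x * energy x) by move=> x /sp ->; rewrite mul0r.
have cpeg j : Cc r (fun x => phi x * denergy j x + energy x * dphi j x) := has_grad_Cc j peg spe.
have := momentum_field FdF sF.
have -> : (fun x => q x * \sum_i (phi x * dV i i x + V i x * dphi i x)) =
    (fun x => q x * \sum_j V j x * dphi j x).
  by apply/funext => x; rewrite big_split/= -mulr_sumr divfree// mulr0 add0r.
have T1 := divfree_weak vC1 vdiv peg spe.
have T2 j : Int (fun x => x ord0 j * (phi x * denergy j x + energy x * dphi j x) +
    phi x * energy x) = 0.
  have sx : supp_in r (fun x : X => x ord0 j * (phi x * energy x)).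
    by move=> x /spe ->; rewrite mulr0.
  rewrite -[RHS](Int_grad j (has_gradM (has_grad_coor j) peg) sx).
  by congr Int; apply/funext => x; rewrite eqxx mulr1.
set A := fun x : X => \sum_j V j x * (phi x * denergy j x + energy x * dphi j x).
set B := fun x : X => \sum_j (x ord0 j * (phi x * denergy j x + energy x * dphi j x) + phi x * energy x).
set C := fun x : X => energy x * \sum_j V j x * dphi j x.
set D := fun x : X => energy x * \sum_j x ord0 j * dphi j x.
have -> : mom_density (fun i x => phi x * V i x) (fun i j x => phi x * dV i j x + V i x * dphi j x) =
    (fun x => 2^-1 * A x + 2^-1 * C x - l / 2 * B x - l / 2 * D x).
  apply/funext => x; rewrite /mom_density.
  transitivity (k * phi x * energy x + \sum_j (V j x - l * x ord0 j) *
      (2^-1 * phi x * denergy j x + energy x * dphi j x)).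
    rewrite big_split/=; congr (_ + _).
      by rewrite /energy mulr_sumr; apply: eq_bigr => i _; ring.
    rewrite exchange_big/=; apply: eq_bigr => j _.
    rewrite /denergy /energy mulr_sumr mulr_suml -big_split/= mulr_sumr.
    by apply: eq_bigr => i _; rewrite mulr2n; move: l => L; field.
  have -> : B x = (\sum_j x ord0 j * (phi x * denergy j x + energy x * dphi j x)) + N%:R * (phi x * energy x).
    by rewrite /B big_split/= sumr_const card_ord mulr_natl.
  (* Here alpha = N / 2 enters: this term is exactly compensated by the divergence N of the field x
     inside [B]. *)
  have -> : k * phi x * energy x = - (l / 2) * (N%:R * (phi x * energy x)).
    have -> : alpha - N%:R = - (N%:R / 2) by rewrite ha; lra.
    by ring.
  set S := \sum_j x ord0 j * (phi x * denergy j x + energy x * dphi j x).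
  suff -> : \sum_j (V j x - l * x ord0 j) * (2^-1 * phi x * denergy j x + energy x * dphi j x) =
      2^-1 * A x + 2^-1 * C x - l / 2 * S - l / 2 * D x by ring.
  rewrite /A /C /D /S !mulr_sumr -!sumrN -!big_split/=; apply: eq_bigr => j _.
  by move: l => L; field.
have iA : itg A.
  by apply: itg_sum => j; exact: (Cc_itg (Cc_mul (cV j) (cpeg j))).
have iB1 j : itg (fun x => x ord0 j * (phi x * denergy j x + energy x * dphi j x) + phi x * energy x).
  apply: (@Cc_itg _ _ r); apply: Cc_add.
    by apply: Cc_mul => //; exact: cts_coor.
  exact: has_grad_Cc0 peg spe.
have iB : itg B by exact: itg_sum.
have iC : itg C.
  by apply: (@Cc_itg _ _ r); apply: Cc_mul => //; apply: Cc_sum => j; exact: Cc_mul.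
have iD : itg D.
  by apply: (@Cc_itg _ _ r); apply: Cc_mul => //; apply: Cc_sum => j; apply: Cc_mul => //; exact: cts_coor.
rewrite IntB; [|apply: itgB; [apply: itgD|]; exact: itgZ|exact: itgZ].
rewrite IntB; [|apply: itgD; exact: itgZ|exact: itgZ].
rewrite IntD; [|exact: itgZ|exact: itgZ].
rewrite !IntZ// T1 (_ : Int B = 0); last by rewrite /B Int_sum// big1.
by move=> H; lra.
Qed.

(** The test field is grad psi. The terms linear in v are combinations of v . grad psi and v . grad
    (x . grad psi), whose integrals vanish because v is divergence-free. *)
Lemma pressure_identity psi P (H : 'I_N -> 'I_N -> X -> R) r :
  has_grad psi P -> (forall i, has_grad (P i) (H i)) -> supp_in r psi ->
  (forall i j x, H i j x = H j i x) ->
  Int (fun x => q x * \sum_i H i i x) = - Int (fun x => \sum_i \sum_j V i x * V j x * H i j x).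
Proof.
move=> psiP PH sp symH.
have sP i : supp_in r (P i) := (has_grad_Cc i psiP sp).2.
have cP i : Cc r (P i) := has_grad_Cc i psiP sp.
have cH i j : Cc r (H i j) := has_grad_Cc j (PH i) (sP i).
have cV := cts_vcomp vC1.
apply/eqP; rewrite -addr_eq0 addrC; apply/eqP.
rewrite -[RHS](momentum_field PH sP); congr (_ + _).

(* The gradient of x . grad psi equals grad psi plus the Hessian applied to x. The second part,
   paired with v, is the transport term of the equation. *)
have gf2 := has_grad_sum (fun j => has_gradM (has_grad_coor j) (PH j)).
have sf2 : supp_in r (fun x : X => \sum_j (x ord0 j * P j x)).
  by move=> x rx; apply: big1 => j _; rewrite sP// mulr0.
have T1 := divfree_weak vC1 vdiv psiP sp.
have T2 := divfree_weak vC1 vdiv gf2 sf2.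
set A := fun x : X => \sum_j V j x * P j x in T1.
set B := (fun x => _) in T2.
set W := fun x : X => \sum_i _.
have iA : itg A by apply: itg_sum => j; exact: (Cc_itg (Cc_mul (cV j) (cP j))).
have iB : itg B.
  apply: itg_sum => j; apply: (@Cc_itg _ _ r); apply: Cc_mul => //.
  exact: has_grad_Cc j gf2 sf2.
have iW : itg W.
  apply: itg_sum => i; apply: itg_sum => j; apply: (@Cc_itg _ _ r); apply: Cc_mul => //.
  exact: ctsM.
have -> : mom_density P H = (fun x => W x + (k + l) * A x - l * B x).
  apply/funext => x; rewrite /mom_density.
  have -> : B x = A x + \sum_i \sum_j V i x * (x ord0 j * H i j x).
    rewrite /A /B -big_split/=; apply: eq_bigr => i _.
    rewrite -mulr_sumr -mulrDr; congr (_ * _).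
    rewrite big_split/= addrC; congr (_ + _); last by apply: eq_bigr => j _; rewrite symH.
    rewrite (bigD1 i)//= eqxx mulr1 big1 ?addr0// => j /negbTE ji.
    by rewrite eq_sym ji mulr0.
  set S := \sum_i \sum_j V i x * (x ord0 j * H i j x).
  rewrite (_ : W x + _ - _ = k * A x + W x - l * S); last by ring.
  rewrite /W /A /S !mulr_sumr -sumrN -!big_split/=; apply: eq_bigr => i _.
  rewrite mulrA -addrA; congr (_ + _).
  rewrite mulr_sumr -sumrN -big_split/=; apply: eq_bigr => j _; ring.
rewrite IntB; [|apply: itgD => //; exact: itgZ|exact: itgZ].
by rewrite IntD//; [rewrite !IntZ// T1 T2 !mulr0 addr0 subr0|exact: itgZ].
Qed.

End identities.

(** * The regularised fundamental solution *)

Section radial.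
Context {R : realType} {N : nat}.
Local Notation X := 'rV[R]_N.

(** Radial functions are expressed through |x|^2, which unlike |x| is smooth at the origin. *)
Definition sqn (x : X) : R := \sum_i x ord0 i ^+ 2.

Lemma sqn_ge0 x : 0 <= sqn x.
Proof. by apply: sumr_ge0 => i _; exact: sqr_ge0. Qed.

Lemma enormE (x : X) : enorm x ^+ 2 = sqn x.
Proof. by rewrite sqr_sqrtr// sqn_ge0. Qed.

Lemma enorm_ge0 (x : X) : 0 <= enorm x.
Proof. exact: sqrtr_ge0. Qed.

Lemma norm_enorm (x : X) : `|x| <= enorm x.
Proof.
apply: norm_le_coor => [|i]; first exact: enorm_ge0.
rewrite -ler_sqr ?nnegrE ?enorm_ge0// real_normK ?num_real// enormE /sqn (bigD1 i)//= lerDl.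
by apply: sumr_ge0 => j _; exact: sqr_ge0.
Qed.

Lemma coor_enorm (x : X) i : `|x ord0 i| <= enorm x.
Proof. exact: le_trans (coor_le_norm x i) (norm_enorm x). Qed.

Lemma enorm_le_norm (x : X) : enorm x <= N%:R * `|x|.
Proof.
rewrite -ler_sqr ?nnegrE ?enorm_ge0 ?mulr_ge0// enormE exprMn.
have [N0|N0] := posnP N.
  rewrite /sqn big1 ?mulr_ge0 ?sqr_ge0// => -[i iN] _.
  by exfalso; move: iN; rewrite {1}N0.
apply: (@le_trans _ _ (\sum_(i < N) `|x| ^+ 2)).
  by apply: ler_sum => i _; rewrite -real_normK ?num_real// ler_sqr ?nnegrE// coor_le_norm.
rewrite sumr_const card_ord -[leLHS]mulr_natl ler_wpM2r ?sqr_ge0// -natrX ler_nat.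
by rewrite leq_pmull.
Qed.

Lemma sqn_grad : has_grad sqn (fun i x => 2 * x ord0 i).
Proof.
apply: has_grad_ext (has_grad_sum (fun i => has_gradM (has_grad_coor i) (has_grad_coor i))) _ _.
  by move=> x; apply: eq_bigr => i _; rewrite expr2.
move=> i x; rewrite (bigD1 i)//= eqxx mulr1 big1 => [|j /negbTE ji]; first by ring.
by rewrite eq_sym ji !mulr0 addr0.
Qed.

Lemma sqn_continuous : continuous sqn.
Proof. exact: has_grad_continuous sqn_grad. Qed.

Lemma sqn_gt (x : X) r : 0 <= r -> r < `|x| -> r ^+ 2 < sqn x.
Proof.
move=> r0 rx; rewrite -enormE ltr_sqr ?nnegrE ?enorm_ge0//.
exact: lt_le_trans rx (norm_enorm x).
Qed.

Lemma antiderivative (g : R -> R) S : 0 <= S -> continuous g ->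
  (forall s, S <= s -> g s = 0) ->
  exists2 G : R -> R, (forall s : R, 0 <= s -> is_derive s (1 : R) G (g s)) &
    forall s, S <= s -> G s = 0.
Proof.
move=> S0 cg gS.
(* The lower end is -1, so that every s >= 0 is an interior point and the derivative at 0 is
   two-sided. *)
pose F (x : R) : R := \int[lebesgue_measure]_(t in `[- 1 : R, x]) g t.
have FD (s : R) : 0 <= s -> is_derive s (1 : R) F (g s).
  move=> s0.
  have ig : lebesgue_measure.-integrable `[- 1 : R, s + 1] (EFin \o g).
    apply: continuous_compact_integrable; first exact: segment_compact.
    exact: continuous_subspaceT.
  have [] := @continuous_FTC1_closed _ g (- 1) s (s + 1) _ ig _ (cg s).
  - by rewrite ltrDl.
  - by apply: lt_le_trans s0.
  by move=> D E; apply: DeriveDef; [exact: D|rewrite -derive1E; exact: E].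
exists (fun s => F s - F S) => s s0.
  by have := FD _ s0 => H; apply: is_derive_eq; rewrite subr0.
have D (t : R) : t \in `]S, s[ -> is_derive t (1 : R) F (g t).
  by rewrite in_itv/= => /andP[St _]; apply: FD; lra.
have [|c] := MVT_segment s0 D.
  apply: derivable_within_continuous => t; rewrite in_itv/= => /andP[St _].
  by have [] := FD t (le_trans S0 St).
by rewrite in_itv/= => /andP[/gS -> _] ->; rewrite mul0r.
Qed.

Lemma radial_grad (g : R -> R) S : 0 <= S -> continuous g ->
  (forall s, S <= s -> g s = 0) ->
  exists2 G : X -> R, has_grad G (fun i x => 2 * (x ord0 i * g (sqn x))) &
    forall x, S <= sqn x -> G x = 0.
Proof.
move=> S0 cg gS; have [G GD GS] := antiderivative S0 cg gS.
exists (fun x => G (sqn x)) => [|x]; last exact: GS.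
have := @has_grad_comp _ _ _ _ G g sqn_grad; move/(_ _ _)/has_grad_ext; apply => //.
- by move=> x; apply: GD; exact: sqn_ge0.
- by move=> x; apply: continuous_comp; [exact: sqn_continuous|exact: cg].
- by move=> i x; ring.
Qed.

Lemma radial_grad2 (g g' : R -> R) : (forall s : R, is_derive s (1 : R) g (g' s)) -> continuous g' ->
  forall j, has_grad (fun x : X => 2 * (x ord0 j * g (sqn x)))
    (fun i x => 2 * (i == j)%:R * g (sqn x) + 4 * (x ord0 i * x ord0 j) * g' (sqn x)).
Proof.
move=> gD cg j.
have := @has_grad_comp _ _ _ _ g g' sqn_grad (fun x => gD _) _.
have C : continuous (fun x => g' (sqn x)).
  by move=> x; apply: continuous_comp; [exact: sqn_continuous|exact: cg].
move=> /(_ C) /(has_gradM (has_grad_coor j)) /(has_gradZ 2) /has_grad_ext; apply => //.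
by move=> i x; ring.
Qed.

End radial.

(** * Radial profiles and kernels *)

Section profile.
Context {R : realType} (N : nat).
Local Notation a := (N%:R / 2 : R).

(* Third order Taylor polynomial at 1 of s^(- N / 2), the radial derivative of
   the fundamental solution of the Laplacian in terms of s = |x|^2. *)
Definition core (s : R) : R := 1 + a * (1 - s) + a * (a + 1) / 2 * (1 - s) ^+ 2
  + a * (a + 1) * (a + 2) / 6 * (1 - s) ^+ 3.
Definition dcore (s : R) : R := - (a + a * (a + 1) * (1 - s) +
  a * (a + 1) * (a + 2) / 2 * (1 - s) ^+ 2).
Definition d2core (s : R) : R := a * (a + 1) + a * (a + 1) * (a + 2) * (1 - s).

Definition prof := piecewise 1 core (fun s => s `^ (- a)).
Definition dprof := piecewise 1 dcore (fun s => - a * s `^ (- a - 1)).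
Definition d2prof := piecewise 1 d2core (fun s => - a * ((- a - 1) * s `^ (- a - 1 - 1))).

Lemma horner_derive (c0 c1 c2 c3 s : R) :
  is_derive s (1 : R) (fun s => c0 + c1 * (1 - s) + c2 * (1 - s) ^+ 2 + c3 * (1 - s) ^+ 3)
    (- (c1 + 2 * c2 * (1 - s) + 3 * c3 * (1 - s) ^+ 2)).
Proof.
by apply: is_derive_eq; rewrite /GRing.scale/=; ring.
Qed.

Lemma prof_derive s : is_derive s (1 : R) prof (dprof s).
Proof.
apply: piecewise_derive => {s} [s _|s s1||].
- apply: is_derive_eq (horner_derive _ _ _ _ _) _.
  by rewrite /dcore; field.
- by apply: is_derive1_powR; exact: lt_le_trans s1.
- by rewrite powR1 /core subrr !expr0n/= !mulr0 !addr0.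
- by rewrite powR1 /dcore subrr !expr0n/= !mulr0 !addr0 mulr1.
Qed.

Lemma dprof_derive s : is_derive s (1 : R) dprof (d2prof s).
Proof.
apply: piecewise_derive => {s} [s _|s s1||].
- have := horner_derive (- a) (- (a * (a + 1))) (- (a * (a + 1) * (a + 2) / 2)) 0 s.
  rewrite (_ : (fun _ => _) = dcore); last by apply/funext => t; rewrite /dcore; ring.
  by move=> H; apply: is_derive_eq H _; rewrite /d2core; field.
- have s0 : 0 < s by exact: lt_le_trans s1.
  have H := is_derive1_powR (- a - 1) s0.
  by apply: is_derive_eq; rewrite /GRing.scale/=; ring.
- by rewrite powR1 /dcore subrr !expr0n/= !mulr0 !addr0 mulr1.
- by rewrite powR1 /d2core subrr !mulr0 !addr0 mulr1; ring.
Qed.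

End profile.

Section kernel.
Context {R : realType} {N : nat}.
Context (N_gt0 : (0 < N)%N).
Local Notation X := 'rV[R]_N.
Local Notation a := (N%:R / 2 : R).
Local Notation Int := (@Int R N).
Local Notation prof := (@prof R N).
Local Notation dprof := (@dprof R N).
Local Notation d2prof := (@d2prof R N).

Let a_gt0 : 0 < a. Proof. by rewrite divr_gt0// ltr0n. Qed.

Lemma powR_sqr (r : R) (m : nat) : 0 < r -> (r ^+ 2) `^ (- (m%:R / 2)) = r ^- m.
Proof.
move=> r0; rewrite -powR_mulrn ?ltW// -powRrM -powR_mulrn ?ltW// -powRN.
by congr (_ `^ _); field.
Qed.

Lemma profE (r : R) : 1 <= r -> prof (r ^+ 2) = r ^- N.
Proof.
move=> r1; have r0 : 0 < r by exact: lt_le_trans r1.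
rewrite /prof /piecewise; case: leP => r21; last exact: powR_sqr.
have -> : r = 1 by apply/le_anti; rewrite r1 -(@expr_le1 _ 2)// ?r21 ?ltW.
by rewrite /core !expr1n subrr !expr0n/= !mulr0 !addr0 invr1.
Qed.

Lemma dprofE (r : R) : 1 <= r -> dprof (r ^+ 2) = - a * r ^- N.+2.
Proof.
move=> r1; have r0 : 0 < r by exact: lt_le_trans r1.
rewrite /dprof /piecewise; case: leP => r21; last first.
  by rewrite -powR_sqr//; congr (_ * (_ `^ _)); rewrite -!natr1; field.
have -> : r = 1 by apply/le_anti; rewrite r1 -(@expr_le1 _ 2)// ?r21 ?ltW.
by rewrite /dcore !expr1n subrr !expr0n/= !mulr0 !addr0 invr1 mulr1.
Qed.

(** The weights r^N and r^(N+2) are those for which the bounds survive the rescaling of [sprof] with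
    the same constant, whatever the scale. *)
Lemma prof_bound : exists2 C : R, 0 <= C & forall r, 0 <= r ->
  r ^+ N * `|prof (r ^+ 2)| <= C /\ r ^+ N.+2 * `|dprof (r ^+ 2)| <= C.
Proof.
have a0 := a_gt0.
pose C := (1 + a + a * (a + 1) + a * (a + 1) * (a + 2)) : R.
have C0 : 0 <= C by rewrite /C; nra.
exists C => // r r0; have [r1|r1] := leP r 1.
  have r21 : r ^+ 2 <= 1 by rewrite expr_le1.
  have r20 : 0 <= r ^+ 2 by exact: sqr_ge0.
  rewrite /prof /dprof /piecewise r21 /core /dcore.
  (* For r <= 1 the Taylor polynomials have nonnegative coefficients in u and are bounded by their
     values at u = 1. *)
  have [u0 u1] : 0 <= 1 - r ^+ 2 /\ 1 - r ^+ 2 <= 1 by split; lra.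
  set u := 1 - r ^+ 2 in u0 u1 *.
  have u20 : 0 <= u ^+ 2 by exact: sqr_ge0.
  have u21 : u ^+ 2 <= 1 by rewrite expr_le1.
  have u30 : 0 <= u ^+ 3 by exact: exprn_ge0.
  have u31 : u ^+ 3 <= 1 by rewrite expr_le1.
  have b0 : 0 <= a * (a + 1) by nra.
  have c0 : 0 <= a * (a + 1) * (a + 2) by nra.
  rewrite /C; move: b0 c0; set b := a * (a + 1); set c := b * (a + 2) => b0 c0.
  split; rewrite -[leRHS]mul1r; apply: ler_pM; rewrite ?exprn_ge0 ?expr_le1//.
    rewrite ger0_norm; first by nra.
    by nra.
  by rewrite normrN ger0_norm; nra.
have r10 := lt_trans ltr01 r1.
have rN (m : nat) : r ^+ m * r ^- m = 1 by rewrite mulfV// expf_neq0// gt_eqF.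
have i0 m : 0 <= r ^- m by rewrite invr_ge0 exprn_ge0// ltW.
split; first by rewrite profE ?ltW// ger0_norm// rN /C; nra.
rewrite dprofE ?ltW// normrM normrN !ger0_norm ?(ltW a0)// mulrCA rN /C; nra.
Qed.

(** The rescaling keeps s^(-N/2) unchanged for s >= e^2, so profiles at two scales coincide outside
    the larger ball. *)
Definition sprof (e s : R) := e ^- N * prof (s / e ^+ 2).
Definition dsprof (e s : R) := e ^- N * (dprof (s / e ^+ 2) / e ^+ 2).
Definition d2sprof (e s : R) := e ^- N * (d2prof (s / e ^+ 2) / e ^+ 2 / e ^+ 2).

Lemma scale_derive (f f' : R -> R) (c b s : R) : (forall s : R, is_derive s (1 : R) f (f' s)) ->
  is_derive s (1 : R) (fun s => c * f (s / b)) (c * (f' (s / b) / b)).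
Proof.
move=> fd.
have H : is_derive s (1 : R) (fun s : R => s / b) b^-1.
  by apply: is_derive_eq; rewrite /GRing.scale/=; ring.
have H2 := @is_derive1_comp _ f (fun s : R => s / b) s _ _ (fd (s / b)) H.
have H3 : is_derive s (1 : R) (fun s : R => c * f (s / b)) _ := is_deriveZ c H2.
by apply: is_derive_eq H3 _.
Qed.

Lemma sprof_derive e (s : R) : is_derive s (1 : R) (sprof e) (dsprof e s).
Proof. by apply: scale_derive => t; exact: prof_derive. Qed.

Lemma dsprof_derive e (s : R) : is_derive s (1 : R) (dsprof e) (d2sprof e s).
Proof.
apply: (@scale_derive (fun t => dprof t / e ^+ 2) (fun t => d2prof t / e ^+ 2)) => t.
have := is_deriveZ (e ^- 2) (dprof_derive N t).
rewrite (_ : (_ \*: _) = (fun t => dprof t / e ^+ 2)); last first.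
  by apply/funext => u; rewrite mulrC.
by rewrite [_ *: _]mulrC.
Qed.

Lemma sprof_far e (r : R) : 0 < e -> e <= r -> sprof e (r ^+ 2) = r ^- N.
Proof.
move=> e0 er; rewrite /sprof -expr_div_n profE ?ler_pdivlMr ?mul1r//.
by rewrite expr_div_n invfM invrK mulrCA mulVf ?mulr1// expf_neq0// gt_eqF.
Qed.

Lemma sprof_bound C : (forall r, 0 <= r ->
    r ^+ N * `|prof (r ^+ 2)| <= C /\ r ^+ N.+2 * `|dprof (r ^+ 2)| <= C) ->
  forall e r, 0 < e -> 0 <= r -> r ^+ N * `|sprof e (r ^+ 2)| <= C /\
     r ^+ N.+2 * `|dsprof e (r ^+ 2)| <= C.
Proof.
move=> HC e r e0 r0; have [|H1 H2] := HC (r / e); first by rewrite divr_ge0// ltW.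
have eN m : 0 < e ^+ m by exact: exprn_gt0.
rewrite /sprof /dsprof !normrM !normfV !(gtr0_norm (eN _)) -expr_div_n; split.
  by move: H1; rewrite mulrA -expr_div_n.
move: H2; rewrite expr_div_n.
by rewrite !expr_div_n -addn2 !exprD invfM => H; apply: le_trans H; rewrite le_eqVlt; apply/orP; left; apply/eqP; ring.
Qed.

Definition bulk (s : R) : R := 2 / 3 * a * (a + 1) * (a + 2) * (a + 3) * (1 - s) ^+ 3.
Definition dbulk (s : R) : R := - (2 * a * (a + 1) * (a + 2) * (a + 3) * (1 - s) ^+ 2).
Definition d2bulk (s : R) : R := 4 * a * (a + 1) * (a + 2) * (a + 3) * (1 - s).
(** The order 3 of the Taylor polynomial [core] yields the power (1 - s)^3 here. Cut at s = 1 it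
    still has two derivatives, and the second one makes the first one continuous. *)
Definition lapl := piecewise 1 bulk (fun=> 0).
Definition dlapl := piecewise 1 dbulk (fun=> 0).
Definition d2lapl := piecewise 1 d2bulk (fun=> 0).

Lemma lapl_derive (s : R) : is_derive s (1 : R) lapl (dlapl s).
Proof.
apply: piecewise_derive => {s} [s _||].
- have := horner_derive 0 0 0 (2 / 3 * a * (a + 1) * (a + 2) * (a + 3)) s.
  rewrite (_ : (fun _ => _) = bulk); last by apply/funext => t; rewrite /bulk; ring.
  by move=> H; apply: is_derive_eq H _; rewrite /dbulk; field.
- by rewrite /bulk subrr expr0n/= mulr0.
- by rewrite /dbulk subrr expr0n/= mulr0 oppr0.
Qed.

Lemma dlapl_derive (s : R) : is_derive s (1 : R) dlapl (d2lapl s).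
Proof.
apply: piecewise_derive => {s} [s _||].
- have := horner_derive 0 0 (- (2 * a * (a + 1) * (a + 2) * (a + 3))) 0 s.
  rewrite (_ : (fun _ => _) = dbulk); last by apply/funext => t; rewrite /dbulk; ring.
  by move=> H; apply: is_derive_eq H _; rewrite /d2bulk; field.
- by rewrite /dbulk subrr expr0n/= mulr0 oppr0.
- by rewrite /d2bulk subrr mulr0.
Qed.

(* If G(x) = g(|x|^2) and g' = prof, then the Laplacian of G at x is
   2 N prof(s) + 4 s prof'(s) with s = |x|^2; it vanishes for s > 1 because there
   G is the fundamental solution up to a factor and a constant. *)
Lemma laplE (s : R) : 0 <= s -> 2 * N%:R * prof s + 4 * s * dprof s = lapl s.
Proof.
move=> s0; rewrite /prof /dprof /lapl /piecewise; case: leP => s1.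
  rewrite /core /dcore /bulk (_ : N%:R = 2 * a); last by field.
  by move: (a) => b; field.
have s00 : 0 < s by exact: lt_trans s1.
have -> : s `^ (- a) = s * s `^ (- a - 1).
  by rewrite -{2}[s]powRr1 ?ltW// -powRD ?(gt_eqF s00) ?implybT//; congr (_ `^ _); ring.
by field.
Qed.

Lemma lapl_bounds (s : R) : 0 <= s -> [/\ 0 <= lapl s,
  `|lapl s| <= 2 * a * (a + 1) * (a + 2) * (a + 3) &
  `|dlapl s| <= 2 * a * (a + 1) * (a + 2) * (a + 3)].
Proof.
move=> s0; have a0 := a_gt0.
have K0 : 0 <= a * (a + 1) * (a + 2) * (a + 3) by rewrite !mulr_ge0//; lra.
have E c (x : R) : c * a * (a + 1) * (a + 2) * (a + 3) * x = c * (a * (a + 1) * (a + 2) * (a + 3)) * x by ring.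
have E2 : 2 * a * (a + 1) * (a + 2) * (a + 3) = 2 * (a * (a + 1) * (a + 2) * (a + 3)) by ring.
rewrite /lapl /dlapl /piecewise; case: (leP s 1) => s1; last first.
  by rewrite normr0 E2; split => //; lra.
rewrite /bulk /dbulk !E E2; move: (a * (a + 1) * (a + 2) * (a + 3)) K0 => K K0.
have u0 : 0 <= 1 - s by lra.
have u20 : 0 <= (1 - s) ^+ 2 by exact: sqr_ge0.
have u21 : (1 - s) ^+ 2 <= 1 by rewrite expr_le1//; lra.
have u30 : 0 <= (1 - s) ^+ 3 by exact: exprn_ge0.
have u31 : (1 - s) ^+ 3 <= 1 by rewrite expr_le1//; lra.
split.
- by rewrite !mulr_ge0.
- rewrite ger0_norm; last by rewrite !mulr_ge0.
  nra.
- rewrite normrN ger0_norm; last by rewrite !mulr_ge0.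
  nra.
Qed.

(** The Laplacian of the fundamental solution smoothed at scale e: a nonnegative mollifier supported
    in the ball of radius e. Its mass is a constant which is not normalised to 1 and appears below
    as [kap]. *)
Definition mol (e : R) (x : X) : R := e ^- N * lapl (sqn x / e ^+ 2).
Definition dmol (e : R) i (x : X) : R :=
  e ^- N * (dlapl (sqn x / e ^+ 2) / e ^+ 2) * (2 * x ord0 i).

Lemma mol_grad e : has_grad (mol e) (dmol e).
Proof.
apply: (@has_grad_comp _ _ _ _ (fun s => e ^- N * lapl (s / e ^+ 2))
  (fun s => e ^- N * (dlapl (s / e ^+ 2) / e ^+ 2)) sqn_grad) => [x|x].
  exact: scale_derive lapl_derive.
apply: (@continuous_comp _ _ _ (@sqn R N) (fun s => e ^- N * (dlapl (s / e ^+ 2) / e ^+ 2)) x).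
  exact: sqn_continuous.
apply: (@is_derive_continuous _ _ (fun s => e ^- N * (d2lapl (s / e ^+ 2) / e ^+ 2 / e ^+ 2))) => s.
apply: (@scale_derive (fun t => dlapl t / e ^+ 2) (fun t => d2lapl t / e ^+ 2)) => t.
have := is_deriveZ (e ^- 2) (dlapl_derive t).
rewrite (_ : (_ \*: _) = (fun t => dlapl t / e ^+ 2)); last first.
  by apply/funext => u; rewrite mulrC.
by rewrite [_ *: _]mulrC.
Qed.

Lemma supp_mol e : 0 < e -> supp_in e (mol e).
Proof.
move=> e0 x ex; have := sqn_gt (ltW e0) ex => H.
rewrite /mol /lapl /piecewise ifF ?mulr0//; apply/negbTE; rewrite -ltNge.
by rewrite ltr_pdivlMr ?exprn_gt0// mul1r.
Qed.

Lemma mol_ge0 e x : 0 < e -> 0 <= mol e x.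
Proof.
move=> e0; rewrite mulr_ge0 ?invr_ge0 ?exprn_ge0 ?(ltW e0)//.
by have [] := @lapl_bounds (sqn x / e ^+ 2) (divr_ge0 (sqn_ge0 x) (sqr_ge0 e)).
Qed.

Lemma mol_bounds : exists2 C : R, 0 <= C & forall e x, 0 < e ->
  `|mol e x| <= C * e ^- N /\ forall i, `|dmol e i x| <= C * e ^- N.+1.
Proof.
have a0 := a_gt0.
pose K := (2 * a * (a + 1) * (a + 2) * (a + 3)) : R.
have K0 : 0 <= K by rewrite /K !mulr_ge0//; lra.
exists (2 * K) => [|e x e0]; first by rewrite mulr_ge0.
have [_ b1 b2] := @lapl_bounds (sqn x / e ^+ 2) (divr_ge0 (sqn_ge0 x) (sqr_ge0 e)).
have eN m : 0 < e ^+ m by exact: exprn_gt0.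
have ei : 0 <= e ^- N by rewrite invr_ge0 ltW.
split=> [|i].
  rewrite /mol normrM normfV (gtr0_norm (eN N)) mulrC ler_wpM2r//.
  by apply: le_trans b1 _; rewrite -/K; lra.
have [xe|xe] := leP (sqn x) (e ^+ 2); last first.
  rewrite /dmol /dlapl /piecewise ifF; first by rewrite mul0r mulr0 mul0r normr0 mulr_ge0 ?mulr_ge0// invr_ge0 ltW//.
  by apply/negbTE; rewrite -ltNge ltr_pdivlMr ?exprn_gt0// mul1r.
have xie : `|x ord0 i| <= e.
  apply: le_trans (coor_enorm x i) _.
  by rewrite -ler_sqr ?nnegrE ?enorm_ge0 ?(ltW e0)// enormE.
rewrite /dmol !normrM !normfV !(gtr0_norm (eN _)) (gtr0_norm (_ : 0 < 2))//.
apply: (@le_trans _ _ (e ^- N * (K / e ^+ 2) * (2 * e))).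
  apply: ler_pM => //; first by rewrite mulr_ge0// divr_ge0// ltW.
    by rewrite ler_wpM2l// ler_wpM2r// invr_ge0 ltW.
  by rewrite ler_wpM2l.
rewrite [e ^+ N.+1]exprS; have EN := lt0r_neq0 (eN N); have e1 := lt0r_neq0 e0.
move: (e ^+ N) EN => E EN; rewrite le_eqVlt; apply/orP; left; apply/eqP; field.
by rewrite e1 EN.
Qed.

(* The gradient of a difference of fundamental solutions smoothed at the scales
   e and T: the two agree beyond the radius T, so it is compactly supported. *)
Definition kern (e T : R) (j : 'I_N) (x : X) : R :=
  2 * (x ord0 j * (sprof e (sqn x) - sprof T (sqn x))).
Definition dkern (e T : R) (j i : 'I_N) (x : X) : R :=
  2 * (i == j)%:R * (sprof e (sqn x) - sprof T (sqn x)) +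
  4 * (x ord0 i * x ord0 j) * (dsprof e (sqn x) - dsprof T (sqn x)).

Lemma kern_grad e T j : has_grad (kern e T j) (dkern e T j).
Proof.
apply: (@radial_grad2 _ _ (fun s => sprof e s - sprof T s) (fun s => dsprof e s - dsprof T s)).
  by move=> s; apply: is_deriveB; exact: sprof_derive.
apply: (@is_derive_continuous _ _ (fun s => d2sprof e s - d2sprof T s)) => s.
by apply: is_deriveB; exact: dsprof_derive.
Qed.

Lemma kern_potential e T : 0 < e -> e <= T ->
  exists2 G : X -> R, has_grad G (kern e T) & supp_in T G.
Proof.
move=> e0 eT; have T0 := lt_le_trans e0 eT.
have [|s|s sT|G GD GS] := @radial_grad R N (fun s => sprof e s - sprof T s) (T ^+ 2).
- exact: sqr_ge0.
- apply: (@is_derive_continuous _ _ (fun s => dsprof e s - dsprof T s)) => t.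
  by apply: is_deriveB; exact: sprof_derive.
- have s0 : 0 <= s by apply: le_trans sT; exact: sqr_ge0.
  have Ts : T <= Num.sqrt s by rewrite -ler_sqr ?nnegrE ?sqrtr_ge0 ?(ltW T0)// sqr_sqrtr.
  rewrite -(sqr_sqrtr s0) !sprof_far ?subrr//; exact: le_trans Ts.
exists G => // x xT; apply: GS; apply/ltW/sqn_gt => //; exact: ltW.
Qed.

Lemma dkern_sym e T i j x : dkern e T i j x = dkern e T j i x.
Proof. by rewrite /dkern eq_sym [x ord0 j * _]mulrC. Qed.

Lemma dkern_trace e T x : 0 < e -> 0 < T -> \sum_i dkern e T i i x = mol e x - mol T x.
Proof.
move=> e0 T0.
have E d : 0 < d -> mol d x = 2 * N%:R * sprof d (sqn x) + 4 * sqn x * dsprof d (sqn x).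
  move=> d0; rewrite /mol -laplE ?divr_ge0 ?sqn_ge0 ?sqr_ge0// /sprof /dsprof.
  by rewrite mulrDr; congr (_ + _); ring.
rewrite (E e)// (E T)// /dkern.
rewrite (eq_bigr (fun i => 2 * (sprof e (sqn x) - sprof T (sqn x)) +
  x ord0 i ^+ 2 * (4 * (dsprof e (sqn x) - dsprof T (sqn x))))) => [|i _]; last first.
  by rewrite eqxx mulr1 expr2; ring.
by rewrite big_split/= sumr_const card_ord -mulr_natr -mulr_suml -/(sqn x); ring.
Qed.

(** The bound |x|^-N is independent of both scales, which allows e to tend to 0 and T to infinity.
    The constant is 4 C from the diagonal term plus 8 C from the other. *)
Lemma dkern_bound : exists2 C : R, 0 <= C & forall e T i j x, 0 < e -> 0 < T ->
  enorm x ^+ N * `|dkern e T i j x| <= C.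
Proof.
have [C C0 HC] := prof_bound; exists (12 * C) => [|e T i j x e0 T0]; first by rewrite mulr_ge0.
have r0 := enorm_ge0 x.
have [e1 e2] := sprof_bound HC e0 r0; have [T1 T2] := sprof_bound HC T0 r0.
rewrite /dkern -enormE; move: (sprof e _) (sprof T _) (dsprof e _) (dsprof T _) e1 e2 T1 T2 => p1 p2 q1 q2 e1 e2 T1 T2.
set r := enorm x in r0 e1 e2 T1 T2 *.
have rN : 0 <= r ^+ N by exact: exprn_ge0.
have xx : `|x ord0 j * x ord0 i| <= r ^+ 2.
  by rewrite normrM expr2; apply: ler_pM => //; exact: coor_enorm.
have b1 : r ^+ N * `|2 * (j == i)%:R * (p1 - p2)| <= 4 * C.
  rewrite !normrM (gtr0_norm (_ : 0 < 2))//.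
  have : `|(j == i)%:R : R| <= 1 by case: eqP; rewrite ?normr1 ?normr0.
  have := ler_normB p1 p2; have := normr_ge0 (p1 - p2); have := normr_ge0 ((j == i)%:R : R).
  move: (`|p1 - p2|) (`|p1|) (`|p2|) e1 T1 (`|(j == i)%:R : R|) => p p1' p2' e1 T1 d d0 p0 pp d1.
  have : r ^+ N * p <= 2 * C by apply: (@le_trans _ _ (r ^+ N * (p1' + p2'))); [exact: ler_wpM2l|lra].
  have : d * (r ^+ N * p) <= r ^+ N * p by rewrite ler_piMl// mulr_ge0.
  by rewrite (_ : r ^+ N * (2 * d * p) = 2 * (d * (r ^+ N * p))); [lra|ring].
have b2 : r ^+ N * `|4 * (x ord0 j * x ord0 i) * (q1 - q2)| <= 8 * C.
  rewrite normrM [`|4 * _|]normrM (gtr0_norm (_ : 0 < 4))//.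
  apply: (@le_trans _ _ (r ^+ N * (4 * r ^+ 2 * (`|q1| + `|q2|)))).
    rewrite ler_wpM2l//; apply: ler_pM.
    - by rewrite mulr_ge0.
    - by [].
    - by rewrite ler_wpM2l.
    - exact: ler_normB.
  rewrite (_ : _ * _ = 4 * (r ^+ N.+2 * `|q1| + r ^+ N.+2 * `|q2|)); first by lra.
  have -> : r ^+ N.+2 = r ^+ N * r ^+ 2 by rewrite -exprD addn2.
  by ring.
apply: le_trans (ler_wpM2l rN (ler_normD _ _)) _; rewrite mulrDr; lra.
Qed.

(** The difference of the two mollifiers is the trace of [dkern], a sum of derivatives of compactly
    supported functions. *)
Lemma Int_mol e T : 0 < e -> e <= T -> Int (mol e) = Int (mol T).
Proof.
move=> e0 eT; have T0 := lt_le_trans e0 eT.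
have [G GD sG] := kern_potential e0 eT.
have sk i := (has_grad_Cc i GD sG).2.
have iH i j : itg (dkern e T i j) := Cc_itg (has_grad_Cc j (kern_grad e T i) (sk i)).
have im d : 0 < d -> itg (mol d).
  by move=> d0; apply: (Cc_itg (has_grad_Cc0 (mol_grad d) (supp_mol d0))).
apply/eqP; rewrite -subr_eq0 -IntB; [|exact: im|exact: im]; apply/eqP.
rewrite (_ : (fun x => _) = (fun x => \sum_i dkern e T i i x)).
  by rewrite Int_sum// big1// => i _; exact: (Int_grad i (kern_grad e T i) (sk i)).
by apply/funext => x; rewrite dkern_trace.
Qed.

Lemma Int_mol_const : exists2 kap : R, 0 < kap & forall e, 0 < e -> Int (mol e) = kap.
Proof.
exists (Int (mol 1)); last first.
  move=> e e0; have [e1|e1] := leP e 1; first exact: Int_mol.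
  by apply/esym/Int_mol => //; exact: ltW.
apply: (@Int_gt0 _ _ _ 1); first exact: has_grad_Cc0 (mol_grad 1) (supp_mol ltr01).
  by move=> x; exact: mol_ge0.
have a0 := a_gt0.
rewrite /mol expr1n invr1 mul1r /sqn big1 => [|i _]; last by rewrite mxE expr0n.
rewrite mul0r /lapl /piecewise ler01 /bulk subr0 expr1n mulr1 !mulr_gt0//; lra.
Qed.

End kernel.

(** * The pressure against mollifications at large scales *)

Section pressure.
Context {R : realType} {N : nat}.
Local Notation X := 'rV[R]_N.
Implicit Types (f g : X -> R) (df dg : 'I_N -> X -> R).
Local Notation Int := (@Int R N).
Local Notation itg := (@itg R N).
Context (v : X -> X) (q : X -> R) (alpha : R).
Context (N_gt1 : (1 < N)%N) (vC1 : C1 v) (vdiv : divergence_free v) (qloc : loc_integrable q).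
Context (vmom : profile_momentum alpha v q) (vL2 : itg (energy v)).
Local Notation V := (vcomp v).
Local Notation dV := (dvcomp v).
Local Notation l := ((1 + alpha)^-1).
Local Notation k := ((alpha - N%:R) * l).
Local Notation e := (energy v).

Let N_gt0 : (0 < N)%N. Proof. exact: ltnW. Qed.

Lemma energy_ge0 x : 0 <= e x.
Proof. by apply: sumr_ge0 => i _; exact: sqr_ge0. Qed.

Lemma vcomp_sqr_le i x : V i x ^+ 2 <= e x.
Proof. by rewrite /energy (bigD1 i)//= lerDl; apply: sumr_ge0 => j _; exact: sqr_ge0. Qed.

Lemma vcomp_mul_le i j x : `|V i x * V j x| <= e x.
Proof.
have hi := vcomp_sqr_le i x; have hj := vcomp_sqr_le j x.
rewrite ler_norml; apply/andP; split; nra.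
Qed.

(** Young's inequality with weight T. Applied on a cube of size T, it trades the volume T^N of the
    L^1 bound for the energy and a factor 1/T. *)
Lemma vcomp_le i x T : 0 < T -> `|V i x| <= T * e x + T^-1.
Proof.
move=> T0; have h := vcomp_sqr_le i x.
have [u0 uT] : 0 < T^-1 /\ T * T^-1 = 1 by rewrite invr_gt0 mulfV// gt_eqF.
rewrite -(ler_pM2l T0) mulrDr uT.
have : `|V i x| ^+ 2 <= e x by rewrite real_normK// num_real.
move: (`|V i x|) (normr_ge0 (V i x)) => y y0 ye.
have : (T * y) ^+ 2 <= T ^+ 2 * e x by rewrite exprMn ler_wpM2l// sqr_ge0.
rewrite [T ^+ 2]expr2 -mulrA => H.
by have := sqr_ge0 (T * y - 1); nra.
Qed.

(** The momentum equation is tested with the mollification of F at scale T, whose divergence is the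
    mollification of div F. Its gradient is taken on the mollifier, which gains a factor 1/T. *)
Lemma momentum_decay (F : 'I_N -> X -> R) dF (r : R) : (forall i, has_grad (F i) (dF i)) -> 0 <= r ->
  (forall i, supp_in r (F i)) ->
  forall tau : R, 0 < tau -> exists2 T0 : R, 1 <= T0 & forall T, T0 <= T ->
    `|Int (fun x => q x * corr (mol T) (fun y => \sum_i dF i i y) x)| <= tau.
Proof.
move=> FdF r0 sF tau tau0.
have [Cm Cm0 HCm] := mol_bounds (R := R) N_gt0.
have cF i := has_grad_Cc0 (FdF i) (sF i).
have cdF i j := has_grad_Cc j (FdF i) (sF i).
pose K := \sum_i Int (fun x => `|F i x|).
have KF i : Int (fun x => `|F i x|) <= K.
  by rewrite /K (bigD1 i)//= lerDl; apply: sumr_ge0 => j _; apply: Int_ge0.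
have K0 : 0 <= K by apply: sumr_ge0 => j _; apply: Int_ge0.
pose M := Cm * K; have M0 : 0 <= M by exact: mulr_ge0.
pose B := N%:R * (`|k| * M) + N%:R * (N%:R * (M + 2 * `|l| * M)).
have B0 : 0 <= B by rewrite /B !addr_ge0// ?mulr_ge0// addr_ge0// mulr_ge0// mulr_ge0.
have E0 : 0 <= Int e by apply: Int_ge0; exact: energy_ge0.
pose Z := B * (Int e + 4 ^+ N); have Z0 : 0 <= Z by rewrite mulr_ge0// addr_ge0// exprn_ge0.
(* The final bound is Z / T. The condition T >= r places every support in the cube of radius 2 T, of
   volume 4^N T^N. *)
exists (1 + r + Z / tau); first by rewrite -addrA lerDl addr_ge0// divr_ge0// ltW.
move=> T T0T.
have ZT : 0 <= Z / tau by rewrite divr_ge0// ltW.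
have T1 : 1 <= T by lra.
have rT : r <= T by lra.
have T0 : 0 < T by lra.
have cm : Cc T (@mol R N T) := has_grad_Cc0 (mol_grad T) (supp_mol T0).
have sm := @supp_mol R N T T0.
have G i := corr_grad cm (FdF i) (sF i).
have sG i : supp_in (T + r) (corr (mol T) (F i)) := supp_corr sm (sF i).
have := momentum_field vC1 qloc vmom G sG.
have -> : (fun x => q x * \sum_i corr (mol T) (dF i i) x) =
    (fun x => q x * corr (mol T) (fun y => \sum_i dF i i y) x).
  by apply/funext => x; rewrite (corr_sum x cm (fun i => cdF i i)).
move=> /eqP; rewrite addrC addr_eq0 => /eqP ->; rewrite normrN.
have u0 : 0 <= T ^- N by rewrite invr_ge0 exprn_ge0// ltW.
have u1E : T ^- N.+1 = T ^- N / T by rewrite exprS invfM mulrC.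
have bF i x : `|corr (mol T) (F i) x| <= M * T ^- N.
  apply: le_trans (corr_bound cm (cF i) (fun y _ => (HCm T y T0).1)) _.
  by rewrite /M [leRHS]mulrAC; apply: ler_wpM2l => //; exact: mulr_ge0.
have bdF i j x : `|corr (mol T) (dF i j) x| <= M * (T ^- N / T).
  rewrite (corr_gradE j x (mol_grad T) sm (FdF i) (sF i)) normrN.
  have cdm := has_grad_Cc j (mol_grad T) sm.
  apply: le_trans (corr_bound cdm (cF i) (fun y _ => (HCm T y T0).2 j)) _.
  rewrite u1E /M [leRHS]mulrAC; apply: ler_wpM2l => //.
  by rewrite mulr_ge0// mulr_ge0// invr_ge0 ltW.
apply: (@le_trans _ _ (B * (T ^- N * T * Int e + T ^- N / T * (2 * (2 * T)) ^+ N))); last first.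
  (* This is where N >= 2 is used. *)
  have w1 : T ^- N * T <= T^-1.
    rewrite -ler_pdivlMr// -invfM lef_pV2 ?posrE ?exprn_gt0 ?mulr_gt0//.
    by rewrite -expr2 ler_weXn2l.
  have w2 : T ^- N / T * (2 * (2 * T)) ^+ N = 4 ^+ N / T.
    rewrite (_ : 2 * (2 * T) = 4 * T) ?exprMn; last by ring.
    have EN : T ^+ N != 0 by rewrite expf_neq0// gt_eqF.
    have T0' : T != 0 by rewrite gt_eqF.
    by move: (T ^+ N) (4 ^+ N) EN => E E4 EN; field; rewrite T0' EN.
  rewrite w2; apply: (@le_trans _ _ (Z / T)).
    rewrite /Z -[leRHS]mulrA; apply: ler_wpM2l => //; rewrite mulrDl lerD//.
    by rewrite [leRHS]mulrC ler_wpM2r.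
  by rewrite ler_pdivrMr// mulrC -ler_pdivrMr//; lra.
have mC := mom_density_Cc alpha vC1 G sG.
have i1 : itg (fun x => T ^- N * T * e x + T ^- N / T * cind (2 * T) x).
  by apply: itgD; apply: itgZ => //; exact: itg_cind.
rewrite -(Int_cind (_ : 0 <= 2 * T)); last by rewrite mulr_ge0// ltW.
rewrite -!IntZ//; last exact: itg_cind.
rewrite -IntD; [|exact: itgZ|apply: itgZ; exact: itg_cind].
rewrite -IntZ//; apply: Int_abs_le => [||x]; [exact: itg_meas (Cc_itg mC)|exact: itgZ|].
have [xT|xT] := leP `|x| (2 * T); last first.
  rewrite mC.2; last by lra.
  rewrite normr0; apply: mulr_ge0 => //; apply: addr_ge0; apply: mulr_ge0.
  - by rewrite mulr_ge0// ltW.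
  - exact: energy_ge0.
  - by rewrite divr_ge0// ltW.
  - exact: ler0n.
rewrite (cindT xT) mulr1.
set D := T ^- N * T * e x + T ^- N / T.
have ex0 := energy_ge0 x.
have Ti0 : 0 < T^-1 by rewrite invr_gt0.
have TTi : T * T^-1 = 1 by rewrite mulfV// gt_eqF.
have DE : D = T ^- N * (T * e x + T^-1) by rewrite /D; ring.
have D2 : T ^- N / T * e x <= D.
  rewrite DE -mulrA ler_wpM2l//.
  have : T^-1 <= T by rewrite -div1r ler_pdivrMr//; nra.
  nra.
have D0 : 0 <= D by rewrite DE mulr_ge0// addr_ge0// ?mulr_ge0// ltW.
rewrite /mom_density; apply: le_trans (ler_norm_sum _ _ _) _.
apply: (@le_trans _ _ (\sum_(i < N) (`|k| * M * D + \sum_(j < N) (M + 2 * `|l| * M) * D))); last first.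
  have S (c : R) : \sum_(i < N) c = N%:R * c by rewrite sumr_const card_ord mulr_natl.
  rewrite big_split/= !S /B; rewrite le_eqVlt; apply/orP; left; apply/eqP; ring.
apply: ler_sum => i _; apply: le_trans (ler_normD _ _) _; apply: lerD.
  rewrite !normrM; apply: (@le_trans _ _ (`|alpha - N%:R| * `|l| * (T * e x + T^-1) * (M * T ^- N))).
    by apply: ler_pM => //; rewrite ?mulr_ge0// ler_wpM2l ?mulr_ge0// vcomp_le.
  by rewrite DE le_eqVlt; apply/orP; left; apply/eqP; ring.
apply: le_trans (ler_norm_sum _ _ _) _; apply: ler_sum => j _.
rewrite normrM; apply: (@le_trans _ _ ((e x + `|l| * (2 * T * (T * e x + T^-1))) * (M * (T ^- N / T)))).
  apply: ler_pM => //; apply: le_trans (ler_normB _ _) _; apply: lerD; first exact: vcomp_mul_le.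
  rewrite normrM ler_wpM2l// normrM; apply: ler_pM => //; last exact: vcomp_le.
  exact: le_trans (coor_le_norm x j) xT.
rewrite mulrDl (mulrDl M); apply: lerD.
  by rewrite (_ : _ * _ = M * (T ^- N / T * e x)); [exact: ler_wpM2l|ring].
rewrite DE le_eqVlt; apply/orP; left; apply/eqP.
rewrite (_ : _ * (M * _) = 2 * `|l| * M * (T ^- N * (T * e x + T^-1)) * (T * T^-1)); last by ring.
by rewrite TTi mulr1.
Qed.

End pressure.

(** * The pressure estimate *)

Section hessian.
Context {R : realType} {N : nat}.
Local Notation X := 'rV[R]_N.
Local Notation Int := (@Int R N).
Local Notation itg := (@itg R N).

Context (eps T : R) (eps_gt0 : 0 < eps) (epsT : eps <= T).
Context (g : X -> R) (dg : 'I_N -> X -> R) (r : R).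
Context (gdg : has_grad g dg) (sg : supp_in r g).

(** The Hessian of psi = [corr G g], with G the potential of [kern]: the signs of the two
    differentiations of the kernel cancel. *)
Definition hess i j := corr (dkern eps T i j) g.

Let T_gt0 : 0 < T. Proof. exact: lt_le_trans epsT. Qed.

Let kern_Cc i : Cc T (@kern R N eps T i).
Proof.
have [G GD sG] := @kern_potential R N eps T eps_gt0 epsT.
exact: has_grad_Cc GD sG.
Qed.

Let dkern_Cc i j : Cc T (@dkern R N eps T i j).
Proof. exact: has_grad_Cc (kern_grad eps T i) (kern_Cc i).2. Qed.

Let cg : Cc r g. Proof. exact: has_grad_Cc0 gdg sg. Qed.
Let cdg i : Cc r (dg i). Proof. exact: has_grad_Cc gdg sg. Qed.

Lemma hess_Cc i j : Cc (T + r) (hess i j).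
Proof. exact: (corr_Cc (dkern_Cc i j) cg). Qed.

Lemma hess_sym i j x : hess i j x = hess j i x.
Proof. by rewrite /hess (_ : dkern eps T i j = dkern eps T j i)//; apply/funext => y; exact: dkern_sym. Qed.

Lemma hess_potential : exists psi P, [/\ has_grad psi P, supp_in (T + r) psi &
  forall i, has_grad (P i) (hess i)].
Proof.
have [G GD sG] := @kern_potential R N eps T eps_gt0 epsT.
have cG := has_grad_Cc0 GD sG.
exists (corr G g), (fun i x => -1 * corr (kern eps T i) g x); split.
- have := corr_gradl GD sG cg => /has_grad_ext; apply => // i x.
  by rewrite mulN1r.
- exact: supp_corr.
- move=> i; have := has_gradZ (-1) (corr_gradl (kern_grad eps T i) (kern_Cc i).2 cg).
  by move=> /has_grad_ext; apply => // j x; rewrite mulN1r opprK.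
Qed.

Lemma hess_grad i j : has_grad (hess i j) (fun k => corr (dkern eps T i j) (dg k)).
Proof. exact: (corr_grad (dkern_Cc i j) gdg sg). Qed.

(** The left side is the j-th derivative of [hess i j]. Moving the derivative i from the kernel to g
    leaves [kern j], which then receives the derivative j. *)
Lemma third_derivative_sym i j x :
  corr (dkern eps T i j) (dg j) x = corr (dkern eps T j j) (dg i) x.
Proof.
have [_ <-] := (hess_grad i j).1 j x.
rewrite (_ : hess i j = fun y => -1 * corr (kern eps T j) (dg i) y).
  have [_ ->] := (has_gradZ (-1) (corr_gradl (kern_grad eps T j) (kern_Cc j).2 (cdg i))).1 j x.
  by rewrite mulN1r opprK.
apply/funext => y; rewrite hess_sym (corr_gradE i y (kern_grad eps T j) (kern_Cc j).2 gdg sg).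
by rewrite mulN1r opprK.
Qed.

(** For each pair i, j two integrations by parts carry (D_ij psi)^2 to D_ii psi D_jj psi, through
    the common term D_i psi D_ijj psi. *)
Lemma hess_L2 : \sum_i \sum_j Int (fun x => hess i j x ^+ 2) = Int (fun x => (\sum_i hess i i x) ^+ 2).
Proof.
have [psi [P [psiP sp PH]]] := hess_potential.
have cP i := has_grad_Cc i psiP sp.
have cHH i j i' j' : itg (fun x => hess i j x * hess i' j' x).
  by apply: Cc_itg; apply: Cc_mulr; [exact: hess_Cc|exact: (hess_Cc i' j').1].
rewrite (_ : (fun x => (\sum_i hess i i x) ^+ 2) = (fun x => \sum_i \sum_j hess i i x * hess j j x)); last first.
  by apply/funext => x; rewrite expr2 mulr_suml; apply: eq_bigr => i _; rewrite mulr_sumr.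
rewrite Int_sum => [|i]; last exact: itg_sum.
apply: eq_bigr => i _.
rewrite (@Int_sum _ _ _ (fun j x => hess i i x * hess j j x)) => [|j]; last exact: cHH.
apply: eq_bigr => j _.
have sP i' j' : supp_in (T + r) (fun x => P i x * hess i' j' x).
  by move=> x /(hess_Cc i' j').2 ->; rewrite mulr0.
have iPc k l m : itg (fun x => P i x * corr (dkern eps T k l) (dg m) x).
  apply: (@Cc_itg _ _ (T + r)); apply: Cc_mulr; first exact: cP.
  exact: (corr_Cc (dkern_Cc k l) (cdg m)).1.
have I1 : Int (fun x => P i x * corr (dkern eps T i j) (dg j) x) + Int (fun x => hess i j x * hess i j x) = 0.
  rewrite -(IntD (iPc i j j) (cHH i j i j)).
  exact: Int_grad j (has_gradM (PH i) (hess_grad i j)) (sP i j).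
have I2 : Int (fun x => P i x * corr (dkern eps T j j) (dg i) x) + Int (fun x => hess j j x * hess i i x) = 0.
  rewrite -(IntD (iPc j j i) (cHH j j i i)).
  exact: Int_grad i (has_gradM (PH i) (hess_grad j j)) (sP j j).
have E3 : (fun x => P i x * corr (dkern eps T i j) (dg j) x) =
    (fun x => P i x * corr (dkern eps T j j) (dg i) x).
  by apply/funext => x; rewrite third_derivative_sym.
rewrite E3 in I1; rewrite (_ : (fun x => hess i j x ^+ 2) = (fun x => hess i j x * hess i j x)); last first.
  by apply/funext => x; rewrite expr2.
rewrite (_ : (fun x => hess i i x * hess j j x) = (fun x => hess j j x * hess i i x)); last first.
  by apply/funext => x; rewrite mulrC.
by apply: (addrI (Int (fun x => P i x * corr (dkern eps T j j) (dg i) x))); rewrite I1 I2.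
Qed.

Lemma hess_trace x : \sum_i hess i i x = corr (mol eps) g x - corr (mol T) g x.
Proof.
have c0 : Cc T (@mol R N eps).
  have cm := has_grad_Cc0 (mol_grad eps) (supp_mol (N := N) eps_gt0).
  by split; [exact: cm.1|move=> y yT; apply: cm.2; exact: le_lt_trans yT].
have c1 : Cc T (@mol R N T) := has_grad_Cc0 (mol_grad T) (supp_mol (N := N) T_gt0).
rewrite -(corrBl x c0 c1 cg) -(corr_suml x (fun i => dkern_Cc i i) cg).
by congr corr; apply/funext => y; rewrite dkern_trace.
Qed.

Lemma hess_far C rho i j x : (forall eps T i j x, 0 < eps -> 0 < T ->
    enorm x ^+ N * `|@dkern R N eps T i j x| <= C) -> 0 < rho ->
  (forall y, g (x + y) != 0 -> rho <= enorm y) ->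
  `|hess i j x| <= C * rho ^- N * Int (fun y => `|g y|).
Proof.
move=> HC rho0 gy; apply: (corr_bound (dkern_Cc i j) cg) => y /gy ry.
have rN : 0 < rho ^+ N by exact: exprn_gt0.
rewrite ler_pdivlMr//; apply: le_trans (HC eps T i j y eps_gt0 T_gt0).
rewrite mulrC ler_wpM2r//; apply: lerXn2r; rewrite ?nnegrE ?enorm_ge0//; exact: ltW.
Qed.

End hessian.

Section pressure_bound.
Context {R : realType} {N : nat}.
Local Notation X := 'rV[R]_N.
Implicit Types (f g : X -> R) (df dg : 'I_N -> X -> R).
Local Notation Int := (@Int R N).
Local Notation itg := (@itg R N).
Context (v : X -> X) (q : X -> R) (alpha : R).
Context (N_gt1 : (1 < N)%N) (vC1 : C1 v) (vdiv : divergence_free v) (qloc : loc_integrable q).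
Context (vmom : profile_momentum alpha v q) (vL2 : itg (energy v)).
Local Notation V := (vcomp v).
Local Notation e := (energy v).

Let N_gt0 : (0 < N)%N. Proof. exact: ltnW. Qed.

Lemma mol_approx g r kap : Cc r g -> 0 < kap -> (forall d, 0 < d -> Int (@mol R N d) = kap) ->
  forall tau, 0 < tau -> exists2 d0, 0 < d0 & forall d, 0 < d -> d <= d0 ->
    forall x, `|corr (mol d) g x - kap * g x| <= tau.
Proof.
move=> cg kap0 Hk tau tau0.
have [|d0 d00 dP] := Cc_unif cg (_ : 0 < tau / kap); first by rewrite divr_gt0.
exists d0 => // d d_gt0 dd0 x.
have cm : Cc d (@mol R N d) := has_grad_Cc0 (mol_grad d) (supp_mol d_gt0).
have := @corr_approx _ _ _ _ _ _ (tau / kap) x cm cg; rewrite Hk//.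
rewrite (_ : (fun y => `|mol d y|) = mol d); last first.
  by apply/funext => y; rewrite ger0_norm// mol_ge0.
rewrite Hk// divfK ?gt_eqF//; apply=> y yd; apply: dP; exact: le_trans dd0.
Qed.

Lemma small_choice (A tau : R) : 0 <= A -> 0 < tau -> exists2 s, 0 < s & s <= 1 /\ A * s <= tau.
Proof.
move=> A0 tau0; exists (Num.min 1 (tau / (A + 1))).
  by rewrite lt_min ltr01 divr_gt0// ltr_wpDl.
split; first by rewrite ge_min lexx.
apply: (@le_trans _ _ (A * (tau / (A + 1)))).
  by rewrite ler_wpM2l// ge_min lexx orbT.
rewrite mulrA ler_pdivrMr ?ltr_wpDl//; nra.
Qed.

Lemma sqr3_le (a b c : R) : (a + b - c) ^+ 2 <= 3 * a ^+ 2 + 3 * b ^+ 2 + 3 * c ^+ 2.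
Proof.
have := sqr_ge0 (a - b); have := sqr_ge0 (a + c); have := sqr_ge0 (b + c).
rewrite !sqrrB !sqrrD; lra.
Qed.

(** The integrand is split into kap g, the error of the small scale, and the mollification at scale
    T. The last is at most M T^-N on a cube of volume (4 T)^N, so its square has integral
    O(T^-N). *)
Lemma laplacian_L2 g dg r kap : has_grad g dg -> 0 <= r -> supp_in r g -> 0 < kap ->
  (forall d, 0 < d -> Int (@mol R N d) = kap) -> forall tau, 0 < tau ->
  exists2 d0, 0 < d0 & exists2 T0, 1 <= T0 & forall d T, 0 < d -> d <= d0 -> T0 <= T ->
    Int (fun x => (corr (mol d) g x - corr (mol T) g x) ^+ 2) <=
      3 * kap ^+ 2 * Int (fun x => g x ^+ 2) + tau.
Proof.
move=> gdg r0 sg kap0 Hk tau tau0; have cg := has_grad_Cc0 gdg sg.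
have [Cm Cm0 HCm] := mol_bounds (R := R) N_gt0.
pose M := Cm * Int (fun x => `|g x|).
have M0 : 0 <= M by rewrite mulr_ge0// Int_ge0.
pose W := (2 * (r + 1)) ^+ N; have W0 : 0 <= W by rewrite exprn_ge0// mulr_ge0// addr_ge0.
(* Half of tau goes to each of the two errors. The bound s <= 1 gives s^2 <= s. *)
have [s s0 [s1 sW]] := small_choice (mulr_ge0 (ler0n R 3) W0) (divr_gt0 tau0 (ltr0n R 2)).
have [d1 d10 d1P] := mol_approx cg kap0 Hk s0.
exists (Num.min 1 d1); first by rewrite lt_min ltr01.
pose Z := 3 * M ^+ 2 * 4 ^+ N.
have Z0 : 0 <= Z by apply: mulr_ge0; [apply: mulr_ge0 => //; exact: sqr_ge0|exact: exprn_ge0].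
exists (1 + r + Z / (tau / 2)).
  by rewrite -addrA lerDl addr_ge0// divr_ge0// divr_ge0// ltW.
move=> d T d_gt0; rewrite le_min => /andP[dle1 dd1] T0T.
have ZT : 0 <= Z / (tau / 2) by rewrite divr_ge0// divr_ge0// ltW.
have T1 : 1 <= T by lra.
have rT : r <= T by lra.
have T0 : 0 < T by lra.
have cmd : Cc d (@mol R N d) := has_grad_Cc0 (mol_grad d) (supp_mol d_gt0).
have cmT : Cc T (@mol R N T) := has_grad_Cc0 (mol_grad T) (supp_mol T0).
have cd := corr_Cc cmd cg; have cT := corr_Cc cmT cg.
have cD : Cc (T + r) (fun x => corr (mol d) g x - corr (mol T) g x).
  split=> [x|x xT]; first by apply: continuousB; [exact: cd.1|exact: cT.1].
  by rewrite cT.2// cd.2 ?subr0//; lra.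
have iD : itg (fun x => (corr (mol d) g x - corr (mol T) g x) ^+ 2).
  by under eq_fun do rewrite expr2; exact: (Cc_itg (Cc_mulr cD cD.1)).
have ig : itg (fun x => g x ^+ 2).
  by under eq_fun do rewrite expr2; exact: (Cc_itg (Cc_mulr cg cg.1)).
have i1 : itg (fun x => 3 * kap ^+ 2 * g x ^+ 2) by exact: itgZ.
have i2 : itg (fun x => 3 * s * cind (r + 1) x) by apply: itgZ; exact: itg_cind.
have i3 : itg (fun x => 3 * (M * T ^- N) ^+ 2 * cind (2 * T) x) by apply: itgZ; exact: itg_cind.
apply: (@le_trans _ _ (Int (fun x => 3 * kap ^+ 2 * g x ^+ 2 + 3 * s * cind (r + 1) x +
    3 * (M * T ^- N) ^+ 2 * cind (2 * T) x))).
  apply: Int_le => [//||x]; first by apply: itgD => //; exact: itgD.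
  rewrite -[corr (mol d) g x](subrKC (kap * g x)).
  apply: le_trans (sqr3_le _ _ _) _; apply: lerD; first apply: lerD.
  - by rewrite exprMn mulrA.
  - rewrite -mulrA ler_wpM2l//.
    have [xr|xr] := leP `|x| (r + 1); last first.
      rewrite (sg x); last by lra.
      by rewrite cd.2 ?mulr0 ?subr0 ?expr0n ?mulr_ge0 ?(ltW s0)//; lra.
    rewrite (cindT xr) mulr1 -real_normK ?num_real//.
    have ys := d1P d d_gt0 dd1 x.
    by rewrite expr2 -[s]mulr1; apply: ler_pM => //; exact: le_trans s1.
  - rewrite -mulrA ler_wpM2l//.
    have [xT|xT] := leP `|x| (2 * T); last first.
      have -> : corr (mol T) g x = 0 by apply: cT.2; lra.
      by rewrite expr0n/= mulr_ge0 ?sqr_ge0// ler0n.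
    rewrite (cindT xT) mulr1 -real_normK ?num_real//; apply: lerXn2r; rewrite ?nnegrE//.
      by rewrite mulr_ge0// invr_ge0 exprn_ge0// ltW.
    apply: le_trans (corr_bound cmT cg (fun y _ => (HCm T y T0).1)) _.
    by rewrite /M [leRHS]mulrAC.
rewrite IntD//; last exact: itgD.
rewrite IntD// !IntZ//; [|exact: itg_cind|exact: itg_cind].
rewrite !Int_cind ?addr_ge0 ?mulr_ge0 ?(ltW T0)//.
rewrite -addrA lerD2l [tau]splitr; apply: lerD; first by rewrite mulrAC.
rewrite (_ : 3 * (M * T ^- N) ^+ 2 * (2 * (2 * T)) ^+ N = Z * T ^- N); last first.
  rewrite (_ : 2 * (2 * T) = 4 * T) ?[(4 * T) ^+ N]exprMn; last by ring.
  have EN : T ^+ N != 0 by rewrite expf_neq0// gt_eqF.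
  by rewrite /Z; move: (T ^+ N) (4 ^+ N) EN => E E4 EN; field.
apply: (@le_trans _ _ (Z / T)).
  rewrite ler_wpM2l// lef_pV2 ?posrE ?exprn_gt0//.
  by rewrite -[leLHS]expr1 ler_weXn2l.
by rewrite ler_pdivrMr// mulrC -ler_pdivrMr ?divr_gt0//; lra.
Qed.

(** The constant depends on v but not on F, g, the radii or the weight [lam], so it serves all
    shells at once. [chi] marks the near region; outside it the support of g is at distance at least
    [rho]. *)
Lemma pressure_bound : exists2 K : R, 0 <= K &
  forall (F : 'I_N -> X -> R) dF (g : X -> R) dg (r : R) (chi : X -> R) (rho lam : R),
  (forall i, has_grad (F i) (dF i)) -> 0 <= r -> (forall i, supp_in r (F i)) ->
  (fun x => \sum_i dF i i x) = g -> has_grad g dg ->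
  (forall x, chi x = 0 \/ chi x = 1) -> itg (fun x => chi x * e x ^+ 2) ->
  0 < rho -> 0 < lam ->
  (forall x y, chi x = 0 -> g (x + y) != 0 -> rho <= enorm y) ->
  `|Int (fun x => q x * g x)| <=
    K * (lam * Int (fun x => chi x * e x ^+ 2) + lam^-1 * Int (fun x => g x ^+ 2) +
         rho ^- N * Int (fun x => `|g x|)).
Proof.
have [kap kap0 Hk] := Int_mol_const (R := R) N_gt0.
have [Cd Cd0 HCd] := dkern_bound (R := R) N_gt0.
have E0 : 0 <= Int e by apply: Int_ge0; exact: energy_ge0.
pose Nr : R := N%:R.
have Nr0 : 0 <= Nr by exact: ler0n.
pose K := (Nr * Nr + 3 * kap ^+ 2 + Nr * Nr * (Cd * Int e)) / kap.
have K0 : 0 <= K.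
  by rewrite /K divr_ge0 ?(ltW kap0)// !addr_ge0// ?mulr_ge0 ?exprn_ge0 ?(ltW kap0).
exists K => // F dF g dg r chi rho lam FdF r0 sF gE gdg chi01 ichi rho0 lam0 Hchi.
have cdF i j := has_grad_Cc j (FdF i) (sF i).
have cg : Cc r g by rewrite -gE; apply: Cc_sum => i; exact: cdF.
have sg := cg.2.
have ig2 : itg (fun x => g x ^+ 2).
  by under eq_fun do rewrite expr2; exact: (Cc_itg (Cc_mulr cg cg.1)).
set A1 := Int (fun x => chi x * e x ^+ 2); set A2 := Int (fun x => g x ^+ 2).
set A3 := Int (fun x => `|g x|).
have A10 : 0 <= A1.
  by apply: Int_ge0 => x; case: (chi01 x) => ->; rewrite ?mul0r// mul1r sqr_ge0.
have A20 : 0 <= A2 by apply: Int_ge0 => x; exact: sqr_ge0.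
have A30 : 0 <= A3 by exact: Int_ge0.
have rN0 : 0 <= rho ^- N by rewrite invr_ge0 exprn_ge0// ltW.
suff main tau : 0 < tau -> kap * `|Int (fun x => q x * g x)| <=
    lam * (Nr * Nr) * A1 + lam^-1 * (3 * kap ^+ 2 * A2 + lam * tau) +
      Nr * Nr * (Cd * rho ^- N * A3 * Int e) + tau + tau.
  rewrite -(ler_pM2l kap0) /K mulrCA -[leRHS]mulrA [X in _ <= _ * X]mulrA mulVf ?mul1r ?gt_eqF//.
  (* Three errors of size tau occur, from the L^2 bound, the small scale and the large scale. *)
  apply/ler_addgt0Pr => tau tau0; have := main (tau / 3) (divr_gt0 tau0 (ltr0n _ 3)).
  rewrite mulrDr [lam^-1 * (lam * _)]mulrA mulVf ?gt_eqF// mul1r.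
  have p1 : 0 <= lam * A1 by rewrite mulr_ge0// ltW.
  have p2 : 0 <= lam^-1 * A2 by rewrite mulr_ge0// invr_ge0 ltW.
  have p3 : 0 <= rho ^- N * A3 by rewrite mulr_ge0.
  move: (kap * _) => L.
  rewrite (_ : lam * _ * A1 = Nr * Nr * (lam * A1)); last by ring.
  rewrite (_ : lam^-1 * (3 * kap ^+ 2 * A2) = 3 * kap ^+ 2 * (lam^-1 * A2)); last by ring.
  rewrite (_ : Nr * Nr * (Cd * rho ^- N * A3 * Int e) = Nr * Nr * (Cd * Int e) * (rho ^- N * A3)); last by ring.
  have c1 : 0 <= Nr * Nr by exact: mulr_ge0.
  have c2 : 0 <= 3 * kap ^+ 2 by rewrite mulr_ge0// sqr_ge0.
  have c3 : 0 <= Nr * Nr * (Cd * Int e) by rewrite !mulr_ge0.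
  move: (lam * A1) (lam^-1 * A2) (rho ^- N * A3) (Nr * Nr * (Cd * Int e)) (Nr * Nr) (3 * kap ^+ 2) p1 p2 p3 c1 c2 c3
    => x1 x2 x3 b3 b1 b2 p1 p2 p3 c1 c2 c3 H.
  have := mulr_ge0 c1 p2; have := mulr_ge0 c1 p3; have := mulr_ge0 c2 p1.
  have := mulr_ge0 c2 p3; have := mulr_ge0 c3 p1; have := mulr_ge0 c3 p2.
  by move: H; lra.
move=> tau0.
have [da da0 [Ta Ta1 HL2]] := laplacian_L2 gdg r0 sg kap0 Hk (mulr_gt0 lam0 tau0).
have [Tb Tb1 Hdec] := momentum_decay N_gt1 vC1 qloc vmom vL2 FdF r0 sF tau0.
rewrite gE in Hdec.
have iq := itg_abs (loc_itg_cube (r + 1) qloc).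
have q0 : 0 <= Int (fun x => `|cind (r + 1) x * q x|) by exact: Int_ge0.
have [s s0 [_ sq]] := small_choice q0 tau0.
have [db db0 Hap] := mol_approx cg kap0 Hk s0.
pose d := Num.min 1 (Num.min da db); pose T := Ta + Tb.
have d_gt0 : 0 < d by rewrite !lt_min ltr01 da0.
have [d1 dda ddb] : [/\ d <= 1, d <= da & d <= db] by rewrite /d !ge_min !lexx !orbT.
have [TTa TTb] : Ta <= T /\ Tb <= T by rewrite /T; split; lra.
have dT : d <= T by rewrite /T; lra.
have T0 : 0 < T by lra.
have [psi [P [psiP sp PH]]] := hess_potential d_gt0 dT gdg sg.
have cH i j := hess_Cc d_gt0 dT gdg sg i j.
have pid := pressure_identity vC1 vdiv qloc vmom psiP PH sp (hess_sym d T g).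
have trE x := hess_trace d_gt0 dT gdg sg x.
have cmd : Cc d (@mol R N d) := has_grad_Cc0 (mol_grad d) (supp_mol d_gt0).
have cmT : Cc T (@mol R N T) := has_grad_Cc0 (mol_grad T) (supp_mol T0).
have cd := corr_Cc cmd cg; have cT := corr_Cc cmT cg.
have iqg : itg (fun x => q x * g x) by exact: loc_itg_Cc cg.
have iqd : itg (fun x => q x * corr (mol d) g x) by exact: loc_itg_Cc cd.
have iqT : itg (fun x => q x * corr (mol T) g x) by exact: loc_itg_Cc cT.
(* kap g is minus the error of the mollification at scale d, plus the Laplacian of psi, plus the
   mollification at scale T. Only the middle term survives in the limit. *)
have split3 : kap * Int (fun x => q x * g x) =
    - Int (fun x => q x * (corr (mol d) g x - kap * g x)) +
    Int (fun x => q x * \sum_i hess d T g i i x) + Int (fun x => q x * corr (mol T) g x).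
  rewrite (_ : (fun x => q x * (corr (mol d) g x - kap * g x)) =
    (fun x => q x * corr (mol d) g x - kap * (q x * g x))); last by apply/funext => x; ring.
  rewrite (_ : (fun x => q x * \sum_i hess d T g i i x) =
    (fun x => q x * corr (mol d) g x - q x * corr (mol T) g x)); last first.
    by apply/funext => x; rewrite trE; ring.
  by rewrite IntB ?IntB ?IntZ//; [ring|exact: itgZ].
rewrite -[kap in kap * _]gtr0_norm// -normrM split3.
apply: le_trans (ler_normD _ _) _; apply: lerD; last exact: Hdec.
apply: le_trans (ler_normD _ _) _; rewrite [leRHS]addrC normrN; apply: lerD.
  apply: le_trans sq; rewrite mulrC -IntZ//; apply: Int_abs_le => [||x].
  - apply: itg_meas; rewrite (_ : (fun x => _) = (fun x => q x * corr (mol d) g x - kap * (q x * g x))); last by apply/funext => x; ring.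
    by apply: itgB => //; exact: itgZ.
  - exact: itgZ.
  - have [xr|xr] := leP `|x| (r + 1); last first.
      rewrite sg; last by lra.
      have -> : corr (mol d) g x = 0 by apply: cd.2; lra.
      by rewrite mulr0 subr0 mulr0 normr0 mulr_ge0// ltW.
    by rewrite (cindT xr) mul1r normrM mulrC ler_wpM2r// Hap.
rewrite pid normrN.
have cV := cts_vcomp vC1.
have iVH i j : itg (fun x => V i x * V j x * hess d T g i j x).
  by apply: (Cc_itg (r := T + r)); apply: Cc_mul => //; exact: ctsM.
have iHH i j : itg (fun x => hess d T g i j x ^+ 2).
  by under eq_fun do rewrite expr2; exact: (Cc_itg (Cc_mulr (cH i j) (cH i j).1)).
pose far := Cd * rho ^- N * A3; have far0 : 0 <= far by rewrite !mulr_ge0.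
(* Young's inequality with weight [lam] where chi = 1, the pointwise decay of the kernel where chi =
   0. *)
have one i j : `|Int (fun x => V i x * V j x * hess d T g i j x)| <=
    lam * A1 + lam^-1 * Int (fun x => hess d T g i j x ^+ 2) + far * Int e.
  have i1 := itgZ lam ichi; have i2 := itgZ lam^-1 (iHH i j); have i3 := itgZ far vL2.
  rewrite -IntZ// -IntZ// -IntZ// -IntD// -IntD//; last exact: itgD.
  apply: Int_abs_le => [||x]; [exact: itg_meas (iVH i j)|by apply: itgD => //; exact: itgD|].
  have ve := vcomp_mul_le v i j x; have e0 := energy_ge0 v x.
  rewrite normrM; case: (chi01 x) => chix.
    rewrite chix mul0r mulr0 add0r.
    have hf := hess_far d_gt0 dT gdg sg i j HCd rho0 (fun y => Hchi x y chix).
    apply: (@le_trans _ _ (far * e x)); first by rewrite mulrC; apply: ler_pM.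
    by rewrite lerDr mulr_ge0 ?sqr_ge0// invr_ge0 ltW.
  rewrite chix mul1r; apply: (@le_trans _ _ (lam * e x ^+ 2 + lam^-1 * hess d T g i j x ^+ 2)); last first.
    by rewrite lerDl mulr_ge0.
  apply: (@le_trans _ _ (e x * `|hess d T g i j x|)); first by rewrite ler_wpM2r.
  rewrite -[hess d T g i j x ^+ 2]real_normK ?num_real//.
  move: (`|hess d T g i j x|) (normr_ge0 (hess d T g i j x)) => h h0.
  have [u0 lu] : 0 < lam^-1 /\ lam * lam^-1 = 1 by rewrite invr_gt0 mulfV// gt_eqF.
  have : 0 <= lam^-1 * (lam * e x - h) ^+ 2 by rewrite mulr_ge0 ?sqr_ge0// ltW.
  rewrite (_ : lam^-1 * (lam * e x - h) ^+ 2 = lam * e x ^+ 2 * (lam * lam^-1) - 2 * (e x * h) * (lam * lam^-1) + lam^-1 * h ^+ 2); last by ring.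
  by rewrite lu !mulr1; have := mulr_ge0 e0 h0; lra.
rewrite Int_sum => [|i]; last exact: itg_sum.
apply: le_trans (ler_norm_sum _ _ _) _.
apply: (@le_trans _ _ (\sum_i \sum_j (lam * A1 + lam^-1 * Int (fun x => hess d T g i j x ^+ 2) + far * Int e))).
  apply: ler_sum => i _; rewrite Int_sum//; apply: le_trans (ler_norm_sum _ _ _) _.
  by apply: ler_sum => j _; exact: one.
have S (c : R) : \sum_(i < N) c = Nr * c by rewrite sumr_const card_ord mulr_natl.
under eq_bigr => i _ do rewrite !big_split/= !S -mulr_sumr.
rewrite !big_split/= !S -mulr_sumr (hess_L2 d_gt0 dT gdg sg).
have := HL2 d T d_gt0 dda TTa.
rewrite (_ : (fun x => (\sum_i hess d T g i i x) ^+ 2) =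
  (fun x => (corr (mol d) g x - corr (mol T) g x) ^+ 2)); last by apply/funext => x; rewrite trE.
have u0 : 0 < lam^-1 by rewrite invr_gt0.
rewrite -(ler_pM2l u0) -/A2 -/far => H; apply: le_trans (_ : _ <= lam * (Nr * Nr) * A1 + _ + _) _; last first.
  exact: lexx.
by rewrite -/far; move: H; lra.
Qed.

End pressure_bound.

(** * Decay of the energy on shells *)

Section shells.
Context {R : realType} {N : nat}.
Local Notation X := 'rV[R]_N.
Local Notation Int := (@Int R N).
Local Notation itg := (@itg R N).

Lemma dot_le (x y : X) : \sum_i x ord0 i * y ord0 i <= enorm x * enorm y.
Proof.
have [x0 y0] := (enorm_ge0 x, enorm_ge0 y).
have [xE yE] := (enormE x, enormE y).
set s := \sum_i _; set a := enorm x in x0 xE *; set b := enorm y in y0 yE *.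
have H : 2 * (a * b) * s <= 2 * (a * b) ^+ 2.
  have : 0 <= \sum_i (b * x ord0 i - a * y ord0 i) ^+ 2 by apply: sumr_ge0 => i _; exact: sqr_ge0.
  rewrite (eq_bigr (fun i => b ^+ 2 * x ord0 i ^+ 2 + a ^+ 2 * y ord0 i ^+ 2 - 2 * (a * b) * (x ord0 i * y ord0 i))).
    rewrite sumrB big_split/= -!mulr_sumr -/(sqn x) -/(sqn y) -/s -xE -yE.
    by move=> H; lra.
  by move=> i _; ring.
have [ab|ab] := ltP 0 (a * b).
  have ab2 : 0 < 2 * (a * b) by exact: mulr_gt0.
  by rewrite -(ler_pM2l ab2); apply: le_trans H _; rewrite expr2 !mulrA.
have ab0 : a * b = 0 by apply/le_anti; rewrite ab mulr_ge0.
rewrite ab0; suff -> : s = 0 by [].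
move: ab0 => /eqP; rewrite mulf_eq0 => /orP[] /eqP z; apply: big1 => i _.
  have : `|x ord0 i| <= 0 by rewrite -z; exact: coor_enorm.
  by rewrite normr_le0 => /eqP ->; rewrite mul0r.
have : `|y ord0 i| <= 0 by rewrite -z; exact: coor_enorm.
by rewrite normr_le0 => /eqP ->; rewrite mulr0.
Qed.

Lemma enormD (x y : X) : enorm (x + y) <= enorm x + enorm y.
Proof.
rewrite -ler_sqr ?nnegrE ?addr_ge0 ?enorm_ge0// sqrrD !enormE.
rewrite {1}/sqn (eq_bigr (fun i => x ord0 i ^+ 2 + y ord0 i ^+ 2 + 2 * (x ord0 i * y ord0 i))).
  by rewrite !big_split/= -mulr_sumr -/(sqn x) -/(sqn y); have := dot_le x y; lra.
by move=> i _; rewrite mxE; ring.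
Qed.

Lemma enormN (x : X) : enorm (- x) = enorm x.
Proof. by congr Num.sqrt; apply: eq_bigr => i _; rewrite mxE sqrrN. Qed.

(** The bounds a and b are on the squared radius. *)
Definition shell (a b : R) : X -> R := \1_[set x : X | a <= sqn x <= b].

Lemma shell_in a b x : a <= sqn x -> sqn x <= b -> shell a b x = 1.
Proof. by move=> h1 h2; rewrite /shell indicE mem_set//= h1 h2. Qed.

Lemma shell_cases a b x : (shell a b x = 0 /\ ~~ (a <= sqn x <= b)) \/
  [/\ shell a b x = 1, a <= sqn x & sqn x <= b].
Proof.
rewrite /shell indicE; have [/andP[h1 h2]|h] := boolP (a <= sqn x <= b).
  by right; rewrite mem_set//= h1 h2.
by left; rewrite memNset//=; apply/negP.
Qed.

Lemma shell_ge0 a b x : 0 <= shell a b x.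
Proof. by have [[-> _]|[-> _ _]] := shell_cases a b x. Qed.

Lemma measurable_shell a b : measurable_fun setT (shell a b).
Proof.
apply: measurable_indic; rewrite (_ : mkset _ = @sqn R N @^-1` `[a, b]%classic); last first.
  by apply/seteqP; split=> x /=; rewrite in_itv.
rewrite -[X in measurable X]setTI; apply: (continuous_measurable (@sqn_continuous R N)) => //.
Qed.

Lemma shell_itg a b f : itg f -> itg (fun x => shell a b x * f x).
Proof.
move=> fi; apply: (itg_le _ (itg_abs fi)) => [|x].
  by apply: measurable_funM; [exact: measurable_shell|exact: itg_meas].
rewrite normrM ger0_norm ?shell_ge0//.
by have [[-> _]|[-> _ _]] := shell_cases a b x; rewrite ?mul0r ?mul1r.
Qed.

End shells.

(** * The cutoff and the inequality between shells *)

Section cutoff.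
Context {R : realType}.

(** A bump in s = |x|^2 / r^2, positive on ]1, 4[ and so supported on r <= |x| <= 2 r. *)
Definition theta (s : R) := flat 0 (s - 1) * flat 0 (4 - s).
Definition dtheta (s : R) := flat 0 (s - 1) * - flat 2 (4 - s) + flat 0 (4 - s) * flat 2 (s - 1).

Lemma flat0_derive (s : R) : is_derive s (1 : R) (flat 0) (flat 2 s).
Proof. by apply: is_derive_eq (flat_derive 0 s) _; rewrite mul0r subr0. Qed.

Lemma theta_derive (s : R) : is_derive s (1 : R) theta (dtheta s).
Proof.
have H1 : is_derive s (1 : R) (fun s : R => flat 0 (s - 1)) (flat 2 (s - 1)).
  have I : is_derive s (1 : R) (fun s : R => s - 1) 1 by apply: is_derive_eq; rewrite subr0.
  have := @is_derive1_comp _ (flat 0) (fun s : R => s - 1) s _ _ (flat0_derive _) I.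
  by rewrite mulr1.
have H2 : is_derive s (1 : R) (fun s : R => flat 0 (4 - s)) (- flat 2 (4 - s)).
  have I : is_derive s (1 : R) (fun s : R => 4 - s) (- 1) by apply: is_derive_eq; ring.
  have := @is_derive1_comp _ (flat 0) (fun s : R => 4 - s) s _ _ (flat0_derive _) I.
  by rewrite mulrN1.
by have := is_deriveM H1 H2.
Qed.

Lemma flat_continuous n : continuous (@flat R n).
Proof. exact: (is_derive_continuous (flat_derive n)). Qed.

Lemma ctsRM (f g : R -> R) : continuous f -> continuous g -> continuous (fun s => f s * g s).
Proof. by move=> cf cg s; apply: continuousM; [exact: cf|exact: cg]. Qed.

Lemma dtheta_continuous : continuous dtheta.
Proof.
have c1 n : continuous (fun s : R => flat n (s - 1)).
  move=> s; apply: (@continuous_comp _ _ _ (fun s : R => s - 1) (flat n) s); last exact: flat_continuous.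
  by apply: continuousB; [|exact: cst_continuous].
have c2 n : continuous (fun s : R => flat n (4 - s)).
  move=> s; apply: (@continuous_comp _ _ _ (fun s : R => 4 - s) (flat n) s); last exact: flat_continuous.
  by apply: continuousB; [exact: cst_continuous|].
have cN (f : R -> R) : continuous f -> continuous (fun s => - f s).
  by move=> cf s; apply: continuousN; exact: cf.
have cA := ctsRM (c1 0) (cN _ (c2 2)); have cB := ctsRM (c2 0) (c1 2).
by move=> s; exact: (@continuousD _ _ _ _ _ s (cA s) (cB s)).
Qed.

Lemma theta_ge0 s : 0 <= theta s.
Proof. by rewrite mulr_ge0// flat_ge0. Qed.

Lemma flat0_le1 (s : R) : flat 0 s <= 1.
Proof.
rewrite /flat /piecewise; case: (leP s 0) => // s0.
by rewrite expr0 mul1r expR_le1 oppr_le0 invr_ge0 ltW.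
Qed.

Lemma theta_le1 s : theta s <= 1.
Proof. by rewrite -[leRHS]mulr1; apply: ler_pM; rewrite ?flat_ge0 ?flat0_le1. Qed.

Lemma flat0_mono (s t : R) : 0 < s -> s <= t -> flat 0 s <= flat 0 t.
Proof.
move=> s0 st; have t0 := lt_le_trans s0 st.
rewrite /flat /piecewise (lt_geF s0) (lt_geF t0) !expr0 !mul1r ler_expR lerN2.
by rewrite lef_pV2.
Qed.

Lemma theta_supp s : s <= 1 \/ 4 <= s -> theta s = 0.
Proof.
by case=> h; rewrite /theta; [rewrite flat_le0 ?mul0r//|rewrite [flat 0 (4 - s)]flat_le0 ?mulr0//]; lra.
Qed.

Lemma theta_gt0 : exists2 t0 : R, 0 < t0 & forall s, 3 / 2 <= s -> s <= 3 -> t0 <= theta s.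
Proof.
exists (flat 0 (1 / 2) * flat 0 1); first by rewrite mulr_gt0// flat_gt0//; lra.
move=> s h1 h2; apply: ler_pM; rewrite ?flat_ge0//; apply: flat0_mono; lra.
Qed.

End cutoff.

Section decay.
Context {R : realType} {N : nat}.
Local Notation X := 'rV[R]_N.
Local Notation Int := (@Int R N).
Local Notation itg := (@itg R N).
Context (v : X -> X) (q : X -> R) (alpha : R).
Context (N_gt1 : (1 < N)%N) (vC1 : C1 v) (vdiv : divergence_free v) (qloc : loc_integrable q).
Context (vmom : profile_momentum alpha v q) (vL2 : itg (energy v)) (alphaE : alpha = N%:R / 2).
Local Notation V := (vcomp v).
Local Notation dV := (dvcomp v).
Local Notation e := (energy v).

Lemma enorm_energy x : enorm (v x) ^+ 2 = e x.
Proof. exact: enormE. Qed.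

(** The number b stands for r^(1-delta). Keeping it abstract leaves only integral powers of r in the
    computation, and b / r is the gain. *)
Lemma shell_decay (Cb c1 : R) : 0 < Cb -> 0 < c1 -> exists2 K : R, 0 <= K &
  forall r b : R, 0 < r -> 0 < b ->
  (forall x, r ^+ 2 / 4 <= sqn x -> sqn x <= 16 * r ^+ 2 ->
     c1 <= r ^+ N * b * enorm (v x) /\ enorm (v x) <= Cb * b) ->
  Int (fun x => shell (3 / 2 * r ^+ 2) (3 * r ^+ 2) x * e x) <=
    K * (b / r) * Int (fun x => shell (r ^+ 2 / 4) (16 * r ^+ 2) x * e x).
Proof.
move=> C10 c10.
have [Kp Kp0 HKp] := pressure_bound N_gt1 vC1 vdiv qloc vmom vL2.
have [t0 t00 Ht0] := theta_gt0 (R := R).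
have l0 : 0 < (1 + alpha)^-1 by rewrite invr_gt0 alphaE ltr_wpDr// divr_ge0.
set l := (1 + alpha)^-1 in l0.
pose Nr : R := N%:R; have Nr0 : 0 <= Nr by exact: ler0n.
pose K1 := 2 * Nr * Cb + Kp * (Cb ^+ 2 + 16 * Nr ^+ 2 + 2 ^+ N * (4 * Nr) / c1).
have K10 : 0 <= K1.
  apply: addr_ge0; first by rewrite !mulr_ge0// ltW.
  apply: mulr_ge0 => //; apply: addr_ge0.
    by apply: addr_ge0; [exact: sqr_ge0|rewrite mulr_ge0// sqr_ge0].
  by apply: divr_ge0; [rewrite mulr_ge0 ?exprn_ge0// mulr_ge0|exact: ltW].
exists (K1 / (3 / 2 * (l * t0))).
  by apply: divr_ge0 => //; apply: mulr_ge0; [rewrite divr_ge0|rewrite mulr_ge0// ltW].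
move=> r b r0 b0 Hb.
have r20 : 0 < r ^+ 2 by exact: exprn_gt0.
(* The cutoff is prescribed through its gradient 2 x gam(|x|^2). With the minus sign phi decreases
   outwards, so x . grad phi has a sign and the energy term controls the inner shell. *)
pose gam (s : R) := (- r ^- 2) * theta (s / r ^+ 2).
pose dgam (s : R) := (- r ^- 2) * (dtheta (s / r ^+ 2) / r ^+ 2).
have gamD (s : R) : is_derive s (1 : R) gam (dgam s).
  exact: scale_derive theta_derive.
have cdgam : continuous dgam.
  have c0 : continuous (fun s : R => s / r ^+ 2) by apply: ctsRM => s; [exact: cvg_id|exact: cvg_cst].
  have c2 : continuous (fun s : R => dtheta (s / r ^+ 2)).
    by move=> s; apply: (@continuous_comp _ _ _ (fun s : R => s / r ^+ 2) dtheta s); [exact: c0|exact: dtheta_continuous].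
  apply: ctsRM; first by move=> s; exact: cvg_cst.
  by apply: ctsRM => // s; exact: cvg_cst.
have cgam : continuous gam := is_derive_continuous gamD.
have gam4 s : 4 * r ^+ 2 <= s -> gam s = 0.
  by move=> h; rewrite /gam theta_supp ?mulr0//; right; rewrite ler_pdivlMr.
have [|phi phiD phi4] := @radial_grad R N gam (4 * r ^+ 2) _ cgam gam4; first by rewrite mulr_ge0// ltW.
pose dphi j (x : X) := 2 * (x ord0 j * gam (sqn x)).
have dphiD := @radial_grad2 R N gam dgam gamD cdgam.
have rr0 : 0 <= 2 * r by rewrite mulr_ge0// ltW.
have sphi : supp_in (2 * r) phi.
  by move=> x /(sqn_gt rr0) h; apply: phi4; rewrite exprMn in h; apply: ltW; apply: le_lt_trans h; lra.
have gV := vcomp_grad vC1.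
have FD i := has_gradM phiD (gV i).
have sF i : supp_in (2 * r) (fun x => phi x * V i x) by move=> x /sphi ->; rewrite mul0r.
pose g x := \sum_j V j x * dphi j x.
have gE : (fun x => \sum_i (phi x * dV i i x + V i x * (2 * (x ord0 i * gam (sqn x))))) = g.
  by apply/funext => x; rewrite big_split/= -mulr_sumr divfree// mulr0 add0r.
have gD := has_grad_sum (fun j => has_gradM (gV j) (dphiD j)).
have sg : supp_in (2 * r) g.
  move=> x /(sqn_gt rr0) h; apply: big1 => j _; rewrite /dphi gam4 ?mulr0//.
  by rewrite exprMn in h; apply: ltW; apply: le_lt_trans h; lra.
have cg : Cc (2 * r) g := has_grad_Cc0 gD sg.
(* The shell r/2 <= |x| <= 4 r, which leaves a margin of at least r/2 around the support r <= |x| <=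
   2 r of g. *)
pose chi := @shell R N (r ^+ 2 / 4) (16 * r ^+ 2).
have ie : itg (fun x => chi x * e x) by exact: shell_itg.
set Q := Int (fun x => chi x * e x).
have Q0 : 0 <= Q by apply: Int_ge0 => x; rewrite mulr_ge0 ?shell_ge0 ?energy_ge0.
have gle x : `|g x| <= 4 * Nr / r * (chi x * enorm (v x)).
  have [[chi0 /negP nx]|[chi1 h1 h2]] := shell_cases (r ^+ 2 / 4) (16 * r ^+ 2) x.
    rewrite /chi chi0 mul0r mulr0 /g big1 ?normr0// => j _; rewrite /dphi /gam theta_supp ?mulr0//.
    have [h|h] := leP (sqn x) (r ^+ 2 / 4); [left|right].
      by rewrite ler_pdivrMr//; lra.
    rewrite ler_pdivlMr//; have [h'|h'] := leP (sqn x) (16 * r ^+ 2); last by lra.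
    by exfalso; apply: nx; rewrite (ltW h) h'.
  rewrite /chi chi1 mul1r.
  have [h4|h4] := leP (4 * r ^+ 2) (sqn x).
    rewrite /g big1 => [|j _]; last by rewrite /dphi gam4 ?mulr0.
    by rewrite normr0 mulr_ge0 ?enorm_ge0// divr_ge0 ?mulr_ge0// ltW.
  apply: le_trans (ler_norm_sum _ _ _) _.
  apply: (@le_trans _ _ (\sum_(j < N) (4 / r * enorm (v x)))); last first.
    by rewrite sumr_const card_ord -[leLHS]mulr_natl -/Nr le_eqVlt; apply/orP; left; apply/eqP; ring.
  apply: ler_sum => j _; rewrite /dphi /gam.
  have vj : `|V j x| <= enorm (v x) by exact: coor_enorm.
  have xj : `|x ord0 j| <= 2 * r.
    apply: le_trans (coor_enorm x j) _; rewrite -ler_sqr ?nnegrE ?enorm_ge0// enormE exprMn.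
    by apply: ltW; apply: lt_le_trans h4 _; lra.
  have th : `|theta (sqn x / r ^+ 2)| <= 1 by rewrite ger0_norm ?theta_ge0// theta_le1.
  move: (theta _) th => t th.
  rewrite !normrM normrN normfV (gtr0_norm r20) (gtr0_norm (_ : 0 < 2))//.
  apply: (@le_trans _ _ (enorm (v x) * (2 * (2 * r * (r ^- 2 * 1))))).
    have ri0 : 0 <= r ^- 2 by rewrite invr_ge0 ltW.
    have m0 : 0 <= r ^- 2 * `|t| by exact: mulr_ge0.
    apply: ler_pM => //; first by apply: mulr_ge0 => //; exact: mulr_ge0.
    by rewrite ler_wpM2l//; apply: ler_pM => //; rewrite ler_wpM2l.
  have rn : r != 0 by rewrite gt_eqF.
  by rewrite le_eqVlt; apply/orP; left; apply/eqP; field.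
have kr0 : 0 <= 4 * Nr / r by rewrite divr_ge0 ?mulr_ge0// ltW.
have ce := has_grad_continuous (energy_grad vC1).
have mg := itg_meas (Cc_itg cg).
(* The second bound is the lower bound on |v|: multiplied by |v|, it dominates |v| by its square. *)
have chiv x : chi x * enorm (v x) <= chi x * (Cb * b) /\ chi x * enorm (v x) <= r ^+ N * b / c1 * (chi x * e x).
  have [[chi0 _]|[chi1 h1 h2]] := shell_cases (r ^+ 2 / 4) (16 * r ^+ 2) x; rewrite /chi ?chi0 ?chi1.
    by rewrite !mul0r mulr0.
  have [h3 h4] := Hb x h1 h2; rewrite !mul1r; split => //.
  rewrite -enorm_energy expr2 mulrA ler_peMl ?enorm_ge0//.
  by rewrite mulrAC ler_pdivlMr// mul1r.
have chi2 x : chi x * chi x = chi x.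
  by have [[chi0 _]|[chi1 _ _]] := shell_cases (r ^+ 2 / 4) (16 * r ^+ 2) x; rewrite /chi ?chi0 ?chi1 ?mul0r ?mul1r.
have chi_ge0 x : 0 <= chi x by exact: shell_ge0.
have ice : itg (fun x => chi x * e x ^+ 2).
  apply: (itg_le _ (itgZ ((Cb * b) ^+ 2) ie)) => [|x].
    apply: measurable_funM; first exact: measurable_shell.
    by under eq_fun do rewrite expr2; apply: continuous_measurable; exact: ctsM.
  have [h _] := chiv x; have e0 := energy_ge0 v x.
  (* chi is replaced by chi^3: two factors go with |v|^2 into the pointwise bound, and one stays
     with the remaining energy. *)
  rewrite ger0_norm ?mulr_ge0// ?sqr_ge0// -{1}chi2 -{1}chi2 -enorm_energy.
  have w0 : 0 <= chi x * enorm (v x) by rewrite mulr_ge0 ?enorm_ge0.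
  have H : (chi x * enorm (v x)) ^+ 2 <= (chi x * (Cb * b)) ^+ 2.
    by apply: lerXn2r; rewrite ?nnegrE// mulr_ge0// mulr_ge0// ltW.
  rewrite (_ : chi x * chi x * chi x * _ = (chi x * enorm (v x)) ^+ 2 * enorm (v x) ^+ 2 * chi x); last by ring.
  apply: (@le_trans _ _ ((chi x * (Cb * b)) ^+ 2 * enorm (v x) ^+ 2 * chi x)).
    by rewrite ler_wpM2r// ler_wpM2r// sqr_ge0.
  rewrite (_ : _ * _ * chi x = (Cb * b) ^+ 2 * (chi x * chi x * chi x * enorm (v x) ^+ 2)); last by ring.
  by rewrite !chi2.
have B1 : Int (fun x => chi x * e x ^+ 2) <= (Cb * b) ^+ 2 * Q.
  rewrite -IntZ//; apply: Int_le => //; first exact: itgZ.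
  move=> x; have [h _] := chiv x.
  have [[c0 _]|[c1' _ _]] := shell_cases (r ^+ 2 / 4) (16 * r ^+ 2) x; rewrite /chi ?c0 ?c1'.
    by rewrite !mul0r mulr0.
  rewrite /chi c1' !mul1r in h; rewrite !mul1r expr2 ler_wpM2r ?energy_ge0// -enorm_energy.
  by apply: lerXn2r; rewrite ?nnegrE ?enorm_ge0// mulr_ge0// ltW.
have B2 : Int (fun x => g x ^+ 2) <= (4 * Nr / r) ^+ 2 * Q.
  rewrite -IntZ//; apply: Int_le; [|exact: itgZ|move=> x].
    by under eq_fun do rewrite expr2; exact: (Cc_itg (Cc_mulr cg cg.1)).
  rewrite -real_normK ?num_real// -(chi2 x) -enorm_energy.
  rewrite (_ : _ * _ = (4 * Nr / r * (chi x * enorm (v x))) ^+ 2); last by ring.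
  by apply: lerXn2r; rewrite ?nnegrE// mulr_ge0// mulr_ge0 ?enorm_ge0.
have B3 : Int (fun x => `|g x|) <= 4 * Nr / r * (r ^+ N * b / c1) * Q.
  rewrite -IntZ//; apply: Int_le; [exact: itg_abs (Cc_itg cg)|exact: itgZ|move=> x].
  apply: le_trans (gle x) _; rewrite -[leRHS]mulrA; apply: ler_wpM2l => //.
  exact: (chiv x).2.
have B4 : `|Int (fun x => e x * g x)| <= 4 * Nr / r * (Cb * b) * Q.
  rewrite -IntZ//; apply: Int_abs_le => [||x]; [exact: itg_meas (Cc_itg (Cc_mul ce cg))|exact: itgZ|].
  have e0 := energy_ge0 v x.
  rewrite normrM ger0_norm//; apply: (@le_trans _ _ (e x * (4 * Nr / r * (chi x * (Cb * b))))).
    by rewrite ler_wpM2l//; apply: le_trans (gle x) _; rewrite ler_wpM2l//; exact: (chiv x).1.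
  by rewrite le_eqVlt; apply/orP; left; apply/eqP; ring.
have rb0 : 0 < (r * b)^-1 by rewrite invr_gt0 mulr_gt0.
have gfar x y : chi x = 0 -> g (x + y) != 0 -> r / 2 <= enorm y.
  move=> chi0 gxy; have [[_ c0]|[_ h1 h2]] := shell_cases (r ^+ 2) (4 * r ^+ 2) (x + y).
    exfalso; move/eqP: gxy; apply; apply: big1 => j _; rewrite /dphi /gam theta_supp ?mulr0//.
    have [h|h] := leP (sqn (x + y)) (r ^+ 2); first by left; rewrite ler_pdivrMr// mul1r.
    have [h'|h'] := leP (4 * r ^+ 2) (sqn (x + y)); first by right; rewrite ler_pdivlMr.
    by exfalso; move/negP: c0; apply; rewrite (ltW h) (ltW h').
  have [[_ nx]|[c1' _ _]] := shell_cases (r ^+ 2 / 4) (16 * r ^+ 2) x; last first.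
    by move: chi0; rewrite /chi c1' => /eqP; rewrite oner_eq0.
  have lo : r <= enorm (x + y) by rewrite -ler_sqr ?nnegrE ?enorm_ge0 ?(ltW r0)// enormE.
  have hi : enorm (x + y) <= 2 * r.
    by rewrite -ler_sqr ?nnegrE ?enorm_ge0// enormE exprMn; apply: le_trans h2 _; lra.
  have t1 := enormD x y.
  have t2 : enorm x <= enorm (x + y) + enorm y.
    by have := enormD (x + y) (- y); rewrite addrK enormN.
  have [h|h] := ltP (enorm x) (r / 2); first by lra.
  have [h'|h'] := ltP (4 * r) (enorm x); first by lra.
  exfalso; move/negP: nx; apply; rewrite -enormE; apply/andP; split.
    have -> : r ^+ 2 / 4 = (r / 2) ^+ 2 by field.
    by rewrite ler_sqr ?nnegrE ?enorm_ge0// divr_ge0// ltW.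
  have -> : 16 * r ^+ 2 = (4 * r) ^+ 2 by ring.
  by rewrite ler_sqr ?nnegrE ?enorm_ge0// mulr_ge0// ltW.
have chi01 x : chi x = 0 \/ chi x = 1.
  by rewrite /chi; have [[-> _]|[-> _ _]] := shell_cases (r ^+ 2 / 4) (16 * r ^+ 2) x; [left|right].
(* The weight 1/(r b) balances lam b^2 against lam^-1 r^-2: both equal b / r. *)
have HP := HKp _ _ _ _ _ chi (r / 2) (r * b)^-1 FD rr0 sF gE gD chi01 ice (divr_gt0 r0 (ltr0n _ 2)) rb0 gfar.
have EI := energy_identity vC1 vdiv qloc vmom alphaE phiD sphi.
(* For this cutoff x . grad phi = -2 (s theta(s)) with s = |x|^2 / r^2. *)
pose h x := e x * (sqn x / r ^+ 2 * theta (sqn x / r ^+ 2)).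
have hE : (fun x => e x * \sum_j x ord0 j * (2 * (x ord0 j * gam (sqn x)))) = (fun x => -2 * h x).
  apply/funext => x; rewrite (eq_bigr (fun j => x ord0 j ^+ 2 * (2 * gam (sqn x)))); last first.
    by move=> j _; rewrite expr2; ring.
  by rewrite -mulr_suml -/(sqn x) /h /gam; ring.
have ih : itg h.
  have : itg (fun x => e x * \sum_j x ord0 j * (2 * (x ord0 j * gam (sqn x)))).
    apply: (@Cc_itg _ _ (2 * r)); apply: Cc_mul => //; apply: Cc_sum => j.
    apply: Cc_mul; first exact: cts_coor.
    exact: has_grad_Cc j phiD sphi.
  rewrite hE => /(itgZ (- 2^-1)); congr itg; apply/funext => x.
  by rewrite mulrA mulrNN mulVf ?mul1r.
rewrite hE (IntZ _ ih) -/l in EI.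
set QB := Int _.
have hB : 3 / 2 * t0 * QB <= Int h.
  rewrite -IntZ; last exact: shell_itg.
  apply: Int_le => //; first by apply: itgZ; exact: shell_itg.
  move=> x; have e0 := energy_ge0 v x.
  have hx : 0 <= sqn x / r ^+ 2 by rewrite divr_ge0 ?sqn_ge0// ltW.
  have [[-> _]|[-> h1 h2]] := shell_cases (3 / 2 * r ^+ 2) (3 * r ^+ 2) x.
    by rewrite mul0r mulr0 mulr_ge0// mulr_ge0// theta_ge0.
  rewrite mul1r mulrC ler_wpM2l//.
  have a1 : 3 / 2 <= sqn x / r ^+ 2 by rewrite ler_pdivlMr.
  have a2 : sqn x / r ^+ 2 <= 3 by rewrite ler_pdivrMr.
  by apply: ler_pM => //; [exact: ltW|exact: Ht0].
have r1 : r != 0 by rewrite gt_eqF.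
have b1 : b != 0 by rewrite gt_eqF.
have c11 : c1 != 0 by rewrite gt_eqF.
have rN : r ^+ N != 0 by rewrite expf_neq0.
have HP2 : `|Int (fun x => q x * g x)| <= Kp * (Cb ^+ 2 + 16 * Nr ^+ 2 + 2 ^+ N * (4 * Nr) / c1) * (b / r) * Q.
  apply: le_trans HP _; rewrite -!mulrA; apply: ler_wpM2l => //.
  rewrite invrK.
  apply: (@le_trans _ _ ((r * b)^-1 * ((Cb * b) ^+ 2 * Q) + r * b * ((4 * Nr / r) ^+ 2 * Q) +
      (r / 2) ^- N * (4 * Nr / r * (r ^+ N * b / c1) * Q))).
    apply: lerD; first apply: lerD.
    - by rewrite ler_wpM2l// ltW.
    - by rewrite ler_wpM2l// mulr_ge0// ltW.
    - by rewrite ler_wpM2l// invr_ge0 exprn_ge0// divr_ge0// ltW.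
  rewrite [(r / 2) ^+ N]expr_div_n le_eqVlt; apply/orP; left; apply/eqP.
  have tN : (2 : R) ^+ N != 0 by rewrite expf_neq0.
  by move: (r ^+ N) (2 ^+ N) rN tN => rr tt rN tN; field; rewrite rN tN r1 b1 c11.
have : l * (3 / 2 * t0 * QB) <= K1 * (b / r) * Q.
  apply: (@le_trans _ _ (l * Int h)); first by rewrite ler_wpM2l// ltW.
  have -> : l * Int h = - (2^-1 * Int (fun x => e x * g x) + Int (fun x => q x * g x)).
    by rewrite EI; field.
  have n1 := ler_norm (- Int (fun x => e x * g x)); have n2 := ler_norm (- Int (fun x => q x * g x)).
  rewrite !normrN in n1 n2.
  rewrite /K1 mulrDl mulrDl.
  have -> : 2 * Nr * Cb * (b / r) * Q = 2^-1 * (4 * Nr / r * (Cb * b) * Q) by field.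
  lra.
rewrite (_ : l * _ = 3 / 2 * (l * t0) * QB); last by ring.
have p0 : 0 < 3 / 2 * (l * t0) by rewrite mulr_gt0// ?divr_gt0// mulr_gt0.
rewrite -ler_pdivlMl// => /le_trans; apply.
by rewrite le_eqVlt; apply/orP; left; apply/eqP; ring.
Qed.

End decay.

(** * Iteration and contradiction *)

Section iteration.
Context {R : realType}.

(** Each application of the hypothesis gains one more factor s^-d, starting from the trivial bound
    E. *)
Lemma decay_iteration (Q : R -> R) (K E d s0 : R) : 0 <= K -> 0 < s0 -> 0 < d ->
  (forall s, 0 <= Q s) -> (forall s, Q s <= E) ->
  (forall s, s0 <= s -> Q s <= K * s `^ (- d) * \sum_(k < 7) Q (2 ^+ k * (s / 8))) ->
  forall n : nat, exists C sn : R, [/\ 0 <= C, 0 < sn &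
    forall s, sn <= s -> Q s <= C * s `^ (- (n%:R * d))].
Proof.
move=> K0 s00 d0 Q0 QE H; elim => [|n [C [sn [C0 sn0 ih]]]].
  exists E, 1; split => // [|s _]; first exact: le_trans (Q0 0) (QE 0).
  by rewrite mul0r oppr0 powRr0 mulr1.
pose p := n%:R * d; have p0 : 0 <= p by rewrite mulr_ge0// ltW.
(* Seven shells, the innermost of which starts at s / 8: this costs 8^p, and is the reason for the
   threshold 8 [sn] below. *)
pose C' := 7 * (C * 8 `^ p).
have C'0 : 0 <= C' by rewrite mulr_ge0// mulr_ge0// powR_ge0.
exists (K * C'), (s0 + 8 * sn); split; first exact: mulr_ge0.
  by rewrite addr_gt0// mulr_gt0.
move=> s hs.
have [hs0 hsn] : s0 <= s /\ 8 * sn <= s by split; lra.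
have s_gt0 : 0 < s by exact: lt_le_trans hs0.
apply: le_trans (H s hs0) _.
have -> : s `^ (- (n.+1%:R * d)) = s `^ (- d) * s `^ (- p).
  by rewrite -powRD ?(gt_eqF s_gt0) ?implybT//; congr (_ `^ _); rewrite /p -natr1; ring.
rewrite (_ : K * C' * _ = K * s `^ (- d) * (C' * s `^ (- p))); last by ring.
apply: ler_wpM2l; first by rewrite mulr_ge0// powR_ge0.
rewrite /C' -mulrA; apply: (@le_trans _ _ (\sum_(k < 7) (C * 8 `^ p * s `^ (- p)))); last first.
  by rewrite sumr_const card_ord -[leLHS]mulr_natl.
apply: ler_sum => k _.
have t8 : s / 8 <= 2 ^+ k * (s / 8).
  by rewrite ler_peMl ?divr_ge0 ?(ltW s_gt0)// exprn_ege1// ler1n.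
apply: (@le_trans _ _ (C * (2 ^+ k * (s / 8)) `^ (- p))).
  by apply: ih; apply: le_trans t8; rewrite ler_pdivlMr// mulrC.
rewrite -mulrA; apply: ler_wpM2l => //.
have s8 : 0 < s / 8 by rewrite divr_gt0.
apply: (@le_trans _ _ ((s / 8) `^ (- p))).
  rewrite !powRN lef_pV2 ?posrE ?powR_gt0//; last exact: lt_le_trans t8.
  by rewrite ge0_ler_powR// ?nnegrE ?(ltW s8)// (le_trans _ t8)// ltW.
rewrite powRM ?(ltW s_gt0) ?invr_ge0// mulrC; apply: ler_wpM2r; first exact: powR_ge0.
by rewrite -powR_inv1// -powRrM mulN1r opprK.
Qed.

End iteration.

Section shell_lemmas.
Context {R : realType} {N : nat}.
Local Notation X := 'rV[R]_N.
Local Notation Int := (@Int R N).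
Local Notation itg := (@itg R N).

(** The shell contains a unit cube, of volume 2^N. *)
Lemma shell_lower (f : X -> R) (s m : R) : (0 < N)%N -> itg f -> (forall x, 0 <= f x) -> 0 <= m ->
  0 <= s -> (5 * N%:R) ^+ 2 <= s ->
  (forall x, s <= sqn x -> sqn x <= 2 * s -> m <= f x) ->
  m * 2 ^+ N <= Int (fun x => shell s (2 * s) x * f x).
Proof.
move=> N0 fi f0 m0 s0 sN H.
pose t := Num.sqrt s; have t0 : 0 <= t by exact: sqrtr_ge0.
have tE : t ^+ 2 = s by rewrite sqr_sqrtr.
have tN : 5 * N%:R <= t by rewrite -ler_sqr ?nnegrE// ?mulr_ge0// tE.
(* The cube lies within Euclidean distance N <= t / 5 of x0, so its points have norm between t and 7
   t / 5, and (7 / 5)^2 < 2. *)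
pose x0 : X := (6 / 5 * t) *: delta_mx ord0 (Ordinal N0).
have x0E : enorm x0 = 6 / 5 * t.
  rewrite /enorm (bigD1 (Ordinal N0))//= big1 => [|j /negbTE ji].
    by rewrite !mxE !eqxx mulr1 addr0 sqrtr_sqr ger0_norm// mulr_ge0// divr_ge0.
  by rewrite !mxE ji andbF mulr0 expr0n.
have ic := itg_cind (N := N) (1 : R).
have -> : m * 2 ^+ N = Int (fun x => m * cind 1 (x - x0)).
  rewrite IntZ; last exact: (itg_shift (- x0) ic).
  by rewrite (Int_shift (- x0) ic) Int_cind// mulr1.
apply: Int_le; [by apply: itgZ; exact: (itg_shift (- x0) ic)|exact: shell_itg|move=> x].
rewrite /cind; have [xx|_] := leP `|x - x0| 1; last by rewrite mulr0 mulr_ge0 ?shell_ge0.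
have d1 : enorm (x - x0) <= N%:R by apply: le_trans (enorm_le_norm _) _; rewrite ler_piMr.
have h1 : enorm x <= enorm x0 + enorm (x - x0) by have := enormD x0 (x - x0); rewrite subrKC.
have h2 : enorm x0 <= enorm x + enorm (x - x0).
  by have := enormD x (x0 - x); rewrite subrKC -(enormN (x0 - x)) opprB.
rewrite x0E in h1 h2.
have l1 : t <= enorm x by lra.
have l2 : enorm x <= 7 / 5 * t by lra.
have a1 : s <= sqn x by rewrite -enormE -tE ler_sqr ?nnegrE ?enorm_ge0.
have a2 : sqn x <= 2 * s.
  rewrite -enormE; apply: (@le_trans _ _ ((7 / 5 * t) ^+ 2)).
    by rewrite ler_sqr ?nnegrE ?enorm_ge0// mulr_ge0// divr_ge0.
  by rewrite exprMn tE ler_wpM2r//; lra.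
by rewrite shell_in// mul1r mulr1 H.
Qed.

(** Seven doublings lead from s / 8 to 16 s. *)
Lemma shell_cover (f : X -> R) (a b s : R) : itg f -> (forall x, 0 <= f x) ->
  0 < s -> s / 8 <= a -> b <= 16 * s ->
  Int (fun x => shell a b x * f x) <=
    \sum_(k < 7) Int (fun x => shell (2 ^+ k * (s / 8)) (2 * (2 ^+ k * (s / 8))) x * f x).
Proof.
move=> fi f0 s0 sa bs.
rewrite -(@Int_sum R N _ (fun (k : 'I_7) x => shell (2 ^+ k * (s / 8)) (2 * (2 ^+ k * (s / 8))) x * f x)) => [|k]; last exact: shell_itg.
apply: Int_le; [exact: shell_itg|by apply: itg_sum => k; exact: shell_itg|move=> x].
rewrite -mulr_suml ler_wpM2r//.
have [[-> _]|[-> h1 h2]] := shell_cases a b x; first by apply: sumr_ge0 => k _; exact: shell_ge0.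
suff [k hk] : exists k : 'I_7, 2 ^+ k * (s / 8) <= sqn x <= 2 * (2 ^+ k * (s / 8)).
  rewrite (bigD1 k)//= shell_in; [|by case/andP: hk|by case/andP: hk].
  by rewrite lerDl; apply: sumr_ge0 => j _; exact: shell_ge0.
have h3 : s / 8 <= sqn x by lra.
have h4 : sqn x <= 16 * s by lra.
have [u|u] := leP (sqn x) (s / 4).
  by exists (@Ordinal 7 0 isT); rewrite /=; apply/andP; split; lra.
have [u1|u1] := leP (sqn x) (s / 2).
  by exists (@Ordinal 7 1 isT); rewrite /=; apply/andP; split; lra.
have [u2|u2] := leP (sqn x) s.
  by exists (@Ordinal 7 2 isT); rewrite /=; apply/andP; split; lra.
have [u3|u3] := leP (sqn x) (2 * s).
  by exists (@Ordinal 7 3 isT); rewrite /=; apply/andP; split; lra.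
have [u4|u4] := leP (sqn x) (4 * s).
  by exists (@Ordinal 7 4 isT); rewrite /=; apply/andP; split; lra.
have [u5|u5] := leP (sqn x) (8 * s).
  by exists (@Ordinal 7 5 isT); rewrite /=; apply/andP; split; lra.
by exists (@Ordinal 7 6 isT); rewrite /=; apply/andP; split; lra.
Qed.

End shell_lemmas.

Section contradiction.
Context {R : realType} {N : nat}.
Local Notation X := 'rV[R]_N.
Local Notation Int := (@Int R N).
Local Notation itg := (@itg R N).
Context (v : X -> X) (q : X -> R) (alpha : R).
Context (N_gt1 : (1 < N)%N) (vC1 : C1 v) (vdiv : divergence_free v) (qloc : loc_integrable q).
Context (vmom : profile_momentum alpha v q) (vL2 : itg (energy v)) (alphaE : alpha = N%:R / 2).
Local Notation e := (energy v).

(** On the shell s <= |x|^2 <= 2 s the lower bound makes the energy at least of order s^-(N+1),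
    while the iteration makes it O(s^-(N+2)). *)
Lemma no_decaying_profile (delta C c M : R) : 0 < delta -> delta <= 1 -> 0 < C -> 0 < c -> 1 <= M ->
  (forall y : X, M <= enorm y ->
     c <= enorm (v y) * enorm y `^ (N%:R + 1 - delta) /\
     enorm (v y) <= C * enorm y `^ (1 - delta)) -> False.
Proof.
move=> delta0 delta1 C0 c0 M1 H.
have M0 : 0 < M by exact: lt_le_trans M1.
have N0 : (0 < N)%N by exact: ltnW.
have c10 : 0 < c / 4 ^+ N.+1 by rewrite divr_gt0// exprn_gt0.
(* The factors 4 and 4^(N+1) come from replacing |x| by r in the two bounds, as |x| <= 4 r on the
   large shell. *)
have [K K0 HK] := shell_decay N_gt1 vC1 vdiv qloc vmom vL2 alphaE (mulr_gt0 (ltr0n R 4) C0) c10.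
pose Q s := Int (fun x => shell s (2 * s) x * e x).
have Q0 s : 0 <= Q s by apply: Int_ge0 => x; rewrite mulr_ge0 ?shell_ge0 ?energy_ge0.
have QE s : Q s <= Int e.
  apply: Int_le => //; [exact: shell_itg|move=> x].
  have [[-> _]|[-> _ _]] := shell_cases s (2 * s) x; first by rewrite mul0r energy_ge0.
  by rewrite mul1r.
(* Shells are indexed by the squared radius, which halves the exponent. *)
pose d := delta / 2; have d0 : 0 < d by rewrite divr_gt0.
pose K' := K * (2 / 3) `^ (- d).
have K'0 : 0 <= K' by rewrite mulr_ge0// powR_ge0.
have step s : 6 * M ^+ 2 <= s -> Q s <= K' * s `^ (- d) * \sum_(k < 7) Q (2 ^+ k * (s / 8)).
  move=> hs; have M20 : 1 <= M ^+ 2 by rewrite exprn_ege1.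
  have s0 : 0 < s by lra.
  (* Chosen so that the inner shell is exactly [s, 2 s]. The outer one is [s / 6, 32 s / 3], inside
     [s / 8, 16 s], and s >= 6 M^2 places it beyond radius M. *)
  pose r := Num.sqrt (2 / 3 * s).
  have s230 : 0 < 2 / 3 * s by rewrite mulr_gt0// divr_gt0.
  have rE : r ^+ 2 = 2 / 3 * s by rewrite sqr_sqrtr// ltW.
  have r0 : 0 < r by rewrite sqrtr_gt0.
  have b0 : 0 < r `^ (1 - delta) by exact: powR_gt0.
  have := HK r (r `^ (1 - delta)) r0 b0.
  have -> : 3 / 2 * r ^+ 2 = s by rewrite rE; field.
  have -> : 3 * r ^+ 2 = 2 * s by rewrite rE; field.
  have -> : r `^ (1 - delta) / r = (2 / 3) `^ (- d) * s `^ (- d).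
    rewrite -powRM ?divr_ge0 ?(ltW s0)// -rE -powR_mulrn ?(ltW r0)// -powRrM.
    rewrite -powR_inv1 ?(ltW r0)// -powRD ?(gt_eqF r0) ?implybT//.
    by congr (_ `^ _); rewrite /d; field.
  move=> HQ; apply: (@le_trans _ _ (K * ((2 / 3) `^ (- d) * s `^ (- d)) *
      Int (fun x => shell (r ^+ 2 / 4) (16 * r ^+ 2) x * e x))).
    apply: HQ => x h1 h2.
    have y0 := enorm_ge0 x.
    have lo : M <= enorm x.
      rewrite -ler_sqr ?nnegrE ?(ltW M0)// enormE; apply: le_trans h1; rewrite rE; lra.
    have hi : enorm x <= 4 * r.
      by rewrite -ler_sqr ?nnegrE ?mulr_ge0 ?(ltW r0)// enormE exprMn; apply: le_trans h2 _; rewrite -natrX.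
    have [H1 H2] := H x lo.
    have mono p : 0 <= p -> p <= N.+1%:R -> enorm x `^ p <= 4 ^+ N.+1 * r `^ p.
      move=> p0 pN; apply: (@le_trans _ _ ((4 * r) `^ p)).
        by apply: ge0_ler_powR => //; rewrite nnegrE// mulr_ge0// ltW.
      rewrite powRM ?(ltW r0)//; apply: ler_wpM2r; first exact: powR_ge0.
      by rewrite -powR_mulrn// ler_powR// ler1n.
    have hp : r ^+ N * r `^ (1 - delta) = r `^ (N%:R + 1 - delta).
      by rewrite -powR_mulrn ?(ltW r0)// -powRD ?(gt_eqF r0) ?implybT// addrA.
    split.
      rewrite hp ler_pdivrMr ?exprn_gt0//; apply: le_trans H1 _.
      rewrite mulrAC [leRHS]mulrC; apply: ler_wpM2l; first exact: enorm_ge0.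
      rewrite mulrC; apply: mono; rewrite -?natr1; last by lra.
      by have := ler0n R N; lra.
    apply: le_trans H2 _; rewrite -mulrA mulrCA; apply: ler_wpM2l; first exact: ltW.
    apply: (@le_trans _ _ ((4 * r) `^ (1 - delta))).
      by apply: ge0_ler_powR; rewrite ?subr_ge0// nnegrE// mulr_ge0// ltW.
    rewrite powRM ?(ltW r0)//; apply: ler_wpM2r; first exact: powR_ge0.
    by rewrite -[leRHS]powRr1// ler_powR ?ler1n//; lra.
  rewrite /K' mulrA; apply: ler_wpM2l; first by rewrite mulr_ge0 ?mulr_ge0// powR_ge0.
  by apply: shell_cover => //; [exact: energy_ge0| |]; rewrite rE; lra.
have s00 : 0 < 6 * M ^+ 2 by rewrite mulr_gt0// exprn_gt0.
pose n := (Num.truncn ((N%:R + 2) / d)).+1.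
have nd : N%:R + 2 <= n%:R * d by rewrite -ler_pdivrMr// ltW// truncnS_gt.
have [Cn [sn [Cn0 sn0 Hn]]] := decay_iteration K'0 s00 d0 Q0 QE step n.
(* The coefficient of s^-(N+1) in the lower bound: |v|^2 >= c^2 / (2 s)^(N+1) on a cube of volume
   2^N. The last summand of s below makes m s exceed [Cn]. *)
pose m := c ^+ 2 * 2 ^+ N / 2 ^+ N.+1.
have m0 : 0 < m by rewrite divr_gt0// ?mulr_gt0 ?exprn_gt0.
pose s := sn + M ^+ 2 + (5 * N%:R) ^+ 2 + 1 + Cn / m.
have Cm0 : 0 <= Cn / m by rewrite divr_ge0// ltW.
have M20 : 0 <= M ^+ 2 by exact: sqr_ge0.
have N20 : 0 <= (5 * N%:R) ^+ 2 :> R by exact: sqr_ge0.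
have [s1 ss sM sN sC] : [/\ 1 <= s, sn <= s, M ^+ 2 <= s, (5 * N%:R) ^+ 2 <= s & Cn / m < s].
  by rewrite /s; split; lra.
have s0 : 0 < s by exact: lt_le_trans s1.
have up : Q s <= Cn * s ^- N.+2.
  apply: le_trans (Hn s ss) _; apply: ler_wpM2l => //.
  rewrite -powR_mulrn ?(ltW s0)// -powRN ler_powR// lerN2.
  by apply: le_trans nd; rewrite -!natr1; lra.
have lower : c ^+ 2 / (2 * s) ^+ N.+1 * 2 ^+ N <= Q s.
  apply: shell_lower => //; [exact: energy_ge0| |exact: ltW|move=> x h1 h2].
    by rewrite divr_ge0 ?sqr_ge0// exprn_ge0// mulr_ge0// ltW.
  have y0 := enorm_ge0 x.
  have lo : M <= enorm x by rewrite -ler_sqr ?nnegrE ?(ltW M0)// enormE; lra.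
  have [H1 _] := H x lo.
  have y1 : 1 <= enorm x by exact: le_trans lo.
  have H2 : c <= enorm (v x) * enorm x ^+ N.+1.
    apply: le_trans H1 _; rewrite ler_wpM2l ?enorm_ge0// -powR_mulrn// ler_powR// -natr1; lra.
  rewrite ler_pdivrMr ?exprn_gt0 ?mulr_gt0// -enorm_energy.
  apply: (@le_trans _ _ ((enorm (v x) * enorm x ^+ N.+1) ^+ 2)).
    by apply: lerXn2r; rewrite ?nnegrE ?(ltW c0)// mulr_ge0 ?enorm_ge0// exprn_ge0.
  rewrite exprMn ler_wpM2l ?sqr_ge0// -exprM mulnC exprM enormE.
  by apply: lerXn2r; rewrite ?nnegrE ?sqn_ge0// mulr_ge0// ltW.
have := le_trans lower up.
rewrite (_ : c ^+ 2 / (2 * s) ^+ N.+1 * 2 ^+ N = m * s ^- N.+1); last first.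
  by rewrite /m [(2 * s) ^+ _]exprMn invfM; ring.
have -> : s ^- N.+2 = s^-1 * s ^- N.+1 by rewrite -invfM -exprS.
rewrite mulrA ler_pM2r ?invr_gt0 ?exprn_gt0// ler_pdivlMr// => ms.
by move: sC; rewrite ltr_pdivrMr// mulrC ltNge ms.
Qed.

End contradiction.

Theorem theorem3p1 (R : realType) (N : nat) (hN : (2 <= N)%N) (alpha : R)
    (halpha : alpha = N%:R / 2)
    (v : 'rV[R]_N -> 'rV[R]_N) (q : 'rV[R]_N -> R)
    (hprofile : self_similar_profile alpha v q)
    (hL2 : square_integrable v) (hC1 : C1 v)
    (hq : associated_pressure v q)
    (hbounds : exists delta C c : R, [/\ 0 < delta, 0 < C, 0 < c &
      exists M : R, forall y : 'rV[R]_N, M <= enorm y ->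
        c / enorm y `^ (N%:R + 1 - delta) <= enorm (v y) <=
        C * enorm y `^ (1 - delta)]) :
  forall y : 'rV[R]_N, v y = 0.
Proof.
exfalso.
have [loc_v loc_vv loc_q vdiv vmom] := hprofile.
have [delta [C [c [delta0 C0 c0 [M hM]]]]] := hbounds.
have vL2 : itg (energy v).
  by apply: itg_sum => i; exact: Lfun2_integrable_sqr (hL2 i).
(* Lowering delta to at most 1 weakens both bounds once |y| >= 1, and makes 1 - delta nonnegative,
   so that the powers of |y| are monotone. *)
have dmin0 : 0 < Num.min delta 1 by rewrite lt_min delta0 ltr01.
have dmin1 : Num.min delta 1 <= 1 by rewrite ge_min lexx orbT.
have dmin : Num.min delta 1 <= delta by rewrite ge_min lexx.
have M1 : 1 <= Num.max 1 M by rewrite le_max lexx.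
apply: (no_decaying_profile hN hC1 vdiv loc_q vmom vL2 halpha dmin0 dmin1 C0 c0 M1) => y hy.
have y1 : 1 <= enorm y by exact: le_trans hy.
have yM : M <= enorm y by apply: le_trans hy; rewrite le_max lexx orbT.
have y0 : 0 < enorm y by exact: lt_le_trans y1.
have /andP[h1 h2] := hM y yM; split.
  move: h1; rewrite ler_pdivrMr ?powR_gt0// => /le_trans; apply.
  by rewrite ler_wpM2l ?enorm_ge0// ler_powR// lerB ?lexx.
by apply: le_trans h2 _; rewrite ler_wpM2l ?(ltW C0)// ler_powR// lerB ?lexx.
Qed.
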